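(* Let $\mathcal{L}(s)$ be an element of the Selberg class $\mathcal{SP}$ of functions with a polynomial Euler product of order $m$, and let $\mathrm{d}_{\mathcal{L}}$ be its degree. Write $s=\sigma+\mathrm{i}t$. (First part.) There exist $C>0$, $\ell>0$, $c\geq 1$ and $T\geq e$ such that $$\log|\mathcal{L}(s)| \leq \frac14 \mathrm{d}_{\mathcal{L}}\log(c|t|)+\ell\log\log(c|t|)+\log^{+}C \qquad (\ast)$$ for all $s$ with $|t|\geq T$, $\sigma\geq 1/2$ and $\mathcal{L}(s)\neq 0$. (Second part.) With $C,\ell,c,T$ as in $(\ast)$, there exist positive and computable constants $a_1,b_1,a_2,b_2$ which depend only on $\mathrm{d}_{\mathcal{L}},m,\ell,C$, positive constants $A,B$, and $t_0=t_0(c,T)>0$, such that the following holds. If $|t|\geq t_0$ and there exists $C_3\geq 1$ such that $\mathcal{L}(z)\neq 0$ for all $z\in\mathscr{R}(C_3,c,t)$, then $$|\log\mathcal{L}(s)|\leq a_1\left(b_1\log(c|t|)\right)^{2(1-\sigma)}\log\log(c|t|),$$ $$\left|\frac{\mathcal{L}'}{\mathcal{L}}(s)\right|\leq a_2\left(b_2\log(c|t|)\right)^{2(1-\sigma)}\left(\log\log(c|t|)\right)^2$$ for all $\sigma\in\mathscr{S}(A,B,c,t)$.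
   Context: The class $\mathcal{SP}$ (Selberg class of functions with a polynomial Euler product) consists of Dirichlet series $\mathcal{L}(s)=\sum_{n\ge1}a(n)n^{-s}$ satisfying: (1) Ramanujan hypothesis: $a(n)\ll_{\varepsilon}n^{\varepsilon}$ for every $\varepsilon>0$ (so the series converges absolutely for $\sigma>1$). (2) Analytic continuation: there is an integer $k\ge0$ such that $(s-1)^k\mathcal{L}(s)$ is an entire function of finite order. (3) Functional equation: $\Lambda_{\mathcal{L}}(s)=\omega\overline{\Lambda_{\mathcal{L}}(1-\bar s)}$, where $\Lambda_{\mathcal{L}}(s)=\mathcal{L}(s)Q^s\prod_{j=1}^{f}\Gamma(\lambda_js+\mu_j)$ with $Q,\lambda_j>0$ real, $\mu_j,\omega\in\mathbb{C}$, $\Re\{\mu_j\}\ge0$, $|\omega|=1$. (4) Polynomial Euler product of order $m$: there is $m\in\mathbb{N}$ and for every prime $p$ numbers $\alpha_j(p)\in\mathbb{C}$, $1\le j\le m$, such that $\mathcal{L}(s)=\prod_p\prod_{j=1}^m(1-\alpha_j(p)p^{-s})^{-1}$. The degree is $\mathrm{d}_{\mathcal{L}}=2\sum_{j=1}^f\lambda_j$ (well defined). $\log^{+}u=\max\{0,\log u\}$ for $u>0$. For $C_3>0$ and $|t|\ge e$, $$\mathscr{R}(C_3,c,t)=\left\{w\in\mathbb{C}:\Re\{w\}>\tfrac12,\ |\Im\{w\}-t|\le C_3\log\log(c(|t|+1))+3\right\},$$ and $$\mathscr{S}(A,B,c,t)=\left[\frac12+\frac{A}{\log\log(c|t|)},\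 1+\frac{B}{\log\log(c|t|)}\right].$$ $\log\mathcal{L}(s)$ denotes the branch which for $\sigma>1$ equals $\sum_p\sum_{k\ge1}\sum_{j=1}^m\frac{\alpha_j(p)^k}{kp^{ks}}$, continued holomorphically into the zero-free region under consideration. *)

(* Defs.v *)
From Stdlib Require Import Reals ZArith Znumtheory List.
From Coquelicot Require Import Coquelicot.
Import ListNotations.
Local Open Scope R_scope.

Definition Cdifferentiable (f : C -> C) (z : C) : Prop :=
  ex_derive (K := C_AbsRing) (V := C_NormedModule) f z.

Definition entire (f : C -> C) : Prop := forall z, Cdifferentiable f z.

Definition finite_order (f : C -> C) : Prop :=
  exists rho r0 : R, 0 < r0 /\
    forall z, r0 <= Cmod z -> Cmod (f z) <= exp (Rpower (Cmod z) rho).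

Definition Cexp (z : C) : C := (exp (Re z) * cos (Im z), exp (Re z) * sin (Im z)).

(* Meaningful for [0 < x]. *)
Definition RCpow (x : R) (s : C) : C := Cexp (s * ln x)%C.

Fixpoint Cprod (u : nat -> C) (n : nat) : C :=
  match n with
  | O => 1
  | S n' => (Cprod u n' * u n)%C
  end.

(* The componentwise limit; it is the limit of [u] whenever [u] converges. *)
Definition CLim_seq (u : nat -> C) : C :=
  (real (Lim_seq (fun n => Re (u n))), real (Lim_seq (fun n => Im (u n)))).

(* Gauss's limit n! n^z / (z (z+1) ... (z+n)), which converges to Gamma(z) at
   every z other than the poles 0, -1, -2, ... *)
Definition CGamma (z : C) : C :=
  CLim_seq (fun n =>
    (INR (fact n) * RCpow (INR n) z
       / (z * Cprod (fun k => z + INR k) n))%C).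

Definition Gamma_pole (z : C) : Prop := exists n : nat, z = RtoC (- INR n).

Definition is_prime (p : nat) : Prop := prime (Z.of_nat p).

Definition is_prime_dec (p : nat) : {is_prime p} + {~ is_prime p} :=
  prime_dec (Z.of_nat p).

Definition dirichlet_term (a : nat -> C) (s : C) (n : nat) : C :=
  (a n / RCpow (INR n) s)%C.

Definition ramanujan (a : nat -> C) : Prop :=
  forall eps : R, 0 < eps -> exists K : R,
    forall n : nat, (1 <= n)%nat -> Cmod (a n) <= K * Rpower (INR n) eps.

(* For [0 < k] the value of [L] at 1 is unconstrained: there [L] may have a
   pole, and [F] extends [(s-1)^k L(s)] over the removable singularity. *)
Definition continuation (L : C -> C) : Prop :=
  exists (k : nat) (F : C -> C), entire F /\ finite_order F /\
    forall s : C, s <> RtoC 1 \/ k = 0%nat -> F s = ((s - 1) ^ k * L s)%C.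

Definition completed (L : C -> C) (Q : R) (f : nat) (lambda : nat -> R)
    (mu : nat -> C) (s : C) : C :=
  (L s * RCpow Q s * Cprod (fun j => CGamma (lambda j * s + mu j)) f)%C.

Definition completed_regular (f : nat) (lambda : nat -> R) (mu : nat -> C)
    (s : C) : Prop :=
  s <> RtoC 1 /\
  forall j : nat, (1 <= j <= f)%nat -> ~ Gamma_pole (lambda j * s + mu j)%C.

(* An identity of meromorphic functions: it is required at every point at which
   all factors on both sides are finite. *)
Definition functional_equation (L : C -> C) (Q : R) (f : nat)
    (lambda : nat -> R) (mu : nat -> C) (omega : C) : Prop :=
  forall s : C,
    completed_regular f lambda mu s ->
    completed_regular f lambda mu (1 - Cconj s)%C ->
    completed L Q f lambda mu s
      = (omega * Cconj (completed L Q f lambda mu (1 - Cconj s)))%C.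

Definition euler_factor (m : nat) (alpha : nat -> nat -> C) (s : C) (p : nat) : C :=
  Cprod (fun j => / (1 - alpha j p / RCpow (INR p) s))%C m.

(* The first conjunct says that the inverses in the product are meaningful. *)
Definition euler_product (L : C -> C) (m : nat) (alpha : nat -> nat -> C) : Prop :=
  forall s : C, 1 < Re s ->
    (forall p j : nat, is_prime p -> (1 <= j <= m)%nat ->
       (1 - alpha j p / RCpow (INR p) s)%C <> RtoC 0) /\
    filterlim
      (Cprod (fun p => if is_prime_dec p then euler_factor m alpha s p else RtoC 1))
      eventually (locally (L s)).

(* An element of the Selberg class with a polynomial Euler product, together
   with its Dirichlet coefficients, its functional equation and its Euler
   product. Families indexed by 1, ..., n are functions on [nat]; their other
   values are irrelevant. *)
Record selbergSP : Type := SelbergSP {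
  lfun :> C -> C;
  coef : nat -> C;
  fe_size : nat;
  fe_Q : R;
  fe_lambda : nat -> R;
  fe_mu : nat -> C;
  fe_omega : C;
  order : nat;
  alpha : nat -> nat -> C;
  coef_ramanujan : ramanujan coef;
  lfun_series : forall s : C, 1 < Re s ->
    is_series (K := C_AbsRing) (V := C_NormedModule)
      (fun i => dirichlet_term coef s (S i)) (lfun s);
  lfun_continuation : continuation lfun;
  fe_Q_pos : 0 < fe_Q;
  fe_lambda_pos : forall j, (1 <= j <= fe_size)%nat -> 0 < fe_lambda j;
  fe_mu_ge0 : forall j, (1 <= j <= fe_size)%nat -> 0 <= Re (fe_mu j);
  fe_omega_unit : Cmod fe_omega = 1;
  lfun_equation :
    functional_equation lfun fe_Q fe_size fe_lambda fe_mu fe_omega;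
  order_pos : (1 <= order)%nat;
  lfun_euler : euler_product lfun order alpha
}.

Definition degree (L : selbergSP) : R := 2 * sum_n_m (fe_lambda L) 1 (fe_size L).

Definition logp (u : R) : R := Rmax 0 (ln u).

Definition growth_bound (L : selbergSP) (C0 l c T : R) : Prop :=
  forall s : C, T <= Rabs (Im s) -> 1 / 2 <= Re s -> L s <> RtoC 0 ->
    ln (Cmod (L s)) <=
      1 / 4 * degree L * ln (c * Rabs (Im s))
      + l * ln (ln (c * Rabs (Im s))) + logp C0.

Definition regionR (C3 c t : R) (w : C) : Prop :=
  1 / 2 < Re w /\ Rabs (Im w - t) <= C3 * ln (ln (c * (Rabs t + 1))) + 3.

Definition intervalS (A B c t sigma : R) : Prop :=
  1 / 2 + A / ln (ln (c * Rabs t)) <= sigma <= 1 + B / ln (ln (c * Rabs t)).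

(* [v] is the sum over p, k >= 1 and j of alpha_j(p)^k / (k p^(ks)). *)
Definition log_euler_sum (L : selbergSP) (s v : C) : Prop :=
  exists u : nat -> C,
    (forall p, is_prime p ->
       is_series (K := C_AbsRing) (V := C_NormedModule)
         (fun i => let k := S i in
            sum_n_m (G := C_AbelianMonoid)
              (fun j => alpha L j p ^ k / (INR k * RCpow (INR p) (INR k * s)))%C
              1 (order L))
         (u p)) /\
    is_series (K := C_AbsRing) (V := C_NormedModule)
      (fun p => if is_prime_dec p then u p else RtoC 0) v.

(* [g] is the branch of log L on the interior of [D], slit along (-oo, 1]; the
   slit matters only if [D] reaches the possible pole of [L] at 1. In a region
   such as [regionR C3 c t], which is closed under moving to the right, this
   determines [g] on the slit interior. *)
Definition log_branch (L : selbergSP) (D : C -> Prop) (g : C -> C) : Prop :=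
  (forall w : C, D w -> 1 < Re w -> log_euler_sum L w (g w)) /\
  (forall w : C, locally w D -> ~ (Im w = 0 /\ Re w <= 1) -> Cdifferentiable g w).

(* Total recursive functions, with an argument list padded by zeros. *)
Inductive recursive : (list nat -> nat) -> Prop :=
| rec_zero : recursive (fun _ => 0%nat)
| rec_succ : recursive (fun v => S (nth 0 v 0%nat))
| rec_proj i : recursive (fun v => nth i v 0%nat)
| rec_comp f gs : recursive f -> List.Forall recursive gs ->
    recursive (fun v => f (map (fun g => g v) gs))
| rec_prim f g : recursive f -> recursive g ->
    recursive (fun v =>
      nat_rect (fun _ => nat) (f (tl v)) (fun k r => g (k :: r :: tl v))
        (nth 0 v 0%nat))
| rec_min f g : recursive f ->
    (forall v, f (g v :: v) = 0%nat /\
       forall k, (k < g v)%nat -> f (k :: v) <> 0%nat) ->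
    recursive g.

Definition approximates (k p : nat) (x : R) : Prop :=
  Rabs (x - INR p / 2 ^ k) <= / 2 ^ k.

Definition admissible (d : R) (m : nat) (l C0 : R) : Prop :=
  0 <= d /\ (1 <= m)%nat /\ 0 < l /\ 0 < C0.

(* Computability of a real function in the sense of computable analysis: an
   algorithm [phi] turns 2^-k-approximations of the real arguments into a
   2^-n-approximation of the value. Output 0 means that more input precision is
   required, output [S q] is the answer q / 2^n. Natural numerators suffice, as
   the arguments are nonnegative and the value is positive. *)
Definition computable (a : R -> nat -> R -> R -> R) : Prop :=
  exists phi : list nat -> nat, recursive phi /\
    forall (d : R) (m : nat) (l C0 : R), admissible d m l C0 ->
    forall n : nat,
      (forall k p1 p2 p3 q : nat,
         approximates k p1 d -> approximates k p2 l -> approximates k p3 C0 ->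
         phi [n; k; m; p1; p2; p3] = S q -> approximates n q (a d m l C0)) /\
      (exists k0 : nat, forall k p1 p2 p3 : nat, (k0 <= k)%nat ->
         approximates k p1 d -> approximates k p2 l -> approximates k p3 C0 ->
         phi [n; k; m; p1; p2; p3] <> 0%nat).

Definition computable_constant (a : R -> nat -> R -> R -> R) : Prop :=
  (forall d m l C0, admissible d m l C0 -> 0 < a d m l C0) /\ computable a.

(* Main.v *)
Require Import Defs.
From Stdlib Require Import Reals Lra Lia Psatz Factorial ZArith Znumtheory List.
From Stdlib Require Import Classical ClassicalEpsilon FunctionalExtensionality.
From Coquelicot Require Import Coquelicot.
Import ListNotations.
Local Open Scope R_scope.

(** Comparing the Dirichlet series with the Euler product far to the right, prime by prime, shows
    that [prod_j (1 - alpha_j(p) x) * sum_k a(p^k) x^k = 1]; by the Ramanujan hypothesis the power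
    series converges for [|x| < 1], hence [|alpha_j(p)| <= 1]. This makes [|L|] at most
    [(sigma / (sigma - 1))^m] and [|log L|] at most [2 m / (sigma - 1)] to the right of 1.

    The functional equation and [Gamma(z + a) << |z|^a Gamma(z)] carry the first of these bounds to
    the line [Re s = - delta], and Phragmen-Lindelof on [- delta <= Re s <= 1 + delta] with
    [delta = 1 / log |t|] gives the first part.

    For the second part put [h = log log (c|t|)]. The growth bound and Borel-Caratheodory on discs
    centred on [Re s = 2] give [log L << h e^h] on [Re s >= 1/2 + 1/h]. A three-lines argument on a
    rectangle of height about [h], damped by [e^((z - s)^2)], interpolates between this and
    [log L << h] on [Re s = 1 + 4/h]. Cauchy's estimate then bounds the derivative. *)

(** * The maximum modulus principle *)

(** All the complex analysis is drawn from the maximum modulus principle, which rests on Goursat's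
    theorem for rectangles and the mean value property on circles. Schwarz's lemma then replaces
    contour integration: Cauchy's estimate and Borel-Caratheodory are both read off from it, and no
    Taylor expansion of a holomorphic function is used.

    The obstacle in the Euler product is that the [alpha] are tied to the coefficients only through
    values of [L] to the right of 1. Non-vanishing of the factors yields at first only
    [|alpha_j(p)| <= p], so the comparison has to take place at large real abscissae, where even
    this crude bound makes the tail of the product close to 1. It is carried out on partial sums, by
    sieving, so that no double series is ever rearranged.

    In the second part [exp h = log (c|t|)], so the interpolating factor [exp (2h(1 - sigma))] is
    exactly the power of [log (c|t|)] that is wanted, and [b1 = b2 = 1] will do. Moving by a
    multiple of [1/h] changes this factor by a constant only, which is why all margins are of that
    size. *)

Definition quarter_of (r q : R * R * (R * R)) : Prop :=
  let '(a, b, (c, d)) := r in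
  q = (a, (a + b) / 2, (c, (c + d) / 2)) \/
  q = ((a + b) / 2, b, (c, (c + d) / 2)) \/
  q = (a, (a + b) / 2, ((c + d) / 2, d)) \/
  q = ((a + b) / 2, b, ((c + d) / 2, d)).

Lemma nested_halving_point (u v : nat -> R) :
  u O <= v O ->
  (forall n, u n <= u (S n) /\ v (S n) <= v n /\ v (S n) - u (S n) = (v n - u n) / 2) ->
  exists x, (forall n, u n <= x <= v n) /\
    forall delta, 0 < delta -> exists N, forall n, (N <= n)%nat -> v n - u n < delta.
Proof.
intros H0 H.
assert (Hd : forall n, v n - u n = (v O - u O) / 2 ^ n).
{ induction n as [|n IH]; [simpl; field|].
  destruct (H n) as [_ [_ ->]]. rewrite IH. simpl. field. apply pow_nonzero. lra. }
assert (Hp : forall n, 0 < 2 ^ n) by (intros; apply pow_lt; lra).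
assert (Huv : forall n, u n <= v n).
{ intros n. specialize (Hd n). specialize (Hp n).
  assert (0 <= (v O - u O) / 2 ^ n) by (apply Rdiv_le_0_compat; lra). lra. }
assert (Hu : forall n k, u n <= u (n + k)%nat).
{ intros n k; induction k; [rewrite Nat.add_0_r; lra|].
  rewrite Nat.add_succ_r. destruct (H (n + k)%nat); lra. }
assert (Hv : forall n k, v (n + k)%nat <= v n).
{ intros n k; induction k; [rewrite Nat.add_0_r; lra|].
  rewrite Nat.add_succ_r. destruct (H (n + k)%nat); lra. }
assert (Hc : forall n k, u n <= v k).
{ intros n k. destruct (Nat.le_ge_cases n k) as [E|E].
  - replace k with (n + (k - n))%nat by lia. specialize (Hu n (k - n)%nat).
    specialize (Huv (n + (k - n))%nat). lra.
  - replace n with (k + (n - k))%nat by lia. specialize (Hv k (n - k)%nat).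
    specialize (Huv (k + (n - k))%nat). lra. }
destruct (completeness (fun x => exists n, x = u n)) as [x [Hx1 Hx2]].
- exists (v O). intros y [n ->]. apply Hc.
- exists (u O). now exists O.
- exists x. split.
  + intros n. split; [apply Hx1; now exists n|].
    apply Hx2. intros y [k ->]. apply Hc.
  + intros delta Hdelta.
    destruct (pow_lt_1_zero (1 / 2)) with (y := delta / (v O - u O + 1)) as [N HN].
    * rewrite Rabs_pos_eq; lra.
    * apply Rdiv_lt_0_compat; lra.
    * exists N. intros n Hn. specialize (HN n Hn).
      rewrite Rabs_pos_eq in HN by (apply pow_le; lra).
      rewrite Hd. unfold Rdiv. rewrite <- pow_inv.
      replace (/ 2) with (1 / 2) by field.
      apply Rmult_lt_compat_r with (r := v O - u O + 1) in HN; [|lra].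
      replace (delta / (v O - u O + 1) * (v O - u O + 1)) with delta in HN by (field; lra).
      assert (0 <= (1/2)^n) by (apply pow_le; lra). nra.
Qed.

(** Shared engine of the compactness arguments and of Goursat's theorem: a property inherited by at
    least one quarter concentrates at a point. The quarter is selected by [epsilon], so [Q] need not
    be decidable. *)
Lemma bisection (Q : R * R * (R * R) -> Prop) (a b c d : R) :
  a <= b -> c <= d -> Q (a, b, (c, d)) ->
  (forall r, Q r -> exists q, quarter_of r q /\ Q q) ->
  exists x y, a <= x <= b /\ c <= y <= d /\
    forall delta, 0 < delta -> exists a' b' c' d',
      a <= a' <= x /\ x <= b' <= b /\ c <= c' <= y /\ y <= d' <= d /\
      b' - a' < delta /\ d' - c' < delta /\ Q (a', b', (c', d')).
Proof.
intros Hab Hcd H0 Hstep.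
pose (next r := epsilon (inhabits r) (fun q => quarter_of r q /\ Q q)).
assert (Hnext : forall r, Q r -> quarter_of r (next r) /\ Q (next r)).
{ intros r Hr. apply epsilon_spec. now apply Hstep. }
pose (s := nat_rect (fun _ => (R * R * (R * R))%type) (a, b, (c, d)) (fun _ r => next r)).
assert (HQ : forall n, Q (s n)).
{ induction n; simpl; [assumption|]. now apply Hnext. }
pose (sa n := fst (fst (s n))). pose (sb n := snd (fst (s n))).
pose (sc n := fst (snd (s n))). pose (sd n := snd (snd (s n))).
assert (Hq : forall n, quarter_of (s n) (s (S n))) by (intros n; apply Hnext, HQ).
assert (Hle : forall n, sa n <= sb n /\ sc n <= sd n).
{ induction n as [|n IH]; [unfold sa, sb, sc, sd; simpl; lra|].
  specialize (Hq n). unfold sa, sb, sc, sd in *.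
  destruct (s n) as [[a0 b0] [c0 d0]].
  destruct Hq as [E | [E | [E | E]]]; rewrite E; simpl in *; lra. }
assert (Hhalf : forall n,
  (sa n <= sa (S n) /\ sb (S n) <= sb n /\ sb (S n) - sa (S n) = (sb n - sa n) / 2) /\
  (sc n <= sc (S n) /\ sd (S n) <= sd n /\ sd (S n) - sc (S n) = (sd n - sc n) / 2)).
{ intros n. specialize (Hq n). specialize (Hle n). unfold sa, sb, sc, sd in *.
  destruct (s n) as [[a0 b0] [c0 d0]].
  destruct Hq as [E | [E | [E | E]]]; rewrite E; simpl in *; lra. }
destruct (nested_halving_point sa sb) as [x [Hx Hx']].
{ apply Hle. }
{ intros n; apply Hhalf. }
destruct (nested_halving_point sc sd) as [y [Hy Hy']].
{ apply Hle. }
{ intros n; apply Hhalf. }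
assert (Hin : forall n, a <= sa n /\ sb n <= b /\ c <= sc n /\ sd n <= d).
{ induction n as [|n IH]; [unfold sa, sb, sc, sd; simpl; lra|].
  specialize (Hhalf n); lra. }
exists x, y. split; [apply (Hx O)|split; [apply (Hy O)|]].
intros delta Hdelta.
destruct (Hx' delta Hdelta) as [N1 HN1]. destruct (Hy' delta Hdelta) as [N2 HN2].
pose (n := max N1 N2).
exists (sa n), (sb n), (sc n), (sd n).
specialize (Hin n). specialize (Hx n). specialize (Hy n).
repeat split; try lra.
- apply HN1; unfold n; lia.
- apply HN2; unfold n; lia.
- specialize (HQ n). unfold sa, sb, sc, sd. now destruct (s n) as [[? ?] [? ?]].
Qed.

(** Bisect on the property that every value of [phi] on [K] is dominated by a value taken in the
    rectangle. If all four quarters lost it, each would have a value exceeding everything in that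
    quarter; the largest of the four is dominated by some point of the rectangle, and that point
    lies in one of the quarters. No supremum of [phi] has to be known finite in advance. *)
Lemma usc_attains_max (K : C -> Prop) (phi : C -> R) (a b c d : R) :
  a <= b -> c <= d ->
  (exists z, K z) ->
  (forall z, K z -> a <= fst z <= b /\ c <= snd z <= d) ->
  (forall z, ~ K z -> exists delta, 0 < delta /\ forall w,
     Rabs (fst w - fst z) < delta -> Rabs (snd w - snd z) < delta -> ~ K w) ->
  (forall z, K z -> forall eps, 0 < eps -> exists delta, 0 < delta /\ forall w, K w ->
     Rabs (fst w - fst z) < delta -> Rabs (snd w - snd z) < delta -> phi w < phi z + eps) ->
  exists z, K z /\ forall w, K w -> phi w <= phi z.
Proof.
intros Hab Hcd [z0 Hz0] Hbox Hclosed Husc.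
pose (Q := fun r : R * R * (R * R) => let '(a, b, (c, d)) := r in
  forall v, K v -> exists u, K u /\ a <= fst u <= b /\ c <= snd u <= d /\ phi v <= phi u).
destruct (bisection Q a b c d Hab Hcd) as [x [y [Hx [Hy Hxy]]]].
- intros v Hv. exists v. destruct (Hbox v Hv). repeat split; try assumption; lra.
- intros [[a0 b0] [c0 d0]] HQ.
  apply NNPP. intros Hn.
  assert (Hneg : forall q, quarter_of (a0, b0, (c0, d0)) q -> ~ Q q).
  { intros q Hq HQq. apply Hn. now exists q. }
  assert (Hbad : forall q, quarter_of (a0, b0, (c0, d0)) q -> exists v, K v /\
     forall u, K u -> fst (fst q) <= fst u <= snd (fst q) ->
       fst (snd q) <= snd u <= snd (snd q) -> phi u < phi v).
  { intros q Hq. specialize (Hneg q Hq). destruct q as [[a1 b1] [c1 d1]]. simpl.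
    apply NNPP. intros Hno. apply Hneg. intros v Hv. apply NNPP. intros Hno2.
    apply Hno. exists v. split; [assumption|]. intros u Hu H1 H2.
    apply Rnot_le_lt. intros Hle. apply Hno2. exists u. tauto. }
  destruct (Hbad _ (or_introl eq_refl)) as [v1 [Hv1 B1]].
  destruct (Hbad _ (or_intror (or_introl eq_refl))) as [v2 [Hv2 B2]].
  destruct (Hbad _ (or_intror (or_intror (or_introl eq_refl)))) as [v3 [Hv3 B3]].
  destruct (Hbad _ (or_intror (or_intror (or_intror eq_refl)))) as [v4 [Hv4 B4]].
  simpl in B1, B2, B3, B4.
  assert (HM : exists v, K v /\ phi v1 <= phi v /\ phi v2 <= phi v /\
                 phi v3 <= phi v /\ phi v4 <= phi v).
  { destruct (Rle_dec (phi v1) (phi v2)) as [E1|E1];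
    destruct (Rle_dec (phi v3) (phi v4)) as [E2|E2].
    - destruct (Rle_dec (phi v2) (phi v4)); [exists v4|exists v2]; repeat split; try assumption; lra.
    - destruct (Rle_dec (phi v2) (phi v3)); [exists v3|exists v2]; repeat split; try assumption; lra.
    - destruct (Rle_dec (phi v1) (phi v4)); [exists v4|exists v1]; repeat split; try assumption; lra.
    - destruct (Rle_dec (phi v1) (phi v3)); [exists v3|exists v1]; repeat split; try assumption; lra. }
  destruct HM as [v [Hv [L1 [L2 [L3 L4]]]]].
  destruct (HQ v Hv) as [u [Hu [U1 [U2 U3]]]].
  destruct (Rle_dec (fst u) ((a0 + b0) / 2)); destruct (Rle_dec (snd u) ((c0 + d0) / 2)).
  + assert (phi u < phi v1) by (apply B1; [assumption|lra|lra]). lra.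
  + assert (phi u < phi v3) by (apply B3; [assumption|lra|lra]). lra.
  + assert (phi u < phi v2) by (apply B2; [assumption|lra|lra]). lra.
  + assert (phi u < phi v4) by (apply B4; [assumption|lra|lra]). lra.
- assert (HK : K (x, y)).
  { apply NNPP. intros Hno. destruct (Hclosed _ Hno) as [delta [Hd Hdel]].
    destruct (Hxy delta Hd) as (a' & b' & c' & d' & H1 & H2 & H3 & H4 & H5 & H6 & HQ).
    destruct (HQ z0 Hz0) as [u [Hu [U1 [U2 _]]]].
    apply (Hdel u); [simpl; apply Rabs_def1; lra|simpl; apply Rabs_def1; lra|assumption]. }
  exists (x, y). split; [assumption|].
  intros w Hw. apply Rnot_lt_le. intros Hlt.
  destruct (Husc _ HK (phi w - phi (x, y)) ltac:(lra)) as [delta [Hd Hdel]].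
  destruct (Hxy delta Hd) as (a' & b' & c' & d' & H1 & H2 & H3 & H4 & H5 & H6 & HQ).
  destruct (HQ w Hw) as [u [Hu [U1 [U2 U3]]]].
  assert (phi u < phi (x, y) + (phi w - phi (x, y)))
    by (apply Hdel; [assumption|simpl; apply Rabs_def1; lra|simpl; apply Rabs_def1; lra]).
  lra.
Qed.

(** * Goursat's theorem for rectangles *)

Definition closed_form_at (U V : R -> R -> R) (x y : R) : Prop :=
  exists p q r, forall eps, 0 < eps -> exists delta, 0 < delta /\
    forall x' y', Rabs (x' - x) < delta -> Rabs (y' - y) < delta ->
      Rabs (U x' y' - U x y - p * (x' - x) - q * (y' - y))
        <= eps * (Rabs (x' - x) + Rabs (y' - y)) /\
      Rabs (V x' y' - V x y - r * (x' - x) - p * (y' - y))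
        <= eps * (Rabs (x' - x) + Rabs (y' - y)).

(** The integral of [V dx + U dy] counterclockwise round the rectangle; for [F = U + iV] this is the
    imaginary part of the contour integral of [F dz]. The coefficient [p] shared by the two
    expansions in [closed_form_at] is the one Cauchy-Riemann equation that makes this form
    closed. *)
Definition circulation (U V : R -> R -> R) (a b c d : R) : R :=
  RInt (U b) c d - RInt (U a) c d
  + (RInt (fun x => V x c) a b - RInt (fun x => V x d) a b).

Lemma continuity_pt_eps (f : R -> R) (x : R) :
  (forall eps, 0 < eps -> exists delta, 0 < delta /\
     forall x', Rabs (x' - x) < delta -> Rabs (f x' - f x) < eps) ->
  continuous f x.
Proof.
intros H. apply continuity_pt_filterlim. intros eps He.
destruct (H eps He) as [delta [Hd H']]. exists delta. split; [assumption|].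
intros x' [_ Hx']. apply H'. exact Hx'.
Qed.

Lemma linear_remainder_small (e k p t v delta : R) :
  Rabs (e - p * t) <= 1 * Rabs t -> Rabs t < delta -> k = 1 + Rabs p -> delta = v / k ->
  0 < v -> Rabs e < v.
Proof.
intros H1 H2 Hk Hd Hv.
assert (0 <= Rabs p) by apply Rabs_pos.
assert (Rabs e <= k * Rabs t).
{ replace e with ((e - p * t) + p * t) by ring.
  eapply Rle_trans; [apply Rabs_triang|]. rewrite Rabs_mult. subst k. lra. }
apply Rle_lt_trans with (k * Rabs t); [assumption|].
apply Rlt_le_trans with (k * delta).
- apply Rmult_lt_compat_l; lra.
- right. subst delta. field. lra.
Qed.

Lemma closed_form_continuous (U V : R -> R -> R) (x y : R) :
  closed_form_at U V x y ->
  continuous (U x) y /\ continuous (fun x => V x y) x.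
Proof.
intros (p & q & r & H).
destruct (H 1 Rlt_0_1) as [delta [Hd Hdel]].
split; apply continuity_pt_eps; intros eps He.
- exists (Rmin delta (eps / (1 + Rabs q))).
  assert (0 <= Rabs q) by apply Rabs_pos.
  assert (0 < eps / (1 + Rabs q)) by (apply Rdiv_lt_0_compat; lra).
  split; [apply Rmin_glb_lt; lra|].
  intros y' Hy'.
  destruct (Hdel x y') as [HE _].
  + rewrite Rminus_diag, Rabs_R0. lra.
  + apply Rlt_le_trans with (1 := Hy'), Rmin_l.
  + rewrite Rminus_diag, Rabs_R0, Rplus_0_l in HE.
    apply (linear_remainder_small _ (1 + Rabs q) q (y' - y) eps (eps / (1 + Rabs q))); auto.
    * replace (U x y' - U x y - q * (y' - y)) with (U x y' - U x y - p * 0 - q * (y' - y)) by ring.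
      exact HE.
    * apply Rlt_le_trans with (1 := Hy'), Rmin_r.
- exists (Rmin delta (eps / (1 + Rabs r))).
  assert (0 <= Rabs r) by apply Rabs_pos.
  assert (0 < eps / (1 + Rabs r)) by (apply Rdiv_lt_0_compat; lra).
  split; [apply Rmin_glb_lt; lra|].
  intros x' Hx'.
  destruct (Hdel x' y) as [_ HE].
  + apply Rlt_le_trans with (1 := Hx'), Rmin_l.
  + rewrite Rminus_diag, Rabs_R0. lra.
  + rewrite Rminus_diag, Rabs_R0, Rplus_0_r in HE.
    apply (linear_remainder_small _ (1 + Rabs r) r (x' - x) eps (eps / (1 + Rabs r))); auto.
    * replace (V x' y - V x y - r * (x' - x)) with (V x' y - V x y - r * (x' - x) - p * 0) by ring.
      exact HE.
    * apply Rlt_le_trans with (1 := Hx'), Rmin_r.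
Qed.

Definition closed_form_on (U V : R -> R -> R) (a b c d : R) : Prop :=
  forall x y, a <= x <= b -> c <= y <= d -> closed_form_at U V x y.

Lemma closed_form_integrable (U V : R -> R -> R) (a b c d : R) :
  closed_form_on U V a b c d ->
  (forall x u v, a <= x <= b -> c <= u <= v -> v <= d -> ex_RInt (U x) u v) /\
  (forall y u v, c <= y <= d -> a <= u <= v -> v <= b -> ex_RInt (fun x => V x y) u v).
Proof.
intros H; split; intros w u v Hw Hu Hv;
  apply (ex_RInt_continuous (V := R_CompleteNormedModule)); intros z;
  rewrite Rmin_left, Rmax_right by lra; intros Hz;
  apply (closed_form_continuous U V); apply H; lra.
Qed.

Lemma circulation_split (U V : R -> R -> R) (a b c d m n : R) :
  a <= m <= b -> c <= n <= d -> closed_form_on U V a b c d ->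
  circulation U V a b c d =
    circulation U V a m c n + circulation U V m b c n
    + (circulation U V a m n d + circulation U V m b n d).
Proof.
intros Hm Hn H. unfold circulation.
destruct (closed_form_integrable U V a b c d H) as [HU HV].
assert (E1 : forall x, a <= x <= b -> RInt (U x) c d = RInt (U x) c n + RInt (U x) n d).
{ intros x Hx. symmetry. apply (RInt_Chasles (V := R_CompleteNormedModule)); apply HU; lra. }
assert (E2 : forall y, c <= y <= d -> RInt (fun x => V x y) a b
  = RInt (fun x => V x y) a m + RInt (fun x => V x y) m b).
{ intros y Hy. symmetry. apply (RInt_Chasles (V := R_CompleteNormedModule)); apply HV; lra. }
rewrite !E1, !E2 by lra. ring.
Qed.

(** The affine part of the pair at [(x, y)] contributes [p (b - a)(d - c)] on the vertical sides and
    its opposite on the horizontal ones, so only the remainder of size [eps] times the distance is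
    left to integrate. *)
Lemma circulation_small (U V : R -> R -> R) (a b c d x y p q r eps : R) :
  a <= x <= b -> c <= y <= d -> 0 < eps ->
  closed_form_on U V a b c d ->
  (forall x' y', a <= x' <= b -> c <= y' <= d ->
      Rabs (U x' y' - U x y - p * (x' - x) - q * (y' - y))
        <= eps * (Rabs (x' - x) + Rabs (y' - y)) /\
      Rabs (V x' y' - V x y - r * (x' - x) - p * (y' - y))
        <= eps * (Rabs (x' - x) + Rabs (y' - y))) ->
  Rabs (circulation U V a b c d) <= 2 * eps * ((b - a) + (d - c)) ^ 2.
Proof.
intros Hx Hy He H Hlin.
destruct (closed_form_integrable U V a b c d H) as [HU HV].
assert (EU : RInt (U b) c d - RInt (U a) c d - p * (b - a) * (d - c)
   = RInt (fun z => U b z - U a z - p * (b - a)) c d).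
{ rewrite (RInt_minus (fun z => U b z - U a z) (fun _ => p * (b - a))).
  - rewrite (RInt_minus (U b) (U a)) by (apply HU; lra).
    rewrite RInt_const. unfold minus, plus, opp, scal; simpl. unfold mult; simpl. ring.
  - apply (ex_RInt_minus (V := R_NormedModule)); apply HU; lra.
  - apply ex_RInt_const. }
assert (EV : RInt (fun z => V z c) a b - RInt (fun z => V z d) a b - - p * (d - c) * (b - a)
   = RInt (fun z => V z c - V z d - - p * (d - c)) a b).
{ rewrite (RInt_minus (fun z => V z c - V z d) (fun _ => - p * (d - c))).
  - rewrite (RInt_minus (fun z => V z c) (fun z => V z d)) by (apply HV; lra).
    rewrite RInt_const. unfold minus, plus, opp, scal; simpl. unfold mult; simpl. ring.
  - apply (ex_RInt_minus (V := R_NormedModule)); apply HV; lra.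
  - apply ex_RInt_const. }
assert (Hpt : forall x' y', a <= x' <= b -> c <= y' <= d ->
    Rabs (x' - x) + Rabs (y' - y) <= (b - a) + (d - c)).
{ intros x' y' ? ?. apply Rplus_le_compat; apply Rabs_le; lra. }
set (D := (b - a) + (d - c)) in *.
assert (HD : 0 <= D) by (unfold D; lra).
assert (BU : Rabs (RInt (fun z => U b z - U a z - p * (b - a)) c d) <= (d - c) * (2 * eps * D)).
{ apply abs_RInt_le_const; [lra| |].
  - apply (ex_RInt_minus (V := R_NormedModule)); [apply (ex_RInt_minus (V := R_NormedModule)); apply HU; lra|apply ex_RInt_const].
  - intros z Hz.
    destruct (Hlin b z) as [H1 _]; [lra|lra|].
    destruct (Hlin a z) as [H2 _]; [lra|lra|].
    assert (E1 := Hpt b z ltac:(lra) ltac:(lra)). assert (E2 := Hpt a z ltac:(lra) ltac:(lra)).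
    apply Rmult_le_compat_l with (r := eps) in E1; [|lra].
    apply Rmult_le_compat_l with (r := eps) in E2; [|lra].
    apply Rabs_le_between in H1. apply Rabs_le_between in H2. apply Rabs_le. lra. }
assert (BV : Rabs (RInt (fun z => V z c - V z d - - p * (d - c)) a b) <= (b - a) * (2 * eps * D)).
{ apply abs_RInt_le_const; [lra| |].
  - apply (ex_RInt_minus (V := R_NormedModule)); [apply (ex_RInt_minus (V := R_NormedModule)); apply HV; lra|apply ex_RInt_const].
  - intros z Hz.
    destruct (Hlin z c) as [_ H1]; [lra|lra|].
    destruct (Hlin z d) as [_ H2]; [lra|lra|].
    assert (E1 := Hpt z c ltac:(lra) ltac:(lra)). assert (E2 := Hpt z d ltac:(lra) ltac:(lra)).
    apply Rmult_le_compat_l with (r := eps) in E1; [|lra].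
    apply Rmult_le_compat_l with (r := eps) in E2; [|lra].
    apply Rabs_le_between in H1. apply Rabs_le_between in H2. apply Rabs_le. lra. }
replace (circulation U V a b c d) with
  (RInt (fun z => U b z - U a z - p * (b - a)) c d
   + RInt (fun z => V z c - V z d - - p * (d - c)) a b)
  by (rewrite <- EU, <- EV; unfold circulation; ring).
eapply Rle_trans; [apply Rabs_triang|].
apply Rle_trans with ((d - c) * (2 * eps * D) + (b - a) * (2 * eps * D)); [lra|].
right. unfold D. ring.
Qed.

Lemma goursat (U V : R -> R -> R) (a b c d : R) :
  a <= b -> c <= d -> closed_form_on U V a b c d -> circulation U V a b c d = 0.
Proof.
intros Hab Hcd H. apply NNPP. intros Hne.
assert (HA : 0 < Rabs (circulation U V a b c d)) by now apply Rabs_pos_lt.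
assert (HD : a < b \/ a = b) by lra. destruct HD as [HD|HD].
2:{ apply Hne. subst b. unfold circulation. rewrite !RInt_point. unfold zero; simpl. ring. }
set (A := Rabs (circulation U V a b c d)) in *.
set (e0 := A / ((b - a) + (d - c)) ^ 2).
assert (HD2 : 0 < ((b - a) + (d - c)) ^ 2) by (apply pow_lt; lra).
assert (He0 : 0 < e0) by (apply Rdiv_lt_0_compat; lra).
(* The circulation is measured against the squared half-perimeter, which the four quarters share
   equally, so one of them keeps the ratio [e0]. The strict [a' < b'] keeps the half-perimeter
   positive, without which the final comparison would be vacuous; this is why [a = b] was treated
   apart. *)
pose (Q := fun r : R * R * (R * R) => let '(a', b', (c', d')) := r in
  a <= a' /\ a' < b' /\ b' <= b /\ c <= c' /\ c' <= d' /\ d' <= d /\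
  e0 * ((b' - a') + (d' - c')) ^ 2 <= Rabs (circulation U V a' b' c' d')).
destruct (bisection Q a b c d Hab Hcd) as [x [y [Hx [Hy Hxy]]]].
- repeat split; try lra. right. unfold e0. fold A. field. lra.
- intros [[a' b'] [c' d']] (H1 & H2 & H3 & H4 & H5 & H6 & H7).
  assert (Hr : closed_form_on U V a' b' c' d') by (intros x y ? ?; apply H; lra).
  rewrite (circulation_split U V a' b' c' d' ((a' + b') / 2) ((c' + d') / 2)) in H7 by (auto; lra).
  apply NNPP. intros Hno.
  assert (Hbad : forall q, quarter_of (a', b', (c', d')) q -> ~ Q q)
    by (intros q ? ?; apply Hno; now exists q).
  assert (B : forall a1 b1 c1 d1, quarter_of (a', b', (c', d')) (a1, b1, (c1, d1)) ->
     a <= a1 /\ a1 < b1 /\ b1 <= b /\ c <= c1 /\ c1 <= d1 /\ d1 <= d ->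
     Rabs (circulation U V a1 b1 c1 d1) < e0 * ((b1 - a1) + (d1 - c1)) ^ 2).
  { intros a1 b1 c1 d1 Hq HH. apply Rnot_le_lt. intros Hle.
    apply (Hbad _ Hq). unfold Q. tauto. }
  pose proof (B _ _ _ _ (or_introl eq_refl) ltac:(lra)) as B1.
  pose proof (B _ _ _ _ (or_intror (or_introl eq_refl)) ltac:(lra)) as B2.
  pose proof (B _ _ _ _ (or_intror (or_intror (or_introl eq_refl))) ltac:(lra)) as B3.
  pose proof (B _ _ _ _ (or_intror (or_intror (or_intror eq_refl))) ltac:(lra)) as B4.
  replace ((a' + b') / 2 - a' + ((c' + d') / 2 - c')) with ((b' - a' + (d' - c')) / 2) in B1 by field.
  replace (b' - (a' + b') / 2 + ((c' + d') / 2 - c')) with ((b' - a' + (d' - c')) / 2) in B2 by field.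
  replace ((a' + b') / 2 - a' + (d' - (c' + d') / 2)) with ((b' - a' + (d' - c')) / 2) in B3 by field.
  replace (b' - (a' + b') / 2 + (d' - (c' + d') / 2)) with ((b' - a' + (d' - c')) / 2) in B4 by field.
  set (w := (b' - a' + (d' - c'))) in *.
  replace (e0 * (w / 2) ^ 2) with (e0 * w ^ 2 / 4) in * by field.
  apply Rabs_def2 in B1. apply Rabs_def2 in B2. apply Rabs_def2 in B3. apply Rabs_def2 in B4.
  apply (Rlt_irrefl (e0 * w ^ 2)). apply Rle_lt_trans with (1 := H7).
  apply Rabs_def1; lra.
- destruct (H x y Hx Hy) as (p & q & r & Hpqr).
  destruct (Hpqr (e0 / 4) ltac:(lra)) as [delta [Hd Hdel]].
  destruct (Hxy delta Hd) as (a' & b' & c' & d' & K1 & K2 & K3 & K4 & K5 & K6 & HQ).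
  destruct HQ as (H1 & H2 & H3 & H4 & H5 & H6 & H7).
  assert (Hs : Rabs (circulation U V a' b' c' d') <= 2 * (e0 / 4) * ((b' - a') + (d' - c')) ^ 2).
  { apply (circulation_small U V a' b' c' d' x y p q r); try lra.
    - intros x' y' ? ?; apply H; lra.
    - intros x' y' ? ?; apply Hdel; apply Rabs_def1; lra. }
  assert (0 < ((b' - a') + (d' - c')) ^ 2) by (apply pow_lt; lra).
  assert (0 < e0 * ((b' - a') + (d' - c')) ^ 2) by (apply Rmult_lt_0_compat; lra).
  lra.
Qed.

(** * Continuity and derivatives of complex functions *)

Lemma one_le_INR (n : nat) : (1 <= n)%nat -> 1 <= INR n.
Proof. intros Hn. change 1 with (INR 1). now apply le_INR. Qed.

Lemma Ceq_ext (z w : C) : Re z = Re w -> Im z = Im w -> z = w.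
Proof. destruct z, w; unfold Re, Im; simpl; intros -> ->; reflexivity. Qed.

Lemma Cmod_minus_sym (z w : C) : Cmod (z - w) = Cmod (w - z).
Proof. rewrite <- Cmod_opp. f_equal. ring. Qed.

Lemma Cmod_triangle_rev (z w : C) : Cmod z - Cmod w <= Cmod (z - w).
Proof.
assert (H := Cmod_triangle (z - w) w).
replace (z - w + w)%C with z in H by ring. lra.
Qed.

Lemma Cmod_triangle_minus (z w : C) : Cmod (z - w) <= Cmod z + Cmod w.
Proof.
unfold Cminus. rewrite <- (Cmod_opp w). apply Cmod_triangle.
Qed.

Lemma im_le_Cmod (z : C) : Rabs (Im z) <= Cmod z.
Proof.
apply Rle_trans with (2 := Rmax_Cmod z). apply Rmax_r.
Qed.

Lemma Cmod_le_re_im (z : C) : Cmod z <= Rabs (Re z) + Rabs (Im z).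
Proof.
replace z with (RtoC (Re z) + Ci * RtoC (Im z))%C at 1
  by (apply Ceq_ext; unfold Re, Im; simpl; ring).
eapply Rle_trans; [apply Cmod_triangle|].
rewrite Cmod_mult, !Cmod_R, Cmod_Ci. lra.
Qed.

Lemma Cmod_lt_box (z w : C) (d : R) :
  Rabs (fst w - fst z) < d -> Rabs (snd w - snd z) < d -> Cmod (w - z) < 2 * d.
Proof.
intros H1 H2. eapply Rle_lt_trans; [apply Cmod_le_re_im|].
unfold Re, Im; simpl. unfold Rminus in *. lra.
Qed.

Definition ccont (f : C -> C) (z : C) : Prop :=
  forall eps, 0 < eps -> exists delta, 0 < delta /\
    forall w, Cmod (w - z) < delta -> Cmod (f w - f z) < eps.

Lemma ccont_filterlim (f : C -> C) (z : C) :
  ccont f z <->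
  filterlim f (locally (T := AbsRing_UniformSpace C_AbsRing) z)
              (locally (T := AbsRing_UniformSpace C_AbsRing) (f z)).
Proof.
split.
- intros H P [eps HP]. destruct (H eps (cond_pos eps)) as [d [Hd H']].
  exists (mkposreal d Hd). intros w Hw. apply HP. apply H'. exact Hw.
- intros H eps He.
  destruct (H (fun u => Cmod (u - f z) < eps)) as [d Hd].
  + exists (mkposreal eps He). intros w Hw. exact Hw.
  + exists d. split; [apply cond_pos|]. intros w Hw. apply Hd. exact Hw.
Qed.

Lemma ccont_const (c z : C) : ccont (fun _ => c) z.
Proof.
intros eps He. exists 1. split; [lra|]. intros.
replace (c - c)%C with (RtoC 0) by ring. now rewrite Cmod_0.
Qed.

Lemma ccont_id (z : C) : ccont (fun w => w) z.
Proof. intros eps He. now exists eps. Qed.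

Lemma ccont_plus (f g : C -> C) (z : C) :
  ccont f z -> ccont g z -> ccont (fun w => f w + g w)%C z.
Proof.
intros Hf Hg eps He.
destruct (Hf (eps / 2) ltac:(lra)) as [d1 [H1 H1']].
destruct (Hg (eps / 2) ltac:(lra)) as [d2 [H2 H2']].
exists (Rmin d1 d2). split; [now apply Rmin_glb_lt|].
intros w Hw.
assert (Hw1 := H1' w (Rlt_le_trans _ _ _ Hw (Rmin_l _ _))).
assert (Hw2 := H2' w (Rlt_le_trans _ _ _ Hw (Rmin_r _ _))).
replace (f w + g w - (f z + g z))%C with ((f w - f z) + (g w - g z))%C by ring.
eapply Rle_lt_trans; [apply Cmod_triangle|]. lra.
Qed.

Lemma ccont_mult (f g : C -> C) (z : C) :
  ccont f z -> ccont g z -> ccont (fun w => f w * g w)%C z.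
Proof.
intros Hf Hg. apply ccont_filterlim.
apply ccont_filterlim in Hf. apply ccont_filterlim in Hg.
apply (filterlim_comp_2 f g Cmult Hf Hg).
apply (filterlim_mult (K := C_AbsRing)).
Qed.

Lemma ccont_opp (f : C -> C) (z : C) : ccont f z -> ccont (fun w => - f w)%C z.
Proof.
intros Hf eps He. destruct (Hf eps He) as [d [Hd H]]. exists d. split; [assumption|].
intros w Hw. rewrite <- Cmod_opp.
replace (- (- f w - - f z))%C with (f w - f z)%C by ring. auto.
Qed.

Lemma ccont_comp (f g : C -> C) (z : C) :
  ccont g z -> ccont f (g z) -> ccont (fun w => f (g w)) z.
Proof.
intros Hg Hf eps He.
destruct (Hf eps He) as [d [Hd H]]. destruct (Hg d Hd) as [d' [Hd' H']].
exists d'. split; [assumption|]. intros w Hw. apply H, H', Hw.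
Qed.

Lemma ccont_neq0 (f : C -> C) (z : C) : ccont f z -> f z <> 0%C ->
  exists delta, 0 < delta /\ forall w, Cmod (w - z) < delta -> Cmod (f z) / 2 < Cmod (f w).
Proof.
intros Hf Hz. assert (Hp : 0 < Cmod (f z)) by now apply Cmod_gt_0.
destruct (Hf (Cmod (f z) / 2) ltac:(lra)) as [d [Hd H]].
exists d. split; [assumption|]. intros w Hw. specialize (H w Hw).
rewrite Cmod_minus_sym in H. assert (H' := Cmod_triangle_rev (f z) (f w)). lra.
Qed.

Lemma ccont_inv (f : C -> C) (z : C) :
  ccont f z -> f z <> 0%C -> ccont (fun w => / f w)%C z.
Proof.
intros Hf Hz eps He.
assert (Hp : 0 < Cmod (f z)) by now apply Cmod_gt_0.
destruct (ccont_neq0 f z Hf Hz) as [d1 [Hd1 H1]].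
set (M := Cmod (f z)) in *.
assert (HeM : 0 < eps * (M * M / 2)) by (apply Rmult_lt_0_compat; nra).
destruct (Hf _ HeM) as [d2 [Hd2 H2]].
exists (Rmin d1 d2). split; [now apply Rmin_glb_lt|].
intros w Hw.
assert (Hw1 := H1 w (Rlt_le_trans _ _ _ Hw (Rmin_l _ _))).
assert (Hw2 := H2 w (Rlt_le_trans _ _ _ Hw (Rmin_r _ _))).
assert (Hfw : f w <> 0%C) by (apply Cmod_gt_0; lra).
replace (/ f w - / f z)%C with ((f z - f w) / (f w * f z))%C by (field; auto).
rewrite Cmod_div by now apply Cmult_neq_0.
rewrite Cmod_mult, Cmod_minus_sym. fold M.
apply Rmult_lt_reg_r with (Cmod (f w) * M); [apply Rmult_lt_0_compat; lra|].
unfold Rdiv. rewrite Rmult_assoc, Rinv_l, Rmult_1_r by (apply Rgt_not_eq, Rmult_lt_0_compat; lra).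
apply Rlt_le_trans with (1 := Hw2). apply Rmult_le_compat_l; [lra|]. nra.
Qed.

(* Caratheodory's form of differentiability, whose slope function obeys the calculus rules by pure algebra. *)
Definition cderiv (f : C -> C) (z l : C) : Prop :=
  exists phi, ccont phi z /\ phi z = l /\ forall w, f w = (f z + phi w * (w - z))%C.

Lemma cderiv_is_derive (f : C -> C) (z l : C) :
  cderiv f z l <-> is_derive (K := C_AbsRing) (V := C_NormedModule) f z l.
Proof.
split.
- intros (phi & Hc & Hz & Hphi). split.
  + apply is_linear_scal_l.
  + intros x Hx. apply (is_filter_lim_locally_unique (V := AbsRing_NormedModule C_AbsRing)) in Hx.
    subst x. intros eps. destruct (Hc eps (cond_pos eps)) as [d [Hd H]].
    exists (mkposreal d Hd). intros w Hw.
    assert (Hw' : Cmod (w - z) < d) by exact Hw.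
    change (Cmod (f w - f z - (w - z) * l) <= eps * Cmod (w - z)).
    rewrite (Hphi w), <- Hz.
    replace (f z + phi w * (w - z) - f z - (w - z) * phi z)%C
      with ((phi w - phi z) * (w - z))%C by ring.
    rewrite Cmod_mult. apply Rmult_le_compat_r; [apply Cmod_ge_0|].
    left. now apply H.
- intros [_ H].
  specialize (H z (fun P HP => HP)).
  exists (fun w => if Ceq_dec w z then l else ((f w - f z) / (w - z))%C).
  assert (Ez : (if Ceq_dec z z then l else ((f z - f z) / (z - z))%C) = l)
    by (destruct (Ceq_dec z z); tauto).
  repeat split.
  + intros eps He. rewrite Ez.
    destruct (H (pos_div_2 (mkposreal eps He))) as [d Hd].
    exists d. split; [apply cond_pos|]. intros w Hw.
    destruct (Ceq_dec w z) as [->|Hne].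
    * replace (l - l)%C with (RtoC 0) by ring. now rewrite Cmod_0.
    * specialize (Hd w Hw).
      change (Cmod (f w - f z - (w - z) * l) <= eps / 2 * Cmod (w - z)) in Hd.
      assert (Hm : (w - z)%C <> 0%C) by now apply Cminus_eq_contra.
      assert (Hp : 0 < Cmod (w - z)) by now apply Cmod_gt_0.
      replace ((f w - f z) / (w - z) - l)%C with ((f w - f z - (w - z) * l) / (w - z))%C
        by (field; auto).
      rewrite Cmod_div by assumption.
      apply Rle_lt_trans with (eps / 2); [|lra].
      apply Rmult_le_reg_r with (1 := Hp). unfold Rdiv at 1.
      rewrite Rmult_assoc, Rinv_l by lra. lra.
  + exact Ez.
  + intros w. destruct (Ceq_dec w z) as [->|Hne]; [ring|].
    field. now apply Cminus_eq_contra.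
Qed.

Lemma Cdifferentiable_cderiv (f : C -> C) (z : C) :
  Cdifferentiable f z <-> exists l, cderiv f z l.
Proof.
split; intros [l Hl]; exists l; now apply cderiv_is_derive.
Qed.

Lemma cderiv_ccont (f : C -> C) (z l : C) : cderiv f z l -> ccont f z.
Proof.
intros (phi & Hc & Hz & Hphi).
assert (H : ccont (fun w => f z + phi w * (w + - z))%C z).
{ apply ccont_plus; [apply ccont_const|]. apply ccont_mult; [assumption|].
  apply ccont_plus; [apply ccont_id|apply ccont_const]. }
intros eps He. destruct (H eps He) as [d [Hd H']]. exists d. split; [assumption|].
intros w Hw. rewrite (Hphi w). specialize (H' w Hw).
replace (f z + phi w * (w - z) - f z)%C with
 (f z + phi w * (w + - z) - (f z + phi z * (z + - z)))%C by ring. exact H'.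
Qed.

Lemma cderiv_eq (f : C -> C) (z l l' : C) : cderiv f z l -> l = l' -> cderiv f z l'.
Proof. now intros H <-. Qed.

Lemma cderiv_const (c z : C) : cderiv (fun _ => c) z 0.
Proof.
exists (fun _ => RtoC 0). split; [apply ccont_const|]. split; [reflexivity|]. intros; ring.
Qed.

Lemma cderiv_id (z : C) : cderiv (fun w => w) z 1.
Proof.
exists (fun _ => RtoC 1). split; [apply ccont_const|]. split; [reflexivity|]. intros; ring.
Qed.

Lemma cderiv_plus (f g : C -> C) (z l m : C) :
  cderiv f z l -> cderiv g z m -> cderiv (fun w => f w + g w)%C z (l + m).
Proof.
intros (phi & H1 & H2 & H3) (psi & H4 & H5 & H6).
exists (fun w => phi w + psi w)%C. split; [now apply ccont_plus|].
split; [now rewrite H2, H5|]. intros w. rewrite (H3 w), (H6 w). ring.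
Qed.

Lemma cderiv_opp (f : C -> C) (z l : C) :
  cderiv f z l -> cderiv (fun w => - f w)%C z (- l).
Proof.
intros (phi & H1 & H2 & H3).
exists (fun w => - phi w)%C. split; [now apply ccont_opp|].
split; [now rewrite H2|]. intros w. rewrite (H3 w). ring.
Qed.

Lemma cderiv_minus (f g : C -> C) (z l m : C) :
  cderiv f z l -> cderiv g z m -> cderiv (fun w => f w - g w)%C z (l - m).
Proof. intros. apply cderiv_plus; [|apply cderiv_opp]; assumption. Qed.

Lemma cderiv_mult (f g : C -> C) (z l m : C) :
  cderiv f z l -> cderiv g z m ->
  cderiv (fun w => f w * g w)%C z (l * g z + f z * m).
Proof.
intros Hf Hg. assert (Cg := cderiv_ccont _ _ _ Hg).
destruct Hf as (phi & H1 & H2 & H3). destruct Hg as (psi & H4 & H5 & H6).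
exists (fun w => phi w * g w + f z * psi w)%C.
split; [apply ccont_plus; apply ccont_mult; auto using ccont_const|].
split; [now rewrite H2, H5|]. intros w. rewrite (H3 w), (H6 w). ring.
Qed.

Lemma cderiv_comp (f g : C -> C) (z l m : C) :
  cderiv g z m -> cderiv f (g z) l -> cderiv (fun w => f (g w)) z (l * m).
Proof.
intros Hg Hf. assert (Cg := cderiv_ccont _ _ _ Hg).
destruct Hf as (phi & H1 & H2 & H3). destruct Hg as (psi & H4 & H5 & H6).
exists (fun w => phi (g w) * psi w)%C.
split; [apply ccont_mult; [apply (ccont_comp phi g)|]; assumption|].
split; [now rewrite H2, H5|]. intros w. rewrite (H3 (g w)), (H6 w). ring.
Qed.

Lemma cderiv_local (f g : C -> C) (z l : C) (delta : R) : 0 < delta ->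
  (forall w, Cmod (w - z) < delta -> f w = g w) -> cderiv f z l -> cderiv g z l.
Proof.
intros Hd He Hf. apply cderiv_is_derive. apply cderiv_is_derive in Hf.
apply (is_derive_ext_loc f); [|assumption].
exists (mkposreal delta Hd). intros w Hw. apply He. exact Hw.
Qed.

Lemma cderiv_inv (f : C -> C) (z l : C) :
  cderiv f z l -> f z <> 0%C -> cderiv (fun w => / f w)%C z (- l / (f z * f z)).
Proof.
intros Hf Hz. assert (Cf := cderiv_ccont _ _ _ Hf).
destruct (ccont_neq0 f z Cf Hz) as [d [Hd Hne]].
destruct Hf as (phi & H1 & H2 & H3).
pose (g := fun w => (/ f z + (- phi w * (/ f w * / f z)) * (w - z))%C).
apply (cderiv_local g _ z _ d Hd).
- intros w Hw. unfold g. specialize (Hne w Hw).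
  assert (f w <> 0%C) by (apply Cmod_gt_0; assert (H := Cmod_ge_0 (f z)); lra).
  transitivity ((f w - phi w * (w - z)) / (f w * f z))%C; [field; auto|].
  rewrite (H3 w) at 1. field. auto.
- exists (fun w => (- phi w * (/ f w * / f z)))%C. split.
  + apply ccont_mult; [now apply ccont_opp|].
    apply ccont_mult; [now apply ccont_inv|apply ccont_const].
  + split; [rewrite H2; field; auto|]. intros w. unfold g. ring.
Qed.

Lemma cderiv_pow (f : C -> C) (z l : C) (n : nat) :
  cderiv f z l -> exists m, cderiv (fun w => f w ^ n)%C z m.
Proof.
intros Hf. induction n as [|n [m IH]]; simpl.
- eexists. apply cderiv_const.
- eexists. apply (cderiv_mult f); eassumption.
Qed.

(** * The complex exponential *)

Lemma exp_minus_linear (a : R) : Rabs a <= 1 / 2 -> Rabs (exp a - 1 - a) <= 2 * a ^ 2.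
Proof.
intros Ha. apply Rabs_le_between in Ha.
assert (H1 := exp_ineq1_le a). assert (H2 := exp_ineq1_le (- a)).
rewrite exp_Ropp in H2. assert (Hp := exp_pos a).
apply Rmult_le_compat_r with (r := exp a) in H2; [|lra]. rewrite Rinv_l in H2 by lra.
apply Rabs_le. split; [nra|].
assert (exp a * (1 - a) <= 1) by lra.
apply Rmult_le_reg_r with (1 - a); [lra|]. nra.
Qed.

Lemma one_minus_cos_le (b : R) : 0 <= 1 - cos b <= b ^ 2 / 2.
Proof.
assert (H : cos b = 1 - 2 * sin (b / 2) * sin (b / 2)).
{ rewrite <- cos_2a_sin. f_equal. field. }
assert (Hs : Rabs (sin (b / 2)) <= Rabs (b / 2)).
{ destruct (Rle_dec 0 (b / 2)) as [Hb|Hb].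
  - destruct (Req_dec (b / 2) 0) as [->|Hn]; [rewrite sin_0; lra|].
    destruct (Rle_dec (b / 2) 1) as [Hb1|Hb1].
    + rewrite (Rabs_pos_eq (b / 2)) by lra.
      rewrite Rabs_pos_eq; [left; apply sin_lt_x; lra|].
      apply sin_ge_0; [lra|]. assert (H' := PI2_1). unfold PI2 in *. lra.
    + rewrite (Rabs_pos_eq (b / 2)) by lra. assert (H1 := SIN_bound (b / 2)).
      apply Rabs_le. lra.
  - rewrite <- (Rabs_Ropp (sin (b / 2))), <- (Rabs_Ropp (b / 2)), <- sin_neg.
    destruct (Rle_dec (- (b / 2)) 1) as [Hb1|Hb1].
    + rewrite (Rabs_pos_eq (- (b / 2))) by lra.
      rewrite Rabs_pos_eq; [left; apply sin_lt_x; lra|].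
      apply sin_ge_0; [lra|]. assert (H' := PI2_1). unfold PI2 in *. lra.
    + rewrite (Rabs_pos_eq (- (b / 2))) by lra. assert (H1 := SIN_bound (- (b / 2))).
      apply Rabs_le. lra. }
apply Rsqr_le_abs_1 in Hs. unfold Rsqr in Hs. rewrite H.
split; [|simpl; lra].
assert (0 <= sin (b / 2) * sin (b / 2)) by apply Rle_0_sqr. lra.
Qed.

Lemma sin_minus_linear (b : R) : Rabs (sin b - b) <= Rabs b * (b ^ 2 / 2).
Proof.
destruct (MVT_gen (fun x => sin x - x) 0 b (fun x => cos x - 1)) as [x [Hx Hx']].
- intros x _. auto_derive; [trivial|ring].
- intros x _. apply continuity_pt_minus; [apply continuity_sin|apply continuity_pt_id].
- rewrite sin_0 in Hx'. replace (sin b - b) with ((cos x - 1) * b) by lra.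
  rewrite Rabs_mult, Rmult_comm. apply Rmult_le_compat_l; [apply Rabs_pos|].
  assert (H := one_minus_cos_le x). rewrite <- Rabs_Ropp, Rabs_pos_eq by lra.
  apply Rle_trans with (x ^ 2 / 2); [lra|].
  assert (x ^ 2 <= b ^ 2); [|lra].
  rewrite <- !Rsqr_pow2. apply Rsqr_le_abs_1. unfold Rmin, Rmax in Hx. destruct (Rle_dec 0 b).
  + rewrite !Rabs_pos_eq; lra.
  + rewrite !Rabs_left1; lra.
Qed.

Lemma Cexp_0 : Cexp 0 = 1%C.
Proof. unfold Cexp, RtoC, Re, Im; simpl. rewrite exp_0, cos_0, sin_0. f_equal; ring. Qed.

Lemma Cexp_plus (z w : C) : Cexp (z + w) = (Cexp z * Cexp w)%C.
Proof.
unfold Cexp. rewrite re_plus, im_plus, exp_plus, cos_plus, sin_plus.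
apply Ceq_ext; unfold Re, Im; simpl; ring.
Qed.

Lemma Cmod_Cexp (z : C) : Cmod (Cexp z) = exp (Re z).
Proof.
unfold Cmod, Cexp; simpl.
replace (exp (Re z) * cos (Im z) * (exp (Re z) * cos (Im z) * 1) +
   exp (Re z) * sin (Im z) * (exp (Re z) * sin (Im z) * 1))
  with ((exp (Re z))² * ((sin (Im z))² + (cos (Im z))²)) by (unfold Rsqr; ring).
rewrite sin2_cos2, Rmult_1_r. apply sqrt_Rsqr. left; apply exp_pos.
Qed.

Lemma Cexp_neq0 (z : C) : Cexp z <> 0%C.
Proof. apply Cmod_gt_0. rewrite Cmod_Cexp. apply exp_pos. Qed.

Lemma Cexp_opp (z : C) : Cexp (- z) = (/ Cexp z)%C.
Proof.
assert (H : (Cexp z * Cexp (- z))%C = 1%C).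
{ rewrite <- Cexp_plus. replace (z + - z)%C with (RtoC 0) by ring. apply Cexp_0. }
assert (Hz := Cexp_neq0 z).
transitivity (/ Cexp z * (Cexp z * Cexp (- z)))%C; [field; auto|]. rewrite H. ring.
Qed.

Lemma Cexp_minus_linear (h : C) : Cmod h <= 1 / 2 ->
  Cmod (Cexp h - 1 - h) <= 8 * Cmod h ^ 2.
Proof.
intros Hh. set (r := Cmod h) in *.
assert (Ha : Rabs (Re h) <= r) by apply re_le_Cmod.
assert (Hb : Rabs (Im h) <= r) by apply im_le_Cmod.
assert (Hr : 0 <= r) by apply Cmod_ge_0.
eapply Rle_trans; [apply Cmod_le_re_im|].
set (a := Re h) in *. set (b := Im h) in *.
replace (Re (Cexp h - 1 - h)) with ((exp a - 1 - a) - exp a * (1 - cos b))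
  by (unfold Cexp, Re, Im in *; simpl; unfold a, b; ring).
replace (Im (Cexp h - 1 - h)) with (exp a * (sin b - b) + (exp a - 1) * b)
  by (unfold Cexp, Re, Im in *; simpl; unfold a, b; ring).
assert (He := exp_minus_linear a ltac:(lra)).
assert (Hc := one_minus_cos_le b). assert (Hs := sin_minus_linear b).
assert (Ha2 : a ^ 2 <= r ^ 2) by (apply pow_maj_Rabs; assumption).
assert (Hb2 : b ^ 2 <= r ^ 2) by (apply pow_maj_Rabs; assumption).
assert (Hr2 : 0 <= r ^ 2) by (apply pow_le; lra).
assert (Hr2' : r ^ 2 <= 1 / 4) by (simpl; nra).
assert (He1 : 0 <= exp a <= 2).
{ split; [left; apply exp_pos|]. apply Rabs_le_between in He.
  apply Rabs_le_between in Ha. lra. }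
assert (He2 : Rabs (exp a - 1) <= 2 * r).
{ replace (exp a - 1) with ((exp a - 1 - a) + a) by ring.
  eapply Rle_trans; [apply Rabs_triang|]. simpl in *. nra. }
assert (Hs' : Rabs (sin b - b) <= r ^ 2 / 4).
{ apply Rle_trans with (1 := Hs). assert (0 <= Rabs b) by apply Rabs_pos.
  apply Rle_trans with (1 / 2 * (r ^ 2 / 2)); [|lra].
  apply Rmult_le_compat; lra. }
assert (T1 : Rabs (exp a - 1 - a - exp a * (1 - cos b)) <= 2 * r ^ 2 + r ^ 2).
{ assert (E : 0 <= exp a * (1 - cos b) <= 2 * (b ^ 2 / 2)).
  { split; [apply Rmult_le_pos; lra|apply Rmult_le_compat; lra]. }
  apply Rabs_le_between in He. apply Rabs_le. lra. }
assert (T2 : Rabs (exp a * (sin b - b) + (exp a - 1) * b) <= 2 * (r ^ 2 / 4) + 2 * r * r).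
{ eapply Rle_trans; [apply Rabs_triang|].
  rewrite !Rabs_mult, (Rabs_pos_eq (exp a)) by lra.
  apply Rplus_le_compat; apply Rmult_le_compat; try lra; apply Rabs_pos. }
simpl in *. nra.
Qed.

Lemma cderiv_Cexp (z : C) : cderiv Cexp z (Cexp z).
Proof.
apply cderiv_is_derive. split; [apply is_linear_scal_l|].
intros x Hx. apply (is_filter_lim_locally_unique (V := AbsRing_NormedModule C_AbsRing)) in Hx.
subst x. intros [eps He].
set (M := Cmod (Cexp z)).
assert (HM : 0 < M) by (apply Cmod_gt_0, Cexp_neq0).
assert (Hd : 0 < Rmin (1 / 2) (eps / (8 * M))).
{ apply Rmin_glb_lt; [lra|]. apply Rdiv_lt_0_compat; lra. }
exists (mkposreal _ Hd). intros w Hw.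
assert (Hw' : Cmod (w - z) < Rmin (1 / 2) (eps / (8 * M))) by exact Hw.
change (Cmod (Cexp w - Cexp z - (w - z) * Cexp z) <= eps * Cmod (w - z)).
replace (Cexp w) with (Cexp z * Cexp (w - z))%C
  by (rewrite <- Cexp_plus; f_equal; ring).
replace (Cexp z * Cexp (w - z) - Cexp z - (w - z) * Cexp z)%C
  with (Cexp z * (Cexp (w - z) - 1 - (w - z)))%C by ring.
rewrite Cmod_mult. fold M.
assert (H1 : Cmod (w - z) <= 1 / 2) by (assert (H := Rmin_l (1 / 2) (eps / (8 * M))); lra).
assert (H2 : Cmod (w - z) <= eps / (8 * M)) by (assert (H := Rmin_r (1 / 2) (eps / (8 * M))); lra).
assert (H3 := Cexp_minus_linear (w - z) H1).
assert (H0 := Cmod_ge_0 (w - z)). set (r := Cmod (w - z)) in *.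
apply Rle_trans with (M * (8 * r ^ 2)); [apply Rmult_le_compat_l; lra|].
apply Rle_trans with ((8 * M * (eps / (8 * M))) * r).
- simpl. assert (r * r <= eps / (8 * M) * r) by (apply Rmult_le_compat_r; lra). nra.
- right. field. lra.
Qed.

Lemma cderiv_closed_form (F : C -> C) (x y : R) (l : C) :
  cderiv F (x, y) l ->
  closed_form_at (fun x y => Re (F (x, y))) (fun x y => Im (F (x, y))) x y.
Proof.
intros (phi & Hc & Hl & Hphi).
exists (Re l), (- Im l), (Im l). intros eps He.
destruct (Hc eps He) as [d [Hd H]].
exists (d / 2). split; [lra|]. intros x' y' Hx Hy.
set (w := (x', y') : C). set (z := (x, y) : C) in *.
assert (Hw : Cmod (w - z) <= Rabs (x' - x) + Rabs (y' - y)).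
{ eapply Rle_trans; [apply Cmod_le_re_im|]. right. reflexivity. }
assert (Hd' : Cmod (F w - F z - l * (w - z)) <= eps * (Rabs (x' - x) + Rabs (y' - y))).
{ rewrite (Hphi w), <- Hl.
  replace (F z + phi w * (w - z) - F z - phi z * (w - z))%C
    with ((phi w - phi z) * (w - z))%C by ring.
  rewrite Cmod_mult. apply Rmult_le_compat; try apply Cmod_ge_0; [|assumption].
  left. apply H. lra. }
split; (eapply Rle_trans; [|exact Hd']).
- eapply Rle_trans; [right|apply re_le_Cmod]. f_equal.
  unfold w, z, Re, Im; simpl. ring.
- eapply Rle_trans; [right|apply im_le_Cmod]. f_equal.
  unfold w, z, Re, Im; simpl. ring.
Qed.

(** * Mean values, the maximum modulus and its consequences *)

Definition punctured_holomorphic (f : C -> C) (z : C) (r : R) : Prop :=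
  ccont f z /\ forall w, 0 < Cmod (w - z) < r -> exists l, cderiv f w l.

Lemma continuous_re_path (f : C -> C) (c : C) (x y : R) :
  ccont f (c + Cexp (x, y))%C ->
  continuous (fun y => Re (f (c + Cexp (x, y))%C)) y.
Proof.
intros Hf. apply continuity_pt_eps. intros eps He.
assert (Hc : ccont (fun w => f (c + Cexp w)%C) (x, y)).
{ apply (ccont_comp f (fun w => c + Cexp w)%C).
  - apply ccont_plus; [apply ccont_const|]. eapply cderiv_ccont, cderiv_Cexp.
  - exact Hf. }
destruct (Hc eps He) as [d [Hd H]]. exists d. split; [assumption|].
intros y' Hy'.
specialize (H (x, y')).
assert (Hm : Cmod ((x, y') - (x, y)) < d).
{ eapply Rle_lt_trans; [apply Cmod_le_re_im|]. unfold Re, Im; simpl.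
  replace (x + - x) with 0 by ring. rewrite Rabs_R0, Rplus_0_l. exact Hy'. }
specialize (H Hm). eapply Rle_lt_trans; [|exact H].
eapply Rle_trans; [right|apply re_le_Cmod]. unfold Re; simpl. reflexivity.
Qed.

(* In logarithmic polar coordinates the circles around [c] become vertical segments, and
   [f (c + Cexp w)] is periodic, so the horizontal sides of a rectangle cancel. *)
Lemma circle_mean (f : C -> C) (c : C) (r x : R) :
  punctured_holomorphic f c r -> exp x < r ->
  RInt (fun y => Re (f (c + Cexp (x, y))%C)) 0 (2 * PI) = 2 * PI * Re (f c).
Proof.
intros [Hc Hf] Hx.
assert (HPI := PI_RGT_0).
pose (F := fun w => f (c + Cexp w)%C).
assert (HF : forall x' y, x' <= x -> exists l, cderiv F (x', y) l).
{ intros x' y Hx'. destruct (Hf (c + Cexp (x', y))%C) as [l Hl].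
  - replace (c + Cexp (x', y) - c)%C with (Cexp (x', y)) by ring.
    rewrite Cmod_Cexp. split; [apply exp_pos|]. unfold Re; simpl.
    destruct Hx' as [Hx'|Hx']; [apply exp_increasing in Hx'|rewrite Hx']; lra.
  - eexists. apply (cderiv_comp f (fun w => c + Cexp w)%C); [|exact Hl].
    apply cderiv_plus; [apply cderiv_const|apply cderiv_Cexp]. }
assert (Hint : forall x', x' <= x ->
  ex_RInt (fun y => Re (f (c + Cexp (x', y))%C)) 0 (2 * PI)).
{ intros x' Hx'. apply (ex_RInt_continuous (V := R_CompleteNormedModule)).
  intros y _. apply continuous_re_path.
  destruct (HF x' y Hx') as [l Hl].
  destruct (Hf (c + Cexp (x', y))%C) as [l' Hl'].
  - replace (c + Cexp (x', y) - c)%C with (Cexp (x', y)) by ring.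
    rewrite Cmod_Cexp. split; [apply exp_pos|]. unfold Re; simpl.
    destruct Hx' as [Hx'|Hx']; [apply exp_increasing in Hx'|rewrite Hx']; lra.
  - eapply cderiv_ccont, Hl'. }
assert (Hconst : forall x', x' <= x ->
  RInt (fun y => Re (F (x, y))) 0 (2 * PI) = RInt (fun y => Re (F (x', y))) 0 (2 * PI)).
{ intros x' Hx'.
  assert (HG := goursat (fun x y => Re (F (x, y))) (fun x y => Im (F (x, y))) x' x 0 (2 * PI) Hx' ltac:(lra)).
  assert (Hcl : closed_form_on (fun x y => Re (F (x, y))) (fun x y => Im (F (x, y))) x' x 0 (2 * PI)).
  { intros u v Hu Hv. destruct (HF u v ltac:(lra)) as [l Hl].
    eapply cderiv_closed_form, Hl. }
  specialize (HG Hcl). unfold circulation in HG.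
  replace (fun x : R => Im (F (x, 2 * PI))) with (fun x : R => Im (F (x, 0))) in HG; [lra|].
  apply functional_extensionality. intros u. unfold F, Cexp, Re, Im; simpl.
  now rewrite cos_2PI, sin_2PI, cos_0, sin_0. }
fold (F (0, 0)). change (fun y => Re (f (c + Cexp (x, y))%C)) with (fun y => Re (F (x, y))).
apply cond_eq. intros eps He.
destruct (Hc (eps / (4 * PI)) ltac:(apply Rdiv_lt_0_compat; lra)) as [d [Hd Hdel]].
(* The mean does not depend on the radius, so the circle may be shrunk until continuity at [c]
   brings all values within [eps / (4 PI)] of [f c]. *)
pose (x' := Rmin x (ln (d / 2))).
assert (Hx' : x' <= x) by apply Rmin_l.
assert (Hex : exp x' < d).
{ apply Rle_lt_trans with (d / 2); [|lra].
  rewrite <- (exp_ln (d / 2)) by lra.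
  destruct (Rmin_r x (ln (d / 2))) as [E|E]; [left; now apply exp_increasing|right; now f_equal]. }
rewrite (Hconst x' Hx').
replace (2 * PI * Re (f c)) with (RInt (fun _ => Re (f c)) 0 (2 * PI))
  by (rewrite RInt_const; unfold scal; simpl; unfold mult; simpl; ring).
assert (E : RInt (fun y => Re (F (x', y))) 0 (2 * PI) - RInt (fun _ => Re (f c)) 0 (2 * PI)
  = RInt (fun y => Re (F (x', y)) - Re (f c)) 0 (2 * PI)).
{ symmetry. apply (RInt_minus (V := R_CompleteNormedModule)); [now apply Hint|apply ex_RInt_const]. }
rewrite E.
apply Rle_lt_trans with ((2 * PI - 0) * (eps / (4 * PI))).
- apply abs_RInt_le_const; [lra| |].
  + apply (ex_RInt_minus (V := R_NormedModule)); [now apply Hint|apply ex_RInt_const].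
  + intros y _. left. eapply Rle_lt_trans; [|apply (Hdel (c + Cexp (x', y))%C)].
    * eapply Rle_trans; [right|apply re_le_Cmod]. unfold F, Re; simpl. reflexivity.
    * replace (c + Cexp (x', y) - c)%C with (Cexp (x', y)) by ring.
      rewrite Cmod_Cexp. exact Hex.
- apply Rle_lt_trans with (eps / 2); [right; field; lra|lra].
Qed.

Lemma RInt_nonneg_zero (g : R -> R) (a b : R) : a < b ->
  (forall x, a <= x <= b -> continuous g x) -> (forall x, a <= x <= b -> 0 <= g x) ->
  RInt g a b = 0 -> g a = 0.
Proof.
intros Hab Hc Hp H0.
destruct (Req_dec (g a) 0) as [E|E]; [assumption|exfalso].
assert (Hga : 0 < g a) by (specialize (Hp a ltac:(lra)); lra).
assert (Hca := Hc a ltac:(lra)). apply continuity_pt_filterlim in Hca.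
destruct (Hca (g a) Hga) as [d [Hd Hdel]].
set (m := Rmin b (a + d / 2)).
assert (Hm : a < m <= b) by (unfold m, Rmin; destruct (Rle_dec b (a + d / 2)); lra).
assert (Hmd : m <= a + d / 2) by apply Rmin_r.
assert (P1 : 0 < RInt g a m).
{ apply RInt_gt_0; [lra| |].
  - intros x Hx. destruct (Req_dec x a) as [->|Hne]; [assumption|].
    specialize (Hdel x). simpl in Hdel. unfold Rdist in Hdel.
    assert (Rabs (g x - g a) < g a).
    { apply Hdel. split; [split; [exact I|auto]|]. rewrite Rabs_pos_eq; lra. }
    apply Rabs_def2 in H. lra.
  - intros x Hx. apply Hc. lra. }
assert (E1 : ex_RInt g a m /\ ex_RInt g m b).
{ split; apply (ex_RInt_continuous (V := R_CompleteNormedModule)); intros z;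
    rewrite Rmin_left, Rmax_right by lra; intros Hz; apply Hc; lra. }
assert (P2 : 0 <= RInt g m b).
{ apply RInt_ge_0; [lra|apply E1|]. intros x Hx. apply Hp. lra. }
assert (E2 := RInt_Chasles (V := R_CompleteNormedModule) g a m b (proj1 E1) (proj2 E1)).
unfold plus in E2; simpl in E2. lra.
Qed.

Lemma punctured_holomorphic_scal (f : C -> C) (u z : C) (r : R) :
  punctured_holomorphic f z r -> punctured_holomorphic (fun w => u * f w)%C z r.
Proof.
intros [H1 H2]. split.
- apply ccont_mult; [apply ccont_const|assumption].
- intros w Hw. destruct (H2 w Hw) as [l Hl]. eexists.
  apply cderiv_mult; [apply cderiv_const|exact Hl].
Qed.

(** Suppose the maximum [M1] of [|f|] exceeds [M], and take the rightmost point [z2] of [K] at which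
    it is attained. Being interior, [z2] is the centre of a circle on which the mean value property
    forces [|f| = M1], and the point of that circle at angle 0 lies further right. Choosing the
    rightmost maximum replaces any connectedness argument. *)
Lemma maximum_modulus (K : C -> Prop) (f : C -> C) (a b c d M : R) :
  a <= b -> c <= d -> 0 <= M ->
  (forall z, K z -> a <= fst z <= b /\ c <= snd z <= d) ->
  (forall z, ~ K z -> exists delta, 0 < delta /\ forall w, Cmod (w - z) < delta -> ~ K w) ->
  (forall z, K z -> ccont f z) ->
  (forall z, K z -> Cmod (f z) <= M \/ exists r, 0 < r /\ punctured_holomorphic f z r /\
     forall w, Cmod (w - z) < r -> K w) ->
  forall z, K z -> Cmod (f z) <= M.
Proof.
intros Hab Hcd HM0 Hbox Hcl Hcont Hint z Hz.
apply Rnot_lt_le. intros HM.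
assert (Hbox' := Cmod_lt_box).
assert (Hclosed : forall z, ~ K z -> exists delta, 0 < delta /\ forall w,
     Rabs (fst w - fst z) < delta -> Rabs (snd w - snd z) < delta -> ~ K w).
{ intros z' Hz'. destruct (Hcl z' Hz') as [e [He H]]. exists (e / 2). split; [lra|].
  intros w H1 H2. apply H. specialize (Hbox' z' w (e / 2) H1 H2). lra. }
destruct (usc_attains_max K (fun w => Cmod (f w)) a b c d Hab Hcd) as [z1 [Hz1 Hmax]]; auto.
{ now exists z. }
{ intros z' Hz' eps He. destruct (Hcont z' Hz' eps He) as [e [He' H]].
  exists (e / 2). split; [lra|]. intros w _ H1 H2.
  specialize (H w ltac:(specialize (Hbox' z' w (e / 2) H1 H2); lra)).
  assert (H' := Cmod_triangle_rev (f w) (f z')). lra. }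
set (M1 := Cmod (f z1)) in *.
assert (HM1 : M < M1) by (specialize (Hmax z Hz); lra).
destruct (usc_attains_max (fun z => K z /\ M1 <= Cmod (f z)) Re a b c d Hab Hcd)
  as [z2 [[Hz2 Hf2] Hright]].
{ exists z1. split; [assumption|]. unfold M1. lra. }
{ intros z' [Hz' _]. now apply Hbox. }
{ intros z' Hz'. destruct (classic (K z')) as [Hk|Hk].
  - assert (Hlt : Cmod (f z') < M1) by (apply Rnot_le_lt; tauto).
    destruct (Hcont z' Hk (M1 - Cmod (f z')) ltac:(lra)) as [e [He H]].
    exists (e / 2). split; [lra|]. intros w H1 H2 [_ Hw].
    specialize (H w ltac:(specialize (Hbox' z' w (e / 2) H1 H2); lra)).
    assert (H' := Cmod_triangle_rev (f w) (f z')). lra.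
  - destruct (Hclosed z' Hk) as [e [He H]]. exists e. split; [assumption|].
    intros w H1 H2 [Hw _]. now apply (H w). }
{ intros z' _ eps He. exists eps. split; [assumption|].
  intros w _ H1 _. apply Rabs_def2 in H1. unfold Re. lra. }
assert (E2 : Cmod (f z2) = M1) by (specialize (Hmax z2 Hz2); simpl in Hmax; lra).
destruct (Hint z2 Hz2) as [Hle|[r [Hr [Hhol Hnb]]]]; [lra|].
pose (x := ln (r / 2)).
assert (Hx : exp x = r / 2) by (unfold x; apply exp_ln; lra).
(* The rotation by [u] makes the value at [z2] the positive real [M1]. Then [M1 - Re (u f)] is
   nonnegative on the circle with integral zero, hence vanishes at angle 0. *)
pose (u := (Cconj (f z2) / RtoC M1)%C).
assert (HM1C : RtoC M1 <> 0%C) by (intros HE; apply RtoC_inj in HE; lra).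
assert (Hu : Cmod u = 1).
{ unfold u. rewrite Cmod_div by assumption. rewrite Cmod_conj, E2, Cmod_R, Rabs_pos_eq by lra.
  field. lra. }
assert (Huf : (u * f z2)%C = RtoC M1).
{ unfold u. transitivity ((f z2 * Cconj (f z2)) / RtoC M1)%C; [field; assumption|].
  rewrite <- Cmod2_conj, E2. rewrite RtoC_pow. simpl. field. assumption. }
assert (Hmean := circle_mean (fun w => u * f w)%C z2 r x
  (punctured_holomorphic_scal f u z2 r Hhol) ltac:(lra)).
cbv beta in Hmean. rewrite Huf, re_RtoC in Hmean. clearbody u.
assert (Hin : forall y, K (z2 + Cexp (x, y))%C).
{ intros y. apply Hnb. replace (z2 + Cexp (x, y) - z2)%C with (Cexp (x, y)) by ring.
  rewrite Cmod_Cexp. unfold Re; simpl. lra. }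
assert (Hc : forall y, continuous (fun y => Re (u * f (z2 + Cexp (x, y)))%C) y).
{ intros y. apply (continuous_re_path (fun w => u * f w)%C).
  apply ccont_mult; [apply ccont_const|]. apply Hcont, Hin. }
assert (H0 := RInt_nonneg_zero (fun y => M1 - Re (u * f (z2 + Cexp (x, y)))%C) 0 (2 * PI)).
assert (HPI := PI_RGT_0).
assert (HRe : M1 - Re (u * f (z2 + Cexp (x, 0)%R))%C = 0).
{ apply H0; [lra| | |].
  - intros y _. apply (continuous_minus (V := R_NormedModule)); [apply continuous_const|apply Hc].
  - intros y _. assert (H1 := Hmax _ (Hin y)). simpl in H1.
    assert (H2 := re_le_Cmod (u * f (z2 + Cexp (x, y)))%C).
    rewrite Cmod_mult, Hu, Rmult_1_l in H2. apply Rabs_le_between in H2. lra.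
  - assert (E := RInt_minus (V := R_CompleteNormedModule) (fun _ => M1)
      (fun y => Re (u * f (z2 + Cexp (x, y)))%C) 0 (2 * PI)).
    unfold minus, plus, opp in E; simpl in E.
    transitivity (RInt (fun _ : R => M1) 0 (2 * PI)
       + - RInt (fun y : R => Re (u * f (z2 + Cexp (x, y)))%C) 0 (2 * PI)).
    + apply E; [apply ex_RInt_const|].
      apply (ex_RInt_continuous (V := R_CompleteNormedModule)). intros y _. apply Hc.
    + rewrite Hmean, RInt_const. unfold scal; simpl; unfold mult; simpl. ring. }
assert (Hbig : M1 <= Cmod (f (z2 + Cexp (x, 0)%R)%C)).
{ assert (H2 := re_le_Cmod (u * f (z2 + Cexp (x, 0)%R))%C).
  rewrite Cmod_mult, Hu, Rmult_1_l in H2. apply Rabs_le_between in H2. lra. }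
specialize (Hright _ (conj (Hin 0) Hbig)).
rewrite re_plus in Hright. unfold Cexp, Re in Hright; simpl in Hright.
rewrite cos_0 in Hright. lra.
Qed.

Lemma rectangle_complement_open (a b c d : R) (w : C) : ~ (a <= Re w <= b /\ c <= Im w <= d) ->
  exists e, 0 < e /\ (Re w <= a - e \/ b + e <= Re w \/ Im w <= c - e \/ d + e <= Im w).
Proof.
intros Hw.
destruct (Rlt_le_dec (Re w) a); [exists (a - Re w); split; lra|].
destruct (Rlt_le_dec b (Re w)); [exists (Re w - b); split; lra|].
destruct (Rlt_le_dec (Im w) c); [exists (c - Im w); split; lra|].
destruct (Rlt_le_dec d (Im w)); [exists (Im w - d); split; lra|].
exfalso; apply Hw; lra.
Qed.

Lemma maximum_modulus_rectangle (f : C -> C) (a b c d M : R) :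
  a <= b -> c <= d -> 0 <= M ->
  (forall z, a <= Re z <= b -> c <= Im z <= d -> exists l, cderiv f z l) ->
  (forall z, a <= Re z <= b -> c <= Im z <= d ->
     Re z = a \/ Re z = b \/ Im z = c \/ Im z = d -> Cmod (f z) <= M) ->
  forall z, a <= Re z <= b -> c <= Im z <= d -> Cmod (f z) <= M.
Proof.
intros Hab Hcd HM Hf Hb z Hz1 Hz2.
apply (maximum_modulus (fun z => a <= Re z <= b /\ c <= Im z <= d) f a b c d M); auto.
- intros w Hw.
  destruct (rectangle_complement_open a b c d w Hw) as [e [He HE]]. exists e. split; [assumption|].
  intros v Hv Hin.
  assert (H1 := re_le_Cmod (v - w)). assert (H2 := im_le_Cmod (v - w)).
  unfold Cminus in H1, H2. rewrite re_plus, re_opp in H1. rewrite im_plus, im_opp in H2.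
  assert (H3 : Rabs (Re v + - Re w) < e) by (unfold Cminus in Hv; lra).
  assert (H4 : Rabs (Im v + - Im w) < e) by (unfold Cminus in Hv; lra).
  apply Rabs_def2 in H3. apply Rabs_def2 in H4. lra.
- intros w [Hw1 Hw2]. destruct (Hf w Hw1 Hw2) as [l Hl]. eapply cderiv_ccont, Hl.
- intros w [Hw1 Hw2].
  destruct (classic (Re w = a \/ Re w = b \/ Im w = c \/ Im w = d)) as [HB|HB].
  + left. now apply Hb.
  + right.
    assert (E : exists e, 0 < e /\ a <= Re w - e /\ Re w + e <= b /\ c <= Im w - e /\ Im w + e <= d).
    { exists (Rmin (Rmin (Re w - a) (b - Re w)) (Rmin (Im w - c) (d - Im w))).
      assert (T1 := Rmin_l (Rmin (Re w - a) (b - Re w)) (Rmin (Im w - c) (d - Im w))).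
      assert (T2 := Rmin_r (Rmin (Re w - a) (b - Re w)) (Rmin (Im w - c) (d - Im w))).
      assert (T3 := Rmin_l (Re w - a) (b - Re w)). assert (T4 := Rmin_r (Re w - a) (b - Re w)).
      assert (T5 := Rmin_l (Im w - c) (d - Im w)). assert (T6 := Rmin_r (Im w - c) (d - Im w)).
      split; [|lra].
      assert (Re w <> a) by tauto. assert (Re w <> b) by tauto.
      assert (Im w <> c) by tauto. assert (Im w <> d) by tauto.
      repeat apply Rmin_glb_lt; lra. }
    destruct E as [e [He HE]].
    assert (Hin : forall v, Cmod (v - w) < e -> a <= Re v <= b /\ c <= Im v <= d).
    { intros v Hv.
      assert (H1 := re_le_Cmod (v - w)). assert (H2 := im_le_Cmod (v - w)).
      unfold Cminus in H1, H2. rewrite re_plus, re_opp in H1. rewrite im_plus, im_opp in H2.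
      assert (H3 : Rabs (Re v + - Re w) < e) by (unfold Cminus in Hv; lra).
      assert (H4 : Rabs (Im v + - Im w) < e) by (unfold Cminus in Hv; lra).
      apply Rabs_def2 in H3. apply Rabs_def2 in H4. lra. }
    exists e. split; [assumption|]. split; [|exact Hin]. split.
    * destruct (Hf w Hw1 Hw2) as [l Hl]. eapply cderiv_ccont, Hl.
    * intros v Hv. apply Hf; apply Hin; apply Hv.
Qed.

(** At the centre only continuity is demanded. This is what lets the principle be applied to
    difference quotients at [c] without a theorem on removable singularities. *)
Lemma maximum_modulus_disc (f : C -> C) (c : C) (r M : R) :
  0 < r -> 0 <= M ->
  (forall z, Cmod (z - c) <= r -> ccont f z) ->
  (forall z, Cmod (z - c) < r -> z <> c -> exists l, cderiv f z l) ->
  (forall z, Cmod (z - c) = r -> Cmod (f z) <= M) ->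
  forall z, Cmod (z - c) <= r -> Cmod (f z) <= M.
Proof.
intros Hr HM Hc Hf Hb z Hz.
apply (maximum_modulus (fun z => Cmod (z - c) <= r) f
  (fst c - r) (fst c + r) (snd c - r) (snd c + r) M); auto; try lra.
- intros w Hw. assert (H1 := re_le_Cmod (w - c)). assert (H2 := im_le_Cmod (w - c)).
  assert (H3 : Rabs (Re (w - c)) <= r) by lra. assert (H4 : Rabs (Im (w - c)) <= r) by lra.
  apply Rabs_le_between in H3. apply Rabs_le_between in H4.
  unfold Re, Im, Cminus in *; simpl in *. lra.
- intros w Hw. exists (Cmod (w - c) - r). split; [lra|].
  intros v Hv Hin. assert (H := Cmod_triangle_rev (w - c) (v - c)).
  replace (w - c - (v - c))%C with (w - v)%C in H by ring.
  rewrite (Cmod_minus_sym w v) in H. lra.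
- intros w Hw. destruct (Rle_lt_or_eq_dec _ _ Hw) as [Hlt|Heq]; [right|left; auto].
  destruct (Ceq_dec w c) as [->|Hne].
  + exists r. split; [assumption|]. repeat split; auto.
    * intros v Hv. apply Hf; [lra|]. intros ->.
      replace (c - c)%C with (RtoC 0) in Hv by ring. rewrite Cmod_0 in Hv. lra.
    * intros v Hv. lra.
  + assert (Hp : 0 < Cmod (w - c)) by now apply Cmod_gt_0, Cminus_eq_contra.
    set (e := Rmin (r - Cmod (w - c)) (Cmod (w - c))).
    assert (He1 : e <= r - Cmod (w - c)) by apply Rmin_l.
    assert (He2 : e <= Cmod (w - c)) by apply Rmin_r.
    assert (Hin : forall v, Cmod (v - w) < e -> Cmod (v - c) < r /\ v <> c).
    { intros v Hv. assert (H := Cmod_triangle (v - w) (w - c)).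
      replace (v - w + (w - c))%C with (v - c)%C in H by ring. split; [lra|].
      intros ->. rewrite Cmod_minus_sym in Hv. lra. }
    exists e. split; [apply Rmin_glb_lt; lra|]. split; [split|].
    * apply Hc. lra.
    * intros v [_ Hv]. destruct (Hin v Hv). now apply Hf.
    * intros v Hv. destruct (Hin v Hv). lra.
Qed.

(** The Caratheodory slope [phi] of [f] at [c] is the quotient [f(z) / (z - c)], continuous at [c]
    and differentiable elsewhere, and at most [M / r] on the circle. The maximum principle bounds it
    inside, and its value at [c] is the derivative. *)
Lemma schwarz (f : C -> C) (c : C) (r r' M : R) :
  0 < r < r' -> 0 <= M ->
  (forall z, Cmod (z - c) < r' -> exists l, cderiv f z l) ->
  f c = 0%C ->
  (forall z, Cmod (z - c) = r -> Cmod (f z) <= M) ->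
  (forall z, Cmod (z - c) <= r -> Cmod (f z) <= M / r * Cmod (z - c)) /\
  (forall l, cderiv f c l -> Cmod l <= M / r).
Proof.
intros Hr HM Hf H0 Hb.
assert (Hcc : Cmod (c - c) = 0) by (replace (c - c)%C with (RtoC 0) by ring; apply Cmod_0).
assert (Key : forall l, cderiv f c l -> exists phi, phi c = l /\
  (forall w, f w = phi w * (w - c))%C /\ forall z, Cmod (z - c) <= r -> Cmod (phi z) <= M / r).
{ intros l (phi & P1 & P2 & P3). exists phi. split; [assumption|].
  assert (Hphi : forall w, f w = (phi w * (w - c))%C) by (intros w; rewrite (P3 w), H0; ring).
  split; [assumption|].
  assert (Hd : forall z, Cmod (z - c) < r' -> z <> c -> exists l, cderiv phi z l).
  { intros z Hz Hne. destruct (Hf z Hz) as [m Hm].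
    assert (Hp : 0 < Cmod (z - c)) by now apply Cmod_gt_0, Cminus_eq_contra.
    eexists. apply (cderiv_local (fun w => f w * / (w - c))%C phi z _ (Cmod (z - c)) Hp).
    - intros w Hw. rewrite Hphi. field. apply Cminus_eq_contra. intros ->.
      rewrite Cmod_minus_sym in Hw. lra.
    - apply cderiv_mult; [exact Hm|]. apply cderiv_inv.
      + apply cderiv_minus; [apply cderiv_id|apply cderiv_const].
      + now apply Cminus_eq_contra. }
  apply maximum_modulus_disc; try lra.
  - apply Rdiv_le_0_compat; lra.
  - intros z Hz. destruct (Ceq_dec z c) as [->|Hne]; [assumption|].
    destruct (Hd z ltac:(lra) Hne) as [m Hm]. eapply cderiv_ccont, Hm.
  - intros z Hz Hne. apply Hd; [lra|assumption].
  - intros z Hz. specialize (Hb z Hz). rewrite Hphi, Cmod_mult, Hz in Hb.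
    apply Rmult_le_reg_r with r; [lra|].
    replace (M / r * r) with M by (field; lra). exact Hb. }
split.
- intros z Hz. destruct (Hf c ltac:(lra)) as [l Hl].
  destruct (Key l Hl) as (phi & _ & P2 & P3).
  rewrite P2, Cmod_mult. apply Rmult_le_compat_r; [apply Cmod_ge_0|now apply P3].
- intros l Hl. destruct (Key l Hl) as (phi & <- & _ & P3). apply P3. lra.
Qed.

(** Schwarz's lemma for [f - f(c)], whose modulus is at most [2 M]; hence the factor 2 in place of
    Cauchy's constant 1. *)
Lemma cauchy_derivative_bound (f : C -> C) (c l : C) (r r' M : R) :
  0 < r < r' ->
  (forall z, Cmod (z - c) < r' -> exists l, cderiv f z l) ->
  (forall z, Cmod (z - c) <= r -> Cmod (f z) <= M) ->
  cderiv f c l -> Cmod l <= 2 * M / r.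
Proof.
intros Hr Hf Hb Hl.
assert (Hc : Cmod (f c) <= M).
{ apply Hb. replace (c - c)%C with (RtoC 0) by ring. rewrite Cmod_0. lra. }
assert (0 <= Cmod (f c)) by apply Cmod_ge_0.
destruct (schwarz (fun z => f z - f c)%C c r r' (2 * M)) as [_ H']; try lra.
- intros z Hz. destruct (Hf z Hz) as [m Hm]. eexists.
  apply cderiv_minus; [exact Hm|apply cderiv_const].
- ring.
- intros z Hz. eapply Rle_trans; [apply Cmod_triangle_minus|].
  specialize (Hb z ltac:(lra)). lra.
- apply H'. eapply cderiv_eq; [apply cderiv_minus; [exact Hl|apply cderiv_const]|]. ring.
Qed.

(** The map [w / (2A - w)] takes the half-plane [Re w <= A] into the closed unit disc and fixes 0,
    so Schwarz's lemma applies to [f / (2A - f)]; solving for [|f|] gives the claim. The denominator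
    is kept on the left so that [|z - c| = r] needs no exception. *)
Lemma borel_caratheodory (f : C -> C) (c : C) (r r' A : R) :
  0 < r < r' -> 0 < A ->
  (forall z, Cmod (z - c) < r' -> exists l, cderiv f z l) ->
  f c = 0%C ->
  (forall z, Cmod (z - c) < r' -> Re (f z) <= A) ->
  forall z, Cmod (z - c) <= r -> Cmod (f z) * (r - Cmod (z - c)) <= 2 * A * Cmod (z - c).
Proof.
intros Hr HA Hf H0 HRe z Hz.
assert (Hden : forall w, Cmod (w - c) < r' -> A <= Re (2 * A - f w)%C).
{ intros w Hw. specialize (HRe w Hw).
  replace (Re (2 * A - f w)%C) with (2 * A - Re (f w)) by (unfold Re; simpl; ring). lra. }
assert (Hne : forall w, Cmod (w - c) < r' -> (2 * A - f w)%C <> 0%C).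
{ intros w Hw E. specialize (Hden w Hw). rewrite E in Hden. unfold Re in Hden; simpl in Hden. lra. }
destruct (schwarz (fun w => f w * / (2 * A - f w))%C c r r' 1) as [H _]; try lra.
- intros w Hw. destruct (Hf w Hw) as [m Hm]. eexists.
  apply cderiv_mult; [exact Hm|]. apply cderiv_inv; [|now apply Hne].
  apply cderiv_minus; [apply cderiv_const|exact Hm].
- rewrite H0. ring.
- intros w Hw. assert (Hw' : Cmod (w - c) < r') by lra.
  rewrite Cmod_mult, Cmod_inv by now apply Hne.
  assert (Hp : 0 < Cmod (2 * A - f w)) by now apply Cmod_gt_0, Hne.
  apply Rmult_le_reg_r with (1 := Hp). rewrite Rmult_assoc, Rinv_l, Rmult_1_l, Rmult_1_r by lra.
  (* [|2A - f|^2 - |f|^2 = 4A (A - Re f)], which is nonnegative. *)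
  unfold Cmod. apply sqrt_le_1_alt. specialize (HRe w Hw').
  unfold Re in HRe. simpl. nra.
- specialize (H z Hz). simpl in H.
  assert (Hz' : Cmod (z - c) < r') by lra.
  rewrite Cmod_mult, Cmod_inv in H by now apply Hne.
  assert (Hp : 0 < Cmod (2 * A - f z)) by now apply Cmod_gt_0, Hne.
  assert (Ht : Cmod (2 * A - f z) <= 2 * A + Cmod (f z)).
  { eapply Rle_trans; [apply Cmod_triangle_minus|].
    rewrite <- RtoC_mult, Cmod_R, Rabs_pos_eq by lra. lra. }
  set (D := Cmod (2 * A - f z)) in *. set (q := Cmod (z - c)) in *. set (F := Cmod (f z)) in *.
  assert (Hq : 0 <= q) by apply Cmod_ge_0.
  assert (H2 : F * r <= q * D).
  { apply Rmult_le_compat_r with (r := D * r) in H; [|apply Rmult_le_pos; lra].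
    replace (F * / D * (D * r)) with (F * r) in H by (field; lra).
    replace (1 / r * q * (D * r)) with (q * D) in H by (field; lra). exact H. }
  nra.
Qed.

(** Since [f] vanishes near [c], the quotient [f(z) / (z - c)^N] is differentiable at [c] as well
    for every [N]. The maximum principle on the circle of radius [s] gives
    [|f(z)| <= M (|z - c| / s)^N], which tends to 0 because [|z - c| < s]. *)
Lemma identity_theorem_disc (f : C -> C) (c : C) (r rho : R) :
  0 < rho ->
  (forall z, Cmod (z - c) < r -> exists l, cderiv f z l) ->
  (forall z, Cmod (z - c) < rho -> f z = 0%C) ->
  forall z, Cmod (z - c) < r -> f z = 0%C.
Proof.
intros Hrho Hf H0 z Hz.
assert (Hr : 0 < r) by (assert (H := Cmod_ge_0 (z - c)); lra).
set (s := (Cmod (z - c) + r) / 2).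
assert (Hs : 0 < s < r) by (unfold s; assert (H := Cmod_ge_0 (z - c)); lra).
assert (Hsz : Cmod (z - c) < s) by (unfold s; lra).
assert (HM : exists M, 0 <= M /\ forall w, Cmod (w - c) <= s -> Cmod (f w) <= M).
{ destruct (usc_attains_max (fun w => Cmod (w - c) <= s) (fun w => Cmod (f w))
    (fst c - s) (fst c + s) (snd c - s) (snd c + s)) as [u [_ Hu]]; try lra.
  - exists z. lra.
  - intros w Hw. assert (H1 := re_le_Cmod (w - c)). assert (H2 := im_le_Cmod (w - c)).
    assert (H3 : Rabs (Re (w - c)) <= s) by lra. assert (H4 : Rabs (Im (w - c)) <= s) by lra.
    apply Rabs_le_between in H3. apply Rabs_le_between in H4.
    unfold Re, Im, Cminus in *; simpl in *. lra.
  - intros w Hw. exists ((Cmod (w - c) - s) / 2). split; [lra|].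
    intros v Hv1 Hv2 Hin. assert (H := Cmod_triangle_rev (w - c) (v - c)).
    replace (w - c - (v - c))%C with (w - v)%C in H by ring.
    rewrite (Cmod_minus_sym w v) in H. assert (H' := Cmod_lt_box _ _ _ Hv1 Hv2). lra.
  - intros w Hw eps He. destruct (Hf w ltac:(lra)) as [l Hl].
    destruct (cderiv_ccont _ _ _ Hl eps He) as [d [Hd H]].
    exists (d / 2). split; [lra|]. intros v _ Hv1 Hv2.
    specialize (H v ltac:(assert (H' := Cmod_lt_box _ _ _ Hv1 Hv2); lra)).
    assert (H2 := Cmod_triangle_rev (f v) (f w)). lra.
  - exists (Cmod (f u)). split; [apply Cmod_ge_0|exact Hu]. }
destruct HM as [M [HM0 HM]].
destruct (Ceq_dec z c) as [->|Hne].
{ apply H0. replace (c - c)%C with (RtoC 0) by ring. now rewrite Cmod_0. }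
assert (Hzp : 0 < Cmod (z - c)) by now apply Cmod_gt_0, Cminus_eq_contra.
assert (HN : forall N, Cmod (f z) <= M * (Cmod (z - c) / s) ^ N).
{ intros N.
  pose (q := fun w => (f w * / (w - c) ^ N)%C).
  assert (Hq : forall w, Cmod (w - c) < r -> exists l, cderiv q w l).
  { intros w Hw. destruct (Ceq_dec w c) as [->|Hwc].
    - exists 0%C. apply (cderiv_local (fun _ => RtoC 0) q c 0%C rho Hrho).
      + intros v Hv. unfold q. rewrite H0 by assumption. ring.
      + apply cderiv_const.
    - destruct (Hf w Hw) as [l Hl].
      destruct (cderiv_pow (fun w => w - c)%C w (1 - 0)%C N) as [m Hm].
      { apply cderiv_minus; [apply cderiv_id|apply cderiv_const]. }
      eexists. apply cderiv_mult; [exact Hl|]. apply cderiv_inv; [exact Hm|].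
      now apply Cpow_nz, Cminus_eq_contra. }
  assert (Hb : Cmod (q z) <= M / s ^ N).
  { apply (maximum_modulus_disc q c s); try lra.
    - apply Rdiv_le_0_compat; [lra|]. apply pow_lt; lra.
    - intros w Hw. destruct (Hq w ltac:(lra)) as [l Hl]. eapply cderiv_ccont, Hl.
    - intros w Hw _. apply Hq; lra.
    - intros w Hw. unfold q. rewrite Cmod_mult, Cmod_inv, Cmod_pow, Hw.
      + apply Rmult_le_compat_r; [left; apply Rinv_0_lt_compat, pow_lt; lra|apply HM; lra].
      + apply Cpow_nz, Cminus_eq_contra. intros ->.
        replace (c - c)%C with (RtoC 0) in Hw by ring. rewrite Cmod_0 in Hw. lra. }
  unfold q in Hb. rewrite Cmod_mult, Cmod_inv, Cmod_pow in Hb by now apply Cpow_nz, Cminus_eq_contra.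
  assert (Hpz : 0 < Cmod (z - c) ^ N) by now apply pow_lt.
  assert (Hps : 0 < s ^ N) by (apply pow_lt; lra).
  unfold Rdiv at 1. rewrite Rpow_mult_distr, pow_inv.
  apply Rmult_le_compat_r with (r := Cmod (z - c) ^ N) in Hb; [|lra].
  rewrite Rmult_assoc, Rinv_l, Rmult_1_r in Hb by lra.
  eapply Rle_trans; [exact Hb|]. right. field. lra. }
apply Cmod_eq_0. apply Rle_antisym; [|apply Cmod_ge_0].
apply le_epsilon. intros eps He. rewrite Rplus_0_l.
destruct (pow_lt_1_zero (Cmod (z - c) / s)) with (y := eps / (M + 1)) as [N HN'].
- rewrite Rabs_pos_eq by (apply Rdiv_le_0_compat; lra).
  apply Rmult_lt_reg_r with s; [lra|]. unfold Rdiv. rewrite Rmult_assoc, Rinv_l by lra. lra.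
- apply Rdiv_lt_0_compat; lra.
- specialize (HN' N (le_n N)). specialize (HN N).
  assert (Hp : 0 <= (Cmod (z - c) / s) ^ N) by (apply pow_le, Rdiv_le_0_compat; lra).
  rewrite Rabs_pos_eq in HN' by assumption.
  apply Rle_trans with (1 := HN).
  apply Rle_trans with ((M + 1) * (eps / (M + 1))); [|right; field; lra].
  apply Rmult_le_compat; lra.
Qed.

Lemma exp_le_compat (x y : R) : x <= y -> exp x <= exp y.
Proof. intros [H| ->]; [left; now apply exp_increasing|lra]. Qed.

Lemma ln_le_self (u : R) : 0 < u -> ln u <= u - 1.
Proof. intros Hu. assert (H := exp_ineq1_le (ln u)). rewrite exp_ln in H by assumption. lra. Qed.

Lemma ln_le_half (u : R) : 0 < u -> ln u <= u / 2.
Proof.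
intros Hu. assert (H := ln_le_self (u / 2) ltac:(lra)).
rewrite ln_div in H by lra. assert (H2 := ln_le_self 2 ltac:(lra)). lra.
Qed.

Lemma ln_mono (x y : R) : 0 < x -> x <= y -> ln x <= ln y.
Proof. intros H [H1| ->]; [left; now apply ln_increasing|lra]. Qed.

Lemma Cmod_gaussian (s s0 : C) :
  Cmod (Cexp ((s - s0) * (s - s0))) = exp ((Re s - Re s0) ^ 2 - (Im s - Im s0) ^ 2).
Proof.
rewrite Cmod_Cexp. f_equal. rewrite re_mult. unfold Cminus.
rewrite re_plus, im_plus, re_opp, im_opp. ring.
Qed.

Lemma cderiv_gaussian (s0 s : C) : exists l, cderiv (fun s => Cexp ((s - s0) * (s - s0))) s l.
Proof.
eexists. apply (cderiv_comp Cexp (fun s => (s - s0) * (s - s0))%C); [|apply cderiv_Cexp].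
apply cderiv_mult; apply cderiv_minus; try apply cderiv_id; apply cderiv_const.
Qed.

Lemma cderiv_Cexp_affine (a b s : C) : exists l, cderiv (fun s => Cexp (a * (s - b))) s l.
Proof.
eexists. apply (cderiv_comp Cexp (fun s => a * (s - b))%C); [|apply cderiv_Cexp].
apply cderiv_mult; [apply cderiv_const|].
apply cderiv_minus; [apply cderiv_id|apply cderiv_const].
Qed.

Lemma Cmod_dist_bounds (z w : C) (r : R) : Cmod (z - w) < r ->
  Rabs (Re z - Re w) < r /\ Rabs (Im z - Im w) < r.
Proof.
intros H. split; (eapply Rle_lt_trans; [|exact H]).
- eapply Rle_trans; [right|apply re_le_Cmod]. unfold Cminus. now rewrite re_plus, re_opp.
- eapply Rle_trans; [right|apply im_le_Cmod]. unfold Cminus. now rewrite im_plus, im_opp.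
Qed.

(** * The Euler product *)

Definition clim (u : nat -> C) (l : C) : Prop :=
  forall eps, 0 < eps -> exists N, forall n, (N <= n)%nat -> Cmod (u n - l) < eps.

(** Balls of the product uniform structure on [C] are squares; the two notions differ by a factor at
    most 2 in the radius. *)
Lemma filterlim_clim (u : nat -> C) (l : C) :
  filterlim u eventually (locally (T := C_UniformSpace) l) <-> clim u l.
Proof.
split.
- intros H eps He.
  destruct (H (fun z => Cmod (z - l) < eps)) as [N HN].
  + assert (He2 : 0 < eps / 2) by lra. exists (mkposreal _ He2).
    intros z [Hz1 Hz2]. replace eps with (2 * (eps / 2)) by field.
    apply Cmod_lt_box; assumption.
  + exists N. exact HN.
- intros H P [eps HP]. destruct (H eps (cond_pos eps)) as [N HN].
  exists N. intros n Hn. apply HP. specialize (HN n Hn).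
  split; [apply Rle_lt_trans with (2 := HN), (re_le_Cmod (u n - l))|
          apply Rle_lt_trans with (2 := HN), (im_le_Cmod (u n - l))].
Qed.

Fixpoint csum (u : nat -> C) (n : nat) : C :=
  match n with
  | O => 0
  | S k => (csum u k + u k)%C
  end.

Lemma csum_sum_n (u : nat -> C) (n : nat) :
  csum u (S n) = sum_n (G := C_AbelianMonoid) u n.
Proof.
induction n as [|n IH].
- rewrite sum_O. simpl. ring.
- rewrite sum_Sn, <- IH. reflexivity.
Qed.

Lemma clim_shift (u : nat -> C) (l : C) : clim (fun n => u (S n)) l <-> clim u l.
Proof.
split; intros H eps He; destruct (H eps He) as [N HN].
- exists (S N). intros [|n] Hn; [lia|]. apply HN. lia.
- exists N. intros n Hn. apply HN. lia.
Qed.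

Lemma clim_ext (u v : nat -> C) (l : C) : (forall n, u n = v n) -> clim u l -> clim v l.
Proof.
intros E H eps He. destruct (H eps He) as [N HN]. exists N. intros n Hn. rewrite <- E. auto.
Qed.

Lemma is_series_clim (u : nat -> C) (l : C) :
  is_series (K := C_AbsRing) (V := C_NormedModule) u l <-> clim (csum u) l.
Proof.
unfold is_series.
transitivity (clim (fun n => sum_n (G := C_AbelianMonoid) u n) l).
- apply filterlim_clim.
- rewrite <- (clim_shift (csum u)).
  split; apply clim_ext; intros n; now rewrite csum_sum_n.
Qed.

Lemma clim_unique (u : nat -> C) (l l' : C) : clim u l -> clim u l' -> l = l'.
Proof.
intros H H'. apply Ceq_minus. apply Cmod_eq_0. apply Rle_antisym; [|apply Cmod_ge_0].
apply le_epsilon. intros eps He. rewrite Rplus_0_l.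
destruct (H (eps / 2) ltac:(lra)) as [N HN]. destruct (H' (eps / 2) ltac:(lra)) as [N' HN'].
specialize (HN (N + N')%nat ltac:(lia)). specialize (HN' (N + N')%nat ltac:(lia)).
rewrite Cmod_minus_sym in HN.
assert (T := Cmod_triangle (l - u (N + N')%nat) (u (N + N')%nat - l')).
replace (l - u (N + N')%nat + (u (N + N')%nat - l'))%C with (l - l')%C in T by ring. lra.
Qed.

Lemma clim_const (c : C) : clim (fun _ => c) c.
Proof.
intros eps He. exists O. intros n _. replace (c - c)%C with (RtoC 0) by ring. now rewrite Cmod_0.
Qed.

Lemma clim_plus (u v : nat -> C) (l m : C) :
  clim u l -> clim v m -> clim (fun n => u n + v n)%C (l + m).
Proof.
intros H H' eps He.
destruct (H (eps / 2) ltac:(lra)) as [N HN]. destruct (H' (eps / 2) ltac:(lra)) as [N' HN'].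
exists (max N N'). intros n Hn.
specialize (HN n ltac:(lia)). specialize (HN' n ltac:(lia)).
replace (u n + v n - (l + m))%C with ((u n - l) + (v n - m))%C by ring.
eapply Rle_lt_trans; [apply Cmod_triangle|]. lra.
Qed.

Lemma clim_ccont (f : C -> C) (u : nat -> C) (l : C) :
  clim u l -> ccont f l -> clim (fun n => f (u n)) (f l).
Proof.
intros H Hf eps He. destruct (Hf eps He) as [d [Hd H1]]. destruct (H d Hd) as [N HN].
exists N. intros n Hn. apply H1, HN, Hn.
Qed.

Lemma clim_scal (c : C) (u : nat -> C) (l : C) : clim u l -> clim (fun n => c * u n)%C (c * l).
Proof.
intros H. apply (clim_ccont (fun z => c * z)%C); [assumption|].
apply ccont_mult; [apply ccont_const|apply ccont_id].
Qed.

Lemma clim_subseq (u : nat -> C) (l : C) (phi : nat -> nat) :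
  (forall N, exists N', forall n, (N' <= n)%nat -> (N <= phi n)%nat) ->
  clim u l -> clim (fun n => u (phi n)) l.
Proof.
intros Hp H eps He. destruct (H eps He) as [N HN]. destruct (Hp N) as [N' HN'].
exists N'. intros n Hn. apply HN, HN', Hn.
Qed.

Lemma clim_Cmod_le (u : nat -> C) (l z : C) (B : R) :
  clim u l -> (exists N, forall n, (N <= n)%nat -> Cmod (u n - z) <= B) -> Cmod (l - z) <= B.
Proof.
intros H [N HN]. apply le_epsilon. intros eps He.
destruct (H eps He) as [N' HN'].
specialize (HN (N + N')%nat ltac:(lia)). specialize (HN' (N + N')%nat ltac:(lia)).
rewrite Cmod_minus_sym in HN'.
assert (T := Cmod_triangle (l - u (N + N')%nat) (u (N + N')%nat - z)).
replace (l - u (N + N')%nat + (u (N + N')%nat - z))%C with (l - z)%C in T by ring. lra.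
Qed.

(** * Dirichlet coefficients and sieving *)

Definition npow (n : nat) (x : R) : R := Rpower (INR n) x.

Lemma npow_pos (n : nat) (x : R) : 0 < npow n x.
Proof. apply exp_pos. Qed.

Lemma npow_mult (q k : nat) (x : R) : (1 <= q)%nat -> (1 <= k)%nat ->
  npow (q * k) x = npow q x * npow k x.
Proof.
intros Hq Hk. unfold npow. rewrite mult_INR.
symmetry. apply Rpower_mult_distr; apply lt_0_INR; lia.
Qed.

Lemma npow_1 (x : R) : npow 1 x = 1.
Proof. unfold npow. simpl. unfold Rpower. rewrite ln_1, Rmult_0_r. apply exp_0. Qed.

Lemma npow_plus (n : nat) (x y : R) : npow n (x + y) = npow n x * npow n y.
Proof. apply Rpower_plus. Qed.

Lemma npow_opp (n : nat) (x : R) : npow n (- x) = / npow n x.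
Proof. apply Rpower_Ropp. Qed.

Lemma RCpow_npow (n : nat) (x : R) : RCpow (INR n) (RtoC x) = RtoC (npow n x).
Proof.
unfold RCpow, npow, Rpower, Cexp. rewrite <- RtoC_mult.
unfold Re, Im, RtoC; simpl. rewrite cos_0, sin_0. f_equal; ring.
Qed.

Lemma Cmod_RCpow (n : nat) (s : C) : Cmod (RCpow (INR n) s) = npow n (Re s).
Proof.
unfold RCpow, npow, Rpower. rewrite Cmod_Cexp. f_equal. unfold Re; simpl. ring.
Qed.

Lemma RCpow_neq0 (x : R) (s : C) : RCpow x s <> 0%C.
Proof. apply Cexp_neq0. Qed.

Definition dpart (c : nat -> C) (x : R) (N : nat) : C :=
  csum (fun i => c (S i) * RtoC (npow (S i) (- x)))%C N.

(* The coefficients of the Dirichlet series of [c] multiplied by [1 - beta q^-x]. *)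
Definition sieve (q : nat) (beta : C) (c : nat -> C) (n : nat) : C :=
  if (n mod q =? 0)%nat then (c n - beta * c (n / q)%nat)%C else c n.

(** The multiples of [q] up to [N] are the [q k] with [k <= N / q], so multiplication by
    [1 - beta q^-x] is exact already on partial sums. Convergence alone then passes to the sieved
    series, with no rearrangement. *)
Lemma dpart_sieve (q : nat) (beta : C) (c : nat -> C) (x : R) (N : nat) : (2 <= q)%nat ->
  dpart (sieve q beta c) x N =
    (dpart c x N - beta * RtoC (npow q (- x)) * dpart c x (N / q))%C.
Proof.
intros Hq. induction N as [|N IH].
- rewrite Nat.Div0.div_0_l. unfold dpart; simpl. ring.
- unfold dpart in *. simpl csum at 1 2. rewrite IH. unfold sieve.
  destruct (Nat.eqb_spec (S N mod q) 0) as [E|E].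
  + assert (Hd : (S N / q = S (N / q))%nat).
    { assert (H1 := Nat.div_mod_eq (S N) q). assert (H2 := Nat.div_mod_eq N q).
      assert (H3 := Nat.mod_upper_bound N q ltac:(lia)).
      rewrite E in H1. nia. }
    assert (HN : (S N = q * S (N / q))%nat).
    { assert (H1 := Nat.div_mod_eq (S N) q). rewrite E, Hd in H1. lia. }
    rewrite Hd. simpl csum.
    assert (Hp : npow (S N) (- x) = npow q (- x) * npow (S (N / q)) (- x)).
    { rewrite HN at 1. apply npow_mult; lia. }
    rewrite Hp, RtoC_mult. ring.
  + assert (Hd : (S N / q = N / q)%nat).
    { assert (H1 := Nat.div_mod_eq (S N) q). assert (H2 := Nat.div_mod_eq N q).
      assert (H3 := Nat.mod_upper_bound N q ltac:(lia)).
      assert (H4 := Nat.mod_upper_bound (S N) q ltac:(lia)). nia. }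
    rewrite Hd. ring.
Qed.

Lemma clim_dpart_sieve (q : nat) (beta : C) (c : nat -> C) (x : R) (v : C) : (2 <= q)%nat ->
  clim (dpart c x) v ->
  clim (dpart (sieve q beta c) x) (v * (1 - beta * RtoC (npow q (- x))))%C.
Proof.
intros Hq H.
apply clim_ext with (fun N => dpart c x N + (- (beta * RtoC (npow q (- x)))) * dpart c x (N / q))%C.
- intros N. rewrite dpart_sieve by assumption. ring.
- replace (v * (1 - beta * RtoC (npow q (- x))))%C
    with (v + (- (beta * RtoC (npow q (- x)))) * v)%C by ring.
  apply clim_plus; [assumption|]. apply clim_scal.
  apply (clim_subseq (dpart c x) v (fun N => (N / q)%nat)); [|assumption].
  intros N. exists (q * N)%nat. intros n Hn. apply Nat.div_le_lower_bound; lia.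
Qed.

Fixpoint sieve_factor (alpha : nat -> nat -> C) (p m : nat) (c : nat -> C) : nat -> C :=
  match m with
  | O => c
  | S k => sieve p (alpha (S k) p) (sieve_factor alpha p k c)
  end.

Fixpoint sieve_upto (alpha : nat -> nat -> C) (m P : nat) (c : nat -> C) : nat -> C :=
  match P with
  | O => c
  | S P' => if is_prime_dec P then sieve_factor alpha P m (sieve_upto alpha m P' c)
            else sieve_upto alpha m P' c
  end.

Lemma is_prime_ge2 (p : nat) : is_prime p -> (2 <= p)%nat.
Proof. intros H. apply prime_ge_2 in H. lia. Qed.

Definition euler_partial (m : nat) (alpha : nat -> nat -> C) (s : C) : nat -> C :=
  Cprod (fun p => if is_prime_dec p then euler_factor m alpha s p else RtoC 1).

Lemma Cprod_neq0 (u : nat -> C) (n : nat) :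
  (forall k, (1 <= k <= n)%nat -> u k <> 0%C) -> Cprod u n <> 0%C.
Proof.
induction n as [|n IH]; intros H; simpl; [apply C1_nz|].
apply Cmult_neq_0; [apply IH; intros; apply H; lia|apply H; lia].
Qed.

Lemma clim_sieve_factor (alpha : nat -> nat -> C) (p m : nat) (c : nat -> C) (x : R) (v : C) :
  (2 <= p)%nat ->
  clim (dpart c x) v ->
  clim (dpart (sieve_factor alpha p m c) x)
    (v * Cprod (fun j => 1 - alpha j p * RtoC (npow p (- x))) m)%C.
Proof.
intros Hp H. induction m as [|m IH]; simpl.
- now replace (v * 1)%C with v by ring.
- rewrite Cmult_assoc. now apply clim_dpart_sieve.
Qed.

Lemma Cprod_mult_inv (u v : nat -> C) (n : nat) :
  (forall k, (1 <= k <= n)%nat -> (u k * v k)%C = 1%C) -> (Cprod u n * Cprod v n)%C = 1%C.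
Proof.
induction n as [|n IH]; intros H; simpl; [ring|].
transitivity ((Cprod u n * Cprod v n) * (u (S n) * v (S n)))%C; [ring|].
rewrite IH, H by (intros; try apply H; lia). ring.
Qed.

Lemma euler_factor_inv (m p : nat) (alpha : nat -> nat -> C) (x : R) :
  (forall j, (1 <= j <= m)%nat -> (1 - alpha j p / RCpow (INR p) (RtoC x))%C <> RtoC 0) ->
  (Cprod (fun j => 1 - alpha j p * RtoC (npow p (- x))) m * euler_factor m alpha (RtoC x) p)%C = 1%C.
Proof.
intros H. unfold euler_factor. apply Cprod_mult_inv. intros k Hk.
specialize (H k Hk). rewrite RCpow_npow in *.
assert (E : (1 - alpha k p * RtoC (npow p (- x)) = 1 - alpha k p / RtoC (npow p x))%C).
{ rewrite npow_opp, RtoC_inv by (apply Rgt_not_eq, npow_pos). reflexivity. }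
rewrite E. now apply Cinv_r.
Qed.

Lemma npow_antitone (n k : nat) (x : R) : (1 <= n <= k)%nat -> x <= 0 -> npow k x <= npow n x.
Proof.
intros Hn Hx. unfold npow, Rpower.
assert (H : ln (INR n) <= ln (INR k)).
{ destruct (Nat.eq_dec n k) as [->|Hne]; [lra|].
  left. apply ln_increasing; [apply lt_0_INR; lia|apply lt_INR; lia]. }
destruct (Rle_lt_or_eq_dec (x * ln (INR k)) (x * ln (INR n))) as [E|E].
- nra.
- left. now apply exp_increasing.
- right. now rewrite E.
Qed.

Lemma npow_m2 (n : nat) : (1 <= n)%nat -> npow n (- 2) = / INR n ^ 2.
Proof.
intros Hn. change (npow n (Ropp 2) = / INR n ^ 2). rewrite npow_opp. f_equal. unfold npow.
rewrite <- Rpower_pow by (apply lt_0_INR; lia). reflexivity.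
Qed.

(** Beyond [n0] the terms are at most [K A n^-2] with [A = (n0 + 1)^(e + 2 - x)], and the sum of
    [n^-2] telescopes. Keeping the base [n0 + 1], and not [n0], is essential: the tail must be
    exponentially smaller in [x] than the term at [n0]. *)
Lemma dpart_tail (c : nat -> C) (K e x : R) (n0 k : nat) : 0 <= K -> e + 2 <= x ->
  (forall n, (1 <= n)%nat -> Cmod (c n) <= K * npow n e) ->
  Cmod (dpart c x (n0 + k) - dpart c x n0) <= 2 * K * npow (S n0) (e + 2 - x).
Proof.
intros HK Hx Hc.
set (A := npow (S n0) (e + 2 - x)).
assert (HA : 0 < A) by apply npow_pos.
assert (Hterm : forall n, (S n0 <= n)%nat ->
  Cmod (c n * RtoC (npow n (- x))) <= K * A * / INR n ^ 2).
{ intros n Hn. rewrite Cmod_mult, Cmod_R, Rabs_pos_eq by (left; apply npow_pos).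
  apply Rle_trans with (K * npow n e * npow n (- x)).
  - apply Rmult_le_compat_r; [left; apply npow_pos|apply Hc; lia].
  - rewrite <- npow_m2 by lia.
    replace (- x) with ((e + 2 - x) + (- 2) + (- e)) by ring.
    rewrite !npow_plus, (npow_opp n e).
    assert (H1 := npow_antitone (S n0) n (e + 2 - x) ltac:(lia) ltac:(lra)). fold A in H1.
    assert (H2 := npow_pos n e). assert (H3 := npow_pos n (- 2)).
    replace (K * npow n e * (npow n (e + 2 - x) * npow n (-2) * / npow n e))
      with (K * npow n (-2) * npow n (e + 2 - x)) by (field; lra).
    replace (K * A * npow n (-2)) with (K * npow n (-2) * A) by ring.
    apply Rmult_le_compat_l; [apply Rmult_le_pos; lra|exact H1]. }
(* The correction [- / INR (n0 + k)] makes the induction close; for [k = 0] and [n0 = 0] it would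
   read [/ 0], hence the exclusion. *)
assert (Hstrong : k <> O ->
  Cmod (dpart c x (n0 + k) - dpart c x n0) <= K * A * (2 - / INR (n0 + k))).
{ induction k as [|k IH]; [tauto|intros _].
  assert (HKA : 0 <= K * A) by (apply Rmult_le_pos; lra).
  rewrite Nat.add_succ_r. unfold dpart in *. simpl csum.
  set (S1 := csum (fun i : nat => (c (S i) * RtoC (npow (S i) (- x)))%C) (n0 + k)) in *.
  set (S0 := csum (fun i : nat => (c (S i) * RtoC (npow (S i) (- x)))%C) n0) in *.
  assert (Ht := Hterm (S (n0 + k)) ltac:(lia)).
  replace (S1 + c (S (n0 + k)) * RtoC (npow (S (n0 + k)) (- x)) - S0)%C
    with ((S1 - S0) + c (S (n0 + k)) * RtoC (npow (S (n0 + k)) (- x)))%C by ring.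
  eapply Rle_trans; [apply Cmod_triangle|].
  destruct k as [|k].
  - assert (E0 : Cmod (S1 - S0) = 0).
    { unfold S1, S0. rewrite Nat.add_0_r.
      match goal with |- Cmod (?a - ?a) = 0 => replace (a - a)%C with (RtoC 0) by ring end.
      apply Cmod_0. }
    rewrite E0, Rplus_0_l. apply Rle_trans with (1 := Ht).
    apply Rmult_le_compat_l; [assumption|].
    assert (H1 : 1 <= INR (S (n0 + 0))) by (apply one_le_INR; lia).
    set (y := INR (S (n0 + 0))) in *.
    assert (Hi : 0 < / y <= 1).
    { split; [apply Rinv_0_lt_compat; lra|]. rewrite <- Rinv_1. apply Rinv_le_contravar; lra. }
    rewrite <- pow_inv. simpl. nra.
  - specialize (IH ltac:(lia)).
    apply Rle_trans with (K * A * (2 - / INR (n0 + S k)) + K * A * / INR (S (n0 + S k)) ^ 2); [lra|].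
    rewrite <- Rmult_plus_distr_l. apply Rmult_le_compat_l; [assumption|].
    rewrite S_INR.
    assert (H1 : 1 <= INR (n0 + S k)) by (apply one_le_INR; lia).
    set (y := INR (n0 + S k)) in *.
    assert (H2 : / y - / (y + 1) - / (y + 1) ^ 2 = / (y * (y + 1) ^ 2)) by (field; lra).
    assert (0 < / (y * (y + 1) ^ 2)).
    { apply Rinv_0_lt_compat. apply Rmult_lt_0_compat; [lra|apply pow_lt; lra]. }
    lra. }
destruct (Nat.eq_dec k 0) as [->|Hk].
- rewrite Nat.add_0_r. replace (dpart c x n0 - dpart c x n0)%C with (RtoC 0) by ring.
  rewrite Cmod_0. apply Rmult_le_pos; lra.
- apply Rle_trans with (1 := Hstrong Hk).
  replace (2 * K * A) with (K * A * 2) by ring.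
  apply Rmult_le_compat_l; [apply Rmult_le_pos; lra|].
  assert (0 < / INR (n0 + k)) by (apply Rinv_0_lt_compat, lt_0_INR; lia). lra.
Qed.

(** The coefficients of the Dirichlet series that is identically 1. *)
Definition delta1 (n : nat) : C := if (n =? 1)%nat then RtoC 1 else RtoC 0.

Lemma dpart_delta1 (c : nat -> C) (x : R) (n : nat) :
  (forall i, (1 <= i <= n)%nat -> c i = delta1 i) ->
  dpart c x n = if (n =? 0)%nat then RtoC 0 else RtoC 1.
Proof.
intros H. induction n as [|n IH]; [reflexivity|].
unfold dpart in *. simpl csum. rewrite IH by (intros; apply H; lia). rewrite H by lia.
destruct n as [|n]; unfold delta1; simpl.
- rewrite npow_1. ring.
- ring.
Qed.

Lemma geometric_domination_zero (B A q y0 : R) : 0 <= B -> 0 < q < 1 ->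
  (forall y, y0 <= y -> B <= A * Rpower q y) -> B = 0.
Proof.
intros HB Hq H. apply Rle_antisym; [|assumption].
apply Rnot_lt_le. intros Hlt.
assert (HA : 0 < A).
{ specialize (H y0 ltac:(lra)). assert (0 < Rpower q y0) by apply exp_pos.
  apply Rnot_le_lt. intros HA. nra. }
assert (Hl : ln q < 0) by (rewrite <- ln_1; apply ln_increasing; lra).
set (y := Rmax y0 (ln (B / (2 * A)) / ln q)).
specialize (H y (Rmax_l _ _)).
assert (HBA : 0 < B / (2 * A)) by (apply Rdiv_lt_0_compat; lra).
assert (Hle : Rpower q y <= B / (2 * A)).
{ unfold Rpower. rewrite <- (exp_ln (B / (2 * A))) by assumption.
  assert (Hy : y * ln q <= ln (B / (2 * A))).
  { assert (Hy := Rmax_r y0 (ln (B / (2 * A)) / ln q)). fold y in Hy.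
    apply Rmult_le_compat_neg_l with (r := ln q) in Hy; [|lra].
    replace (ln q * (ln (B / (2 * A)) / ln q)) with (ln (B / (2 * A))) in Hy by (field; lra).
    lra. }
  destruct Hy as [Hy|Hy]; [left; now apply exp_increasing|right; now rewrite Hy]. }
apply Rmult_le_compat_l with (r := A) in Hle; [|lra].
replace (A * (B / (2 * A))) with (B / 2) in Hle by (field; lra). lra.
Qed.

(** Uniqueness of Dirichlet coefficients in quantitative form. Once the coefficients below [n] are
    known, [(c n - delta1 n) n^-x] is the difference between the partial sum and 1. Both the tail of
    the series and the hypothesis bound it by a multiple of [(n + 1)^-x], as [n <= P]. Multiplying
    by [n^x] leaves a multiple of [(n / (n + 1))^x], and [x] goes to infinity. *)
Lemma dirichlet_coefficients_delta1 (c : nat -> C) (K e K' E x0 : R) (P : nat) :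
  0 <= K -> 0 <= K' ->
  (forall n, (1 <= n)%nat -> Cmod (c n) <= K * npow n e) ->
  (forall x, x0 <= x -> exists v, clim (dpart c x) v /\ Cmod (v - 1) <= K' * npow (S P) (E - x)) ->
  forall n, (1 <= n <= P)%nat -> c n = delta1 n.
Proof.
intros HK HK' Hc Hv n. induction n as [n IHn] using (well_founded_induction lt_wf). intros Hn.
assert (IH : forall i, (1 <= i <= pred n)%nat -> c i = delta1 i) by (intros i Hi; apply IHn; lia).
apply Ceq_minus. apply Cmod_eq_0.
set (F := Rmax E (e + 2)).
assert (HF1 : E <= F) by apply Rmax_l. assert (HF2 : e + 2 <= F) by apply Rmax_r.
assert (Hnp : 1 <= INR n) by (apply one_le_INR; lia).
assert (Hq : 0 < INR n / INR (S n) < 1).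
{ rewrite S_INR. split; [apply Rdiv_lt_0_compat; lra|].
  apply Rmult_lt_reg_r with (INR n + 1); [lra|]. unfold Rdiv.
  rewrite Rmult_assoc, Rinv_l by lra. lra. }
apply (geometric_domination_zero _ ((K' + 2 * K) * npow (S n) F) (INR n / INR (S n)) (Rmax x0 F));
  [apply Cmod_ge_0|assumption|].
intros x Hx.
assert (Hx0 : x0 <= x) by (apply Rle_trans with (2 := Hx), Rmax_l).
assert (HxF : F <= x) by (apply Rle_trans with (2 := Hx), Rmax_r).
destruct (Hv x Hx0) as [v [Hv1 Hv2]].
assert (Hd : ((c n - delta1 n) * RtoC (npow n (- x)) = dpart c x n - 1)%C).
{ destruct n as [|n]; [lia|].
  assert (Hpart := dpart_delta1 c x n IH).
  unfold dpart in *. simpl csum. rewrite Hpart. unfold delta1.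
  destruct n as [|n]; simpl Nat.eqb; cbv iota; [rewrite npow_1|]; ring. }
assert (Ht : Cmod (v - dpart c x n) <= 2 * K * npow (S n) (e + 2 - x)).
{ apply (clim_Cmod_le (dpart c x)); [assumption|]. exists n. intros m Hm.
  replace m with (n + (m - n))%nat by lia. apply dpart_tail; [assumption|lra|assumption]. }
assert (H1 : npow (S P) (E - x) <= npow (S n) (F - x)).
{ apply Rle_trans with (npow (S n) (E - x)); [apply npow_antitone; [lia|lra]|].
  unfold npow. apply Rle_Rpower; [|lra]. rewrite S_INR; lra. }
assert (H2 : npow (S n) (e + 2 - x) <= npow (S n) (F - x)).
{ unfold npow. apply Rle_Rpower; [|lra]. rewrite S_INR; lra. }
assert (H3 : Cmod (c n - delta1 n) * npow n (- x) <= (K' + 2 * K) * npow (S n) (F - x)).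
{ rewrite <- (Rabs_pos_eq (npow n (- x))) by (left; apply npow_pos).
  rewrite <- Cmod_R, <- Cmod_mult, Hd.
  assert (T := Cmod_triangle (dpart c x n - v) (v - 1)).
  replace (dpart c x n - v + (v - 1))%C with (dpart c x n - 1)%C in T by ring.
  rewrite (Cmod_minus_sym (dpart c x n) v) in T.
  rewrite Rmult_plus_distr_r.
  apply Rle_trans with (1 := T). rewrite Rplus_comm. apply Rplus_le_compat.
  - apply Rle_trans with (1 := Hv2). apply Rmult_le_compat_l; lra.
  - apply Rle_trans with (1 := Ht). apply Rmult_le_compat_l; lra. }
assert (Hp := npow_pos n x).
apply Rmult_le_compat_r with (r := npow n x) in H3; [|lra].
rewrite npow_opp, Rmult_assoc, Rinv_l, Rmult_1_r in H3 by lra.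
apply Rle_trans with (1 := H3). right.
unfold Rminus. rewrite npow_plus, npow_opp.
unfold Rdiv. rewrite <- Rpower_mult_distr; [|lra|apply Rinv_0_lt_compat; rewrite S_INR; lra].
unfold npow at 3. replace (Rpower (/ INR (S n)) x) with (/ npow (S n) x).
- unfold npow. ring.
- unfold npow, Rpower. rewrite ln_Rinv by (rewrite S_INR; lra).
  rewrite <- exp_Ropp. f_equal. ring.
Qed.

(** * The Euler product far to the right *)

Lemma Cexp_surjective (w : C) : w <> 0%C -> exists z, Cexp z = w /\ Re z = ln (Cmod w).
Proof.
intros Hw. assert (Hp : 0 < Cmod w) by now apply Cmod_gt_0.
set (r := Cmod w) in *.
assert (Hr : r ^ 2 = Re w ^ 2 + Im w ^ 2) by apply Cmod2_alt.
assert (H1 : Rabs (Re w) <= r) by apply re_le_Cmod.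
assert (Hx : -1 <= Re w / r <= 1).
{ apply Rabs_le_between in H1. split; apply Rmult_le_reg_r with r; try assumption;
  unfold Rdiv; rewrite Rmult_assoc, Rinv_l by lra; lra. }
assert (Hs : sin (acos (Re w / r)) = Rabs (Im w) / r).
{ rewrite sin_acos by assumption. apply Rsqr_inj.
  - apply sqrt_pos.
  - apply Rdiv_le_0_compat; [apply Rabs_pos|assumption].
  - rewrite Rsqr_sqrt.
    + unfold Rsqr. replace (Rabs (Im w) / r * (Rabs (Im w) / r))
        with ((Rabs (Im w) * Rabs (Im w)) / r ^ 2) by (field; lra).
      rewrite <- Rabs_mult, Rabs_pos_eq by apply Rle_0_sqr.
      replace (Im w * Im w) with (r ^ 2 - Re w ^ 2) by (simpl in *; lra). field. lra.
    + unfold Rsqr. nra. }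
assert (Hc : cos (acos (Re w / r)) = Re w / r) by now apply cos_acos.
assert (Ht : exists theta, cos theta = Re w / r /\ sin theta = Im w / r).
{ destruct (Rle_dec 0 (Im w)) as [Hi|Hi].
  - exists (acos (Re w / r)). split; [assumption|]. now rewrite Hs, Rabs_pos_eq.
  - exists (- acos (Re w / r)). rewrite cos_neg, sin_neg, Hs, Rabs_left1 by lra.
    split; [assumption|]. field. lra. }
destruct Ht as [theta [T1 T2]].
exists (ln r, theta). split; [|reflexivity].
unfold Cexp. change (Re (ln r, theta)) with (ln r). change (Im (ln r, theta)) with theta.
rewrite exp_ln, T1, T2 by assumption.
apply Ceq_ext; [change (r * (Re w / r) = Re w)|change (r * (Im w / r) = Im w)]; field; lra.
Qed.

(** If [|beta| > p], then [s = log beta / log p] has real part greater than 1 and is a zero of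
    [1 - beta p^-s]. *)
Lemma euler_alpha_le_prime (beta : C) (p : nat) : (2 <= p)%nat ->
  (forall s, 1 < Re s -> (1 - beta / RCpow (INR p) s)%C <> RtoC 0) ->
  Cmod beta <= INR p.
Proof.
intros Hp H. apply Rnot_lt_le. intros Hlt.
assert (Hp2 : 2 <= INR p) by (change 2 with (INR 2); apply le_INR; lia).
assert (Hl : 0 < ln (INR p)) by (rewrite <- ln_1; apply ln_increasing; lra).
assert (Hb : beta <> 0%C) by (apply Cmod_gt_0; lra).
destruct (Cexp_surjective beta Hb) as [z [Hz1 Hz2]].
assert (HlC : RtoC (ln (INR p)) <> 0%C) by (intros E; apply RtoC_inj in E; lra).
apply (H (z / RtoC (ln (INR p)))%C).
- replace (z / RtoC (ln (INR p)))%C with (z * RtoC (/ ln (INR p)))%C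
    by (rewrite RtoC_inv by lra; reflexivity).
  rewrite re_scal_r, Hz2. apply Rmult_lt_reg_r with (1 := Hl).
  rewrite Rmult_assoc, Rinv_l, Rmult_1_r, Rmult_1_l by lra. apply ln_increasing; lra.
- unfold RCpow. replace (z / RtoC (ln (INR p)) * RtoC (ln (INR p)))%C with z by (field; assumption).
  rewrite Hz1. field. assumption.
Qed.

Fixpoint rsum (u : nat -> R) (n : nat) : R :=
  match n with
  | O => 0
  | S k => rsum u k + u n
  end.

Lemma rsum_const (c : R) (n : nat) : rsum (fun _ => c) n = INR n * c.
Proof. induction n as [|n IH]; [simpl; ring|]. rewrite S_INR. simpl rsum. rewrite IH. ring. Qed.

Lemma rsum_scal (c : R) (u : nat -> R) (n : nat) : rsum (fun k => c * u k) n = c * rsum u n.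
Proof. induction n as [|n IH]; simpl; [ring|]. rewrite IH. ring. Qed.

Lemma rsum_le (u v : nat -> R) (n : nat) :
  (forall k, (1 <= k <= n)%nat -> u k <= v k) -> rsum u n <= rsum v n.
Proof.
induction n as [|n IH]; intros H; simpl; [lra|].
apply Rplus_le_compat; [apply IH; intros; apply H; lia|apply H; lia].
Qed.

(** The bound [exp b - 1] is stable under products because [(1 + x)(1 + y) - 1 = xy + x + y], with
    equality of the bounds when [x] and [y] are of the form [exp b - 1]. *)
Lemma Cprod_near_one (u : nat -> C) (b : nat -> R) (n : nat) :
  (forall k, (1 <= k <= n)%nat -> Cmod (u k - 1) <= exp (b k) - 1) ->
  Cmod (Cprod u n - 1) <= exp (rsum b n) - 1.
Proof.
induction n as [|n IH]; intros H; simpl.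
- replace (1 - 1)%C with (RtoC 0) by ring. rewrite Cmod_0, exp_0. lra.
- specialize (IH ltac:(intros; apply H; lia)). specialize (H (S n) ltac:(lia)).
  replace (Cprod u n * u (S n) - 1)%C
    with ((Cprod u n - 1) * (u (S n) - 1) + (Cprod u n - 1) + (u (S n) - 1))%C by ring.
  rewrite exp_plus.
  eapply Rle_trans; [apply Cmod_triangle|].
  eapply Rle_trans; [apply Rplus_le_compat_r, Cmod_triangle|].
  rewrite Cmod_mult.
  assert (H1 := Cmod_ge_0 (Cprod u n - 1)). assert (H2 := Cmod_ge_0 (u (S n) - 1)).
  assert (H3 : Cmod (Cprod u n - 1) * Cmod (u (S n) - 1)
    <= (exp (rsum b n) - 1) * (exp (b (S n)) - 1)) by (apply Rmult_le_compat; lra).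
  lra.
Qed.

Lemma Cprod_split (u : nat -> C) (P k : nat) :
  Cprod u (P + k) = (Cprod u P * Cprod (fun i => u (P + i)%nat) k)%C.
Proof.
induction k as [|k IH]; simpl.
- rewrite Nat.add_0_r. ring.
- rewrite Nat.add_succ_r. simpl. rewrite IH. ring.
Qed.

Lemma rsum_npow_tail (P k : nat) (x : R) : 3 <= x ->
  rsum (fun i => npow (P + i) (1 - x)) k <= 2 * npow (S P) (3 - x).
Proof.
intros Hx.
assert (H := dpart_tail (fun n => RtoC (npow n 1)) 1 1 x P k ltac:(lra) ltac:(lra)).
replace (1 + 2 - x) with (3 - x) in H by ring.
rewrite Rmult_1_r in H.
assert (E : (dpart (fun n => RtoC (npow n 1)) x (P + k) - dpart (fun n => RtoC (npow n 1)) x P)%C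
  = RtoC (rsum (fun i => npow (P + i) (1 - x)) k)).
{ clear H. induction k as [|k IH].
  - rewrite Nat.add_0_r. simpl. ring.
  - rewrite Nat.add_succ_r. unfold dpart in *. simpl csum. simpl rsum.
    rewrite RtoC_plus, <- IH, Nat.add_succ_r.
    unfold Rminus. rewrite npow_plus, RtoC_mult. ring. }
rewrite E, Cmod_R in H.
eapply Rle_trans; [apply Rle_abs|]. apply H.
intros n Hn. rewrite Cmod_R, Rabs_pos_eq by (left; apply npow_pos). lra.
Qed.

Lemma inv_one_minus_near_one (w : C) (y : R) : Cmod w <= y -> y <= 1 / 2 ->
  Cmod (/ (1 - w) - 1) <= exp (2 * y) - 1.
Proof.
intros H1 H2.
assert (H0 := Cmod_ge_0 w).
assert (Hd : 1 / 2 <= Cmod (1 - w)).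
{ assert (T := Cmod_triangle_rev 1 w). rewrite Cmod_1 in T. lra. }
assert (Hne : (1 - w)%C <> 0%C) by (apply Cmod_gt_0; lra).
replace (/ (1 - w) - 1)%C with (w / (1 - w))%C by (field; assumption).
rewrite Cmod_div by assumption.
apply Rle_trans with (2 * y); [|assert (H := exp_ineq1_le (2 * y)); lra].
apply Rmult_le_reg_r with (Cmod (1 - w)); [lra|].
unfold Rdiv. rewrite Rmult_assoc, Rinv_l, Rmult_1_r by lra. nra.
Qed.

Lemma euler_factor_near_one (m p : nat) (alpha : nat -> nat -> C) (s : C) (y : R) :
  (forall j, (1 <= j <= m)%nat -> Cmod (alpha j p / RCpow (INR p) s) <= y) -> y <= 1 / 2 ->
  Cmod (euler_factor m alpha s p - 1) <= exp (2 * INR m * y) - 1.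
Proof.
intros H Hy. unfold euler_factor.
replace (2 * INR m * y) with (rsum (fun _ => 2 * y) m) by (rewrite rsum_const; ring).
apply Cprod_near_one. intros j Hj. apply inv_one_minus_near_one; auto.
Qed.

Lemma exp_minus_one_le (y : R) : 0 <= y <= 1 / 2 -> exp y - 1 <= 2 * y.
Proof.
intros Hy. assert (H2 := exp_ineq1_le (- y)).
rewrite exp_Ropp in H2. assert (Hp := exp_pos y).
apply Rmult_le_compat_r with (r := exp y) in H2; [|lra]. rewrite Rinv_l in H2 by lra. nra.
Qed.

Lemma npow_2_ge (x : R) : 0 <= x -> x / 2 <= npow 2 x.
Proof.
intros Hx. unfold npow, Rpower. assert (H := exp_ineq1_le (x * ln (INR 2))).
assert (H2 := ln_lt_2). replace (INR 2) with 2 in * by (simpl; ring). nra.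
Qed.

Lemma selberg_alpha_le_prime (L : selbergSP) (p j : nat) :
  is_prime p -> (1 <= j <= order L)%nat -> Cmod (alpha L j p) <= INR p.
Proof.
intros Hp Hj. apply euler_alpha_le_prime; [now apply is_prime_ge2|].
intros s Hs. now apply (lfun_euler L s Hs).
Qed.

(** Only the a priori bound [|alpha_j(p)| <= p] is available here, so the local parameters are at
    most [p^(1 - x)]. The threshold [3 + 16 m] ensures [2^(x - 3) >= 8 m], which keeps the exponent
    of the product below [1/2], where [exp y - 1 <= 2 y]. *)
Lemma euler_partial_tail (L : selbergSP) (P k : nat) (x : R) :
  (1 <= P)%nat -> 3 + 16 * INR (order L) <= x ->
  Cmod (euler_partial (order L) (alpha L) (RtoC x) (P + k)
        - euler_partial (order L) (alpha L) (RtoC x) P)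
  <= Cmod (euler_partial (order L) (alpha L) (RtoC x) P)
     * (8 * INR (order L) * npow (S P) (3 - x)).
Proof.
intros HP Hx. set (m := order L) in *.
assert (Hm : 1 <= INR m) by apply one_le_INR, (order_pos L).
unfold euler_partial.
set (E := fun p => if is_prime_dec p then euler_factor m (alpha L) (RtoC x) p else RtoC 1).
rewrite Cprod_split.
replace (Cprod E P * Cprod (fun i => E (P + i)%nat) k - Cprod E P)%C
  with (Cprod E P * (Cprod (fun i => E (P + i)%nat) k - 1))%C by ring.
rewrite Cmod_mult. apply Rmult_le_compat_l; [apply Cmod_ge_0|].
assert (Hnp : npow (S P) (3 - x) <= / (8 * INR m)).
{ apply Rle_trans with (npow 2 (3 - x)); [apply npow_antitone; [lia|lra]|].
  replace (3 - x) with (- (x - 3)) by ring. rewrite npow_opp.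
  apply Rinv_le_contravar; [lra|]. assert (H := npow_2_ge (x - 3) ltac:(lra)). lra. }
apply Rle_trans with (exp (rsum (fun i => 2 * INR m * npow (P + i) (1 - x)) k) - 1).
- apply Cprod_near_one. intros i Hi. unfold E.
  destruct (is_prime_dec (P + i)) as [Hpr|Hpr].
  + apply euler_factor_near_one.
    * intros j Hj. rewrite Cmod_div by apply RCpow_neq0. rewrite Cmod_RCpow, re_RtoC.
      assert (Ha := selberg_alpha_le_prime L (P + i) j Hpr Hj).
      unfold Rminus. rewrite npow_plus, npow_opp.
      apply Rmult_le_compat_r; [left; apply Rinv_0_lt_compat, npow_pos|].
      unfold npow. rewrite Rpower_1; [assumption|]. apply lt_0_INR. lia.
    * apply Rle_trans with (npow 2 (1 - x)); [apply npow_antitone; [lia|lra]|].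
      replace (1 - x) with (- (x - 1)) by ring. rewrite npow_opp.
      replace (1 / 2) with (/ 2) by field.
      apply Rinv_le_contravar; [lra|]. assert (H := npow_2_ge (x - 1) ltac:(lra)). lra.
  + replace (1 - 1)%C with (RtoC 0) by ring. rewrite Cmod_0.
    assert (H := exp_ineq1_le (2 * INR m * npow (P + i) (1 - x))).
    assert (H' := npow_pos (P + i) (1 - x)). nra.
- rewrite rsum_scal.
  assert (Hs := rsum_npow_tail P k x ltac:(lra)).
  assert (H0 : 0 <= rsum (fun i => npow (P + i) (1 - x)) k).
  { apply Rle_trans with (rsum (fun _ => 0) k); [rewrite rsum_const; lra|].
    apply rsum_le. intros; left; apply npow_pos. }
  set (T := rsum (fun i => npow (P + i) (1 - x)) k) in *.
  assert (HT : 2 * INR m * T <= 4 * INR m * npow (S P) (3 - x)) by nra.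
  assert (Hh : 4 * INR m * npow (S P) (3 - x) <= 1 / 2).
  { apply Rmult_le_compat_l with (r := 4 * INR m) in Hnp; [|lra].
    replace (4 * INR m * / (8 * INR m)) with (1 / 2) in Hnp by (field; lra). exact Hnp. }
  apply Rle_trans with (2 * (2 * INR m * T)); [apply exp_minus_one_le; split; nra|lra].
Qed.

Definition poly_bounded (e : R) (c : nat -> C) : Prop :=
  exists K, 0 <= K /\ forall n, (1 <= n)%nat -> Cmod (c n) <= K * npow n e.

Lemma sieve_poly_bounded (e : R) (q : nat) (beta : C) (c : nat -> C) : 0 <= e -> (2 <= q)%nat ->
  poly_bounded e c -> poly_bounded e (sieve q beta c).
Proof.
intros He Hq [K [HK H]]. exists (K * (1 + Cmod beta)).
assert (Hb := Cmod_ge_0 beta). split; [apply Rmult_le_pos; lra|].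
intros n Hn. unfold sieve.
assert (Hp := npow_pos n e).
assert (Hcn := H n Hn).
assert (HKp : 0 <= K * npow n e) by (apply Rmult_le_pos; lra).
destruct (Nat.eqb_spec (n mod q) 0) as [E|E]; [|nra].
assert (Hd : (1 <= n / q)%nat).
{ assert (H1 := Nat.div_mod_eq n q). nia. }
assert (Hle : (n / q <= n)%nat) by (apply Nat.Div0.div_le_upper_bound; nia).
assert (Hc2 := H (n / q)%nat Hd).
assert (Hp2 : npow (n / q) e <= npow n e).
{ unfold npow. apply Rle_Rpower_l; [assumption|]. split; [apply lt_0_INR; lia|apply le_INR; lia]. }
eapply Rle_trans; [apply Cmod_triangle_minus|]. rewrite Cmod_mult.
assert (K * npow (n / q) e <= K * npow n e) by (apply Rmult_le_compat_l; lra).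
assert (Cmod beta * Cmod (c (n / q)%nat) <= Cmod beta * (K * npow n e))
  by (apply Rmult_le_compat_l; lra).
lra.
Qed.

Lemma sieve_factor_poly_bounded (e : R) (alpha : nat -> nat -> C) (p m : nat) (c : nat -> C) :
  0 <= e -> (2 <= p)%nat -> poly_bounded e c -> poly_bounded e (sieve_factor alpha p m c).
Proof.
intros He Hp H. induction m as [|m IH]; simpl; [assumption|]. now apply sieve_poly_bounded.
Qed.

Lemma sieve_upto_poly_bounded (e : R) (alpha : nat -> nat -> C) (m P : nat) (c : nat -> C) :
  0 <= e -> poly_bounded e c -> poly_bounded e (sieve_upto alpha m P c).
Proof.
intros He H. induction P as [|P IH]; [assumption|]. simpl.
destruct (is_prime_dec (S P)) as [Hp|Hp]; [|assumption].
apply sieve_factor_poly_bounded; auto using is_prime_ge2.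
Qed.

(** Sieving by the primes up to [P] divides the sum of the series by the partial Euler product; the
    multiplicative form spares the division. *)
Lemma clim_sieve_upto (alpha : nat -> nat -> C) (m P : nat) (c : nat -> C) (x : R) (v : C) :
  (forall p j, is_prime p -> (1 <= j <= m)%nat ->
     (1 - alpha j p / RCpow (INR p) (RtoC x))%C <> RtoC 0) ->
  clim (dpart c x) v ->
  exists w, clim (dpart (sieve_upto alpha m P c) x) w /\
    (w * euler_partial m alpha (RtoC x) P)%C = v.
Proof.
intros Hne H. induction P as [|P [w [IH1 IH2]]].
- exists v. split; [assumption|]. unfold euler_partial; simpl. ring.
- unfold euler_partial in *. simpl sieve_upto. simpl Cprod.
  destruct (is_prime_dec (S P)) as [Hp|Hp].
  + exists (w * Cprod (fun j => 1 - alpha j (S P) * RtoC (npow (S P) (- x))) m)%C. split.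
    * apply clim_sieve_factor; [now apply is_prime_ge2|assumption].
    * rewrite <- IH2. assert (E := euler_factor_inv m (S P) alpha x (fun j Hj => Hne _ _ Hp Hj)).
      match goal with |- (_ * ?A * (?B * ?D))%C = _ => transitivity (w * B * (A * D))%C; [ring|] end.
      rewrite E. ring.
  + exists w. split; [assumption|]. rewrite <- IH2. ring.
Qed.

Lemma dpart_lfun (L : selbergSP) (x : R) : 1 < x -> clim (dpart (coef L) x) (L (RtoC x)).
Proof.
intros Hx. assert (H := lfun_series L (RtoC x) Hx). apply is_series_clim in H.
apply clim_ext with (2 := H). intros N. unfold dpart. f_equal.
apply FunctionalExtensionality.functional_extensionality. intros i.
unfold dirichlet_term. rewrite RCpow_npow, npow_opp, RtoC_inv; [reflexivity|].
apply Rgt_not_eq, npow_pos.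
Qed.

Lemma coef_poly_bounded (L : selbergSP) (e : R) : 0 < e -> poly_bounded e (coef L).
Proof.
intros He. destruct (coef_ramanujan L e He) as [K HK]. exists (Rmax K 0).
split; [apply Rmax_r|]. intros n Hn. apply Rle_trans with (1 := HK n Hn).
apply Rmult_le_compat_r; [left; apply npow_pos|apply Rmax_l].
Qed.

(* For large [x] the Euler product over the primes above [P] is [1 + O(P^(3-x))]. *)
Lemma sieved_coefficients (L : selbergSP) (P : nat) : (1 <= P)%nat ->
  forall n, (1 <= n <= P)%nat -> sieve_upto (alpha L) (order L) P (coef L) n = delta1 n.
Proof.
intros HP.
destruct (sieve_upto_poly_bounded 1 (alpha L) (order L) P (coef L)) as [K [HK0 HK]].
{ lra. } { apply coef_poly_bounded; lra. }
assert (Hm : 1 <= INR (order L)) by apply one_le_INR, (order_pos L).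
apply (dirichlet_coefficients_delta1 _ K 1 (8 * INR (order L)) 3 (3 + 16 * INR (order L)));
  try assumption; [lra|].
intros x Hx.
assert (Hx1 : 1 < Re (RtoC x)) by (rewrite re_RtoC; lra).
destruct (lfun_euler L (RtoC x) Hx1) as [Hne Hlim].
destruct (clim_sieve_upto (alpha L) (order L) P (coef L) x (L (RtoC x)) Hne) as [w [Hw1 Hw2]].
{ apply dpart_lfun. rewrite re_RtoC in Hx1. exact Hx1. }
exists w. split; [assumption|].
apply filterlim_clim in Hlim. fold (euler_partial (order L) (alpha L) (RtoC x)) in Hlim.
set (PP := euler_partial (order L) (alpha L) (RtoC x)) in *.
assert (HPP : PP P <> 0%C).
{ unfold PP, euler_partial. apply Cprod_neq0. intros k _.
  destruct (is_prime_dec k) as [Hk|Hk]; [|apply C1_nz].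
  unfold euler_factor. apply Cprod_neq0. intros j Hj.
  intros E. apply C1_nz. rewrite <- (Cinv_r _ (Hne k j Hk Hj)), E. ring. }
assert (Hp : 0 < Cmod (PP P)) by now apply Cmod_gt_0.
assert (Hd : Cmod (L (RtoC x) - PP P) <= Cmod (PP P) * (8 * INR (order L) * npow (S P) (3 - x))).
{ apply (clim_Cmod_le PP); [assumption|]. exists P. intros n Hn.
  replace n with (P + (n - P))%nat by lia. now apply euler_partial_tail. }
apply Rmult_le_reg_l with (1 := Hp).
apply Rle_trans with (2 := Hd). rewrite <- Cmod_mult, <- Hw2. right. f_equal. ring.
Qed.

(** * The local power series at a prime *)

Definition diff_op (beta : C) (a : nat -> C) (k : nat) : C :=
  match k with
  | O => a O
  | S k' => (a (S k') - beta * a k')%C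
  end.

(** The coefficients of the power series of [a] multiplied by the polynomial
    [(1 - beta_1 X) ... (1 - beta_m X)]: the trace of the sieve by [p] on the powers of [p]. *)
Fixpoint diff_ops (beta : nat -> C) (m : nat) (a : nat -> C) : nat -> C :=
  match m with
  | O => a
  | S k => diff_op (beta (S k)) (diff_ops beta k a)
  end.

Lemma diff_op_ext (beta : C) (a b : nat -> C) :
  (forall k, a k = b k) -> forall k, diff_op beta a k = diff_op beta b k.
Proof. intros H [|k]; simpl; rewrite ?H; reflexivity. Qed.

Lemma sieve_same_prime (p : nat) (beta : C) (c : nat -> C) (k : nat) : (2 <= p)%nat ->
  sieve p beta c (p ^ k) = diff_op beta (fun k => c (p ^ k)%nat) k.
Proof.
intros Hp. unfold sieve. destruct k as [|k]; simpl Nat.pow.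
- rewrite Nat.mod_1_l by lia. reflexivity.
- rewrite Nat.mul_comm, Nat.Div0.mod_mul, Nat.div_mul by lia.
  simpl. now rewrite Nat.mul_comm.
Qed.

Lemma prime_divides_pow (p q k : nat) :
  is_prime p -> is_prime q -> Nat.divide q (p ^ k) -> q = p.
Proof.
intros Hp Hq Hd.
assert (HZ : forall a, Nat.divide q a -> (Z.of_nat q | Z.of_nat a)%Z).
{ intros a [z ->]. exists (Z.of_nat z). apply Nat2Z.inj_mul. }
apply HZ in Hd. induction k as [|k IH]; simpl in Hd.
- exfalso. apply Z.divide_1_r_nonneg in Hd; [|lia]. apply is_prime_ge2 in Hq. lia.
- rewrite Nat2Z.inj_mul in Hd. apply prime_mult in Hd; [|assumption].
  destruct Hd as [Hd|Hd]; [|now apply IH].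
  apply prime_div_prime in Hd; [lia|assumption|assumption].
Qed.

Lemma sieve_other_prime (p q : nat) (beta : C) (c : nat -> C) (k : nat) :
  is_prime p -> is_prime q -> q <> p -> sieve q beta c (p ^ k) = c (p ^ k)%nat.
Proof.
intros Hp Hq Hne. unfold sieve.
destruct (Nat.eqb_spec ((p ^ k) mod q) 0) as [E|E]; [|reflexivity].
exfalso. apply Hne, (prime_divides_pow p q k); try assumption.
apply Nat.Lcm0.mod_divide. exact E.
Qed.

Lemma sieve_factor_same (alpha : nat -> nat -> C) (p m : nat) (c : nat -> C) : (2 <= p)%nat ->
  forall k, sieve_factor alpha p m c (p ^ k)%nat
    = diff_ops (fun j => alpha j p) m (fun k => c (p ^ k)%nat) k.
Proof.
intros Hp. induction m as [|m IH]; intros k; simpl; [reflexivity|].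
rewrite sieve_same_prime by assumption. now apply diff_op_ext.
Qed.

Lemma sieve_factor_other (alpha : nat -> nat -> C) (p q m : nat) (c : nat -> C) (k : nat) :
  is_prime p -> is_prime q -> q <> p -> sieve_factor alpha q m c (p ^ k)%nat = c (p ^ k)%nat.
Proof.
intros Hp Hq Hne. induction m as [|m IH]; simpl; [reflexivity|].
now rewrite sieve_other_prime.
Qed.

Lemma diff_ops_ext (beta : nat -> C) (m : nat) (a b : nat -> C) :
  (forall k, a k = b k) -> forall k, diff_ops beta m a k = diff_ops beta m b k.
Proof.
intros H. induction m as [|m IH]; simpl; [assumption|]. now apply diff_op_ext.
Qed.

(** A prime [q] other than [p] divides no power of [p], so on these indices all stages of the sieve
    act trivially except the one at [p]. *)
Lemma sieve_upto_prime_power (alpha : nat -> nat -> C) (m p P : nat) (c : nat -> C) :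
  is_prime p -> forall k, sieve_upto alpha m P c (p ^ k)%nat =
    if (p <=? P)%nat then diff_ops (fun j => alpha j p) m (fun k => c (p ^ k)%nat) k
    else c (p ^ k)%nat.
Proof.
intros Hp. assert (Hp2 := is_prime_ge2 p Hp).
induction P as [|P IH]; intros k.
- simpl. destruct (Nat.leb_spec p 0); [lia|reflexivity].
- simpl. destruct (is_prime_dec (S P)) as [HP|HP].
  + destruct (Nat.eq_dec (S P) p) as [E|E].
    * rewrite E, sieve_factor_same by assumption.
      destruct (Nat.leb_spec p p); [|lia]. apply diff_ops_ext. intros i. rewrite IH.
      destruct (Nat.leb_spec p P); [lia|reflexivity].
    * rewrite sieve_factor_other by assumption. rewrite IH.
      destruct (Nat.leb_spec p P); destruct (Nat.leb_spec p (S P)); try lia; reflexivity.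
  + rewrite IH.
    destruct (Nat.leb_spec p P); destruct (Nat.leb_spec p (S P)); try lia; try reflexivity.
    exfalso; apply HP. now replace (S P) with p by lia.
Qed.

Lemma local_coefficients (L : selbergSP) (p k : nat) : is_prime p ->
  diff_ops (fun j => alpha L j p) (order L) (fun k => coef L (p ^ k)%nat) k
    = if (k =? 0)%nat then RtoC 1 else RtoC 0.
Proof.
intros Hp. assert (Hp2 := is_prime_ge2 p Hp).
assert (Hk : (1 <= p ^ k)%nat) by (apply Nat.neq_0_lt_0, Nat.pow_nonzero; lia).
(* The bound [p + p ^ k] is large enough both for [p] to have been sieved and for the index [p ^ k]
   to lie in the range where the sieved coefficients are known. *)
assert (H := sieve_upto_prime_power (alpha L) (order L) p (p + p ^ k) (coef L) Hp k).
destruct (Nat.leb_spec p (p + p ^ k)); [|lia].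
rewrite <- H, sieved_coefficients by lia. unfold delta1.
destruct k as [|k]; simpl; [reflexivity|].
destruct (Nat.eqb_spec (p * p ^ k) 1) as [E|E]; [|reflexivity].
apply Nat.eq_mul_1 in E. lia.
Qed.

Lemma clim_diff_op (beta : C) (a : nat -> C) (z v : C) :
  clim (csum (fun k => a k * z ^ k)%C) v ->
  clim (csum (fun k => diff_op beta a k * z ^ k)%C) (v * (1 - beta * z))%C.
Proof.
intros H. apply clim_shift.
apply clim_ext with (fun n => csum (fun k => a k * z ^ k)%C (S n)
   + (- (beta * z)) * csum (fun k => a k * z ^ k)%C n)%C.
- intros n. induction n as [|n IH]; [simpl; ring|].
  change (csum (fun k => diff_op beta a k * z ^ k)%C (S (S n))) with
    (csum (fun k => diff_op beta a k * z ^ k)%C (S n) + diff_op beta a (S n) * z ^ (S n))%C.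
  rewrite <- IH. simpl. ring.
- replace (v * (1 - beta * z))%C with (v + (- (beta * z)) * v)%C by ring.
  apply clim_plus; [now apply clim_shift in H|now apply clim_scal].
Qed.

Lemma clim_diff_ops (beta : nat -> C) (m : nat) (a : nat -> C) (z v : C) :
  clim (csum (fun k => a k * z ^ k)%C) v ->
  clim (csum (fun k => diff_ops beta m a k * z ^ k)%C) (v * Cprod (fun j => 1 - beta j * z) m)%C.
Proof.
intros H. induction m as [|m IH]; simpl.
- now replace (v * 1)%C with v by ring.
- rewrite Cmult_assoc. now apply clim_diff_op.
Qed.

Lemma Cprod_eq0 (u : nat -> C) (n k : nat) : (1 <= k <= n)%nat -> u k = 0%C -> Cprod u n = 0%C.
Proof.
induction n as [|n IH]; intros Hk Hu; [lia|]. simpl.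
destruct (Nat.eq_dec k (S n)) as [->|E]; [rewrite Hu; ring|]. rewrite IH by (auto; lia). ring.
Qed.

(** If [|alpha_j(p)| > 1], the local power series converges at [z = / alpha_j(p)], where the
    polynomial vanishes; yet the product of the two is 1. *)
Theorem alpha_le_1 (L : selbergSP) (p j : nat) :
  is_prime p -> (1 <= j <= order L)%nat -> Cmod (alpha L j p) <= 1.
Proof.
intros Hp Hj. apply Rnot_lt_le. intros Hlt.
assert (Hp2 := is_prime_ge2 p Hp).
set (b := alpha L j p) in *.
assert (Hb : b <> 0%C) by (apply Cmod_gt_0; lra).
set (z := (/ b)%C).
set (r := Cmod b) in *.
assert (Hz : Cmod z = / r) by (unfold z; now rewrite Cmod_inv).
assert (Hpr : 2 <= INR p) by (change 2 with (INR 2); now apply le_INR).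
assert (Hlp : 0 < ln (INR p)) by (rewrite <- ln_1; apply ln_increasing; lra).
assert (Hlr : 0 < ln r) by (rewrite <- ln_1; apply ln_increasing; lra).
(* [p ^ eps = sqrt r] *)
set (eps := ln r / (2 * ln (INR p))).
assert (Heps : 0 < eps) by (apply Rdiv_lt_0_compat; lra).
destruct (coef_poly_bounded L eps Heps) as [K [HK0 HK]].
set (q := exp (- (ln r / 2))).
assert (Hq : 0 < q < 1).
{ split; [apply exp_pos|]. rewrite <- exp_0. apply exp_increasing. lra. }
assert (Hterm : forall k, Cmod (coef L (p ^ k)%nat * z ^ k) <= K * q ^ k).
{ intros k. assert (Hk : (1 <= p ^ k)%nat) by (apply Nat.neq_0_lt_0, Nat.pow_nonzero; lia).
  rewrite Cmod_mult, Cmod_pow, Hz.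
  apply Rle_trans with (K * npow (p ^ k) eps * (/ r) ^ k).
  - apply Rmult_le_compat_r; [apply pow_le; left; apply Rinv_0_lt_compat; lra|now apply HK].
  - right. rewrite Rmult_assoc. f_equal.
    assert (E1 : npow (p ^ k) eps = (exp (ln r / 2)) ^ k).
    { unfold npow, Rpower. rewrite pow_INR, ln_pow by lra.
      rewrite <- Rpower_pow by apply exp_pos. unfold Rpower. rewrite ln_exp.
      f_equal. unfold eps. field. lra. }
    rewrite E1, <- Rpow_mult_distr. f_equal. unfold q.
    replace (/ r) with (exp (- ln r)) by (rewrite exp_Ropp, exp_ln by lra; reflexivity).
    rewrite <- exp_plus. f_equal. field. }
assert (Hconv : exists v, clim (csum (fun k => coef L (p ^ k)%nat * z ^ k)%C) v).
{ destruct (ex_series_le (K := C_AbsRing) (V := C_CompleteNormedModule)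
    (fun k => coef L (p ^ k)%nat * z ^ k)%C (fun k => K * q ^ k)) as [v Hv].
  - intros k. apply Hterm.
  - apply (ex_series_scal (K := R_AbsRing) (V := R_NormedModule) K).
    apply ex_series_geom. rewrite Rabs_pos_eq; lra.
  - exists v. now apply is_series_clim. }
destruct Hconv as [v Hv].
assert (H := clim_diff_ops (fun j => alpha L j p) (order L) _ z v Hv).
rewrite (Cprod_eq0 _ (order L) j Hj) in H.
2:{ cbv beta. fold b. unfold z. rewrite Cinv_r by assumption. ring. }
assert (H1 : clim (csum (fun k => diff_ops (fun j => alpha L j p) (order L)
   (fun k => coef L (p ^ k)%nat) k * z ^ k)%C) 1%C).
{ apply clim_shift. apply clim_ext with (fun _ => RtoC 1); [|apply clim_const].
  induction n as [|n IH]; cbn [csum].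
  - rewrite local_coefficients by assumption. simpl. ring.
  - cbn [csum] in IH. rewrite <- IH, local_coefficients by assumption. simpl. ring. }
apply C1_nz. rewrite <- (clim_unique _ _ _ H H1). ring.
Qed.

(** * A majorant from the zeta function *)

Lemma ln_ratio_ge (y : R) : 1 < y -> / y <= ln (y / (y - 1)).
Proof.
intros Hy. assert (0 < / y < 1).
{ split; [apply Rinv_0_lt_compat; lra|]. rewrite <- Rinv_1. apply Rinv_lt_contravar; lra. }
replace (y / (y - 1)) with (/ (1 - / y)) by (field; lra).
rewrite ln_Rinv by lra.
assert (H1 := exp_ineq1_le (ln (1 - / y))). rewrite exp_ln in H1 by lra. lra.
Qed.

(** Comparison of [(n + 1)^-x] with the integral of [u^-x] over [[n, n + 1]], obtained without
    integration from [log ((n + 1) / n) >= 1 / (n + 1)] and [exp u >= 1 + u]. *)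
Lemma npow_le_telescope (n : nat) (x : R) : (1 <= n)%nat -> 1 < x ->
  npow (S n) (- x) * (x - 1) <= npow n (1 - x) - npow (S n) (1 - x).
Proof.
intros Hn Hx.
assert (H1 : 1 <= INR n) by now apply one_le_INR.
assert (E1 : npow (S n) (- x) = npow (S n) (1 - x) * / INR (S n)).
{ replace (- x) with ((1 - x) + - (1)) by ring. rewrite npow_plus, npow_opp. f_equal.
  unfold npow. rewrite Rpower_1; [reflexivity|]. rewrite S_INR; lra. }
assert (E2 : npow n (1 - x) = npow (S n) (1 - x) * exp ((x - 1) * ln (INR (S n) / INR n))).
{ unfold npow, Rpower. rewrite <- exp_plus. f_equal.
  rewrite ln_div by (rewrite ?S_INR; lra). ring. }
rewrite E1, E2.
assert (Hp := npow_pos (S n) (1 - x)).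
assert (H2 := exp_ineq1_le ((x - 1) * ln (INR (S n) / INR n))).
assert (H3 := ln_ratio_ge (INR (S n)) ltac:(rewrite S_INR; lra)).
replace (INR (S n) - 1) with (INR n) in H3 by (rewrite S_INR; ring).
assert (H4 : (x - 1) * / INR (S n) <= (x - 1) * ln (INR (S n) / INR n))
  by (apply Rmult_le_compat_l; lra).
apply Rle_trans with (npow (S n) (1 - x) * ((x - 1) * / INR (S n))); [right; ring|].
replace (npow (S n) (1 - x) * exp ((x - 1) * ln (INR (S n) / INR n)) - npow (S n) (1 - x))
  with (npow (S n) (1 - x) * (exp ((x - 1) * ln (INR (S n) / INR n)) - 1)) by ring.
apply Rmult_le_compat_l; lra.
Qed.

Lemma zeta_partial_le (x : R) (N : nat) : 1 < x ->
  rsum (fun n => npow n (- x)) (S N) <= 1 + (1 - npow (S N) (1 - x)) / (x - 1).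
Proof.
intros Hx. induction N as [|N IH].
- simpl. rewrite !npow_1. right. field. lra.
- assert (H := npow_le_telescope (S N) x ltac:(lia) Hx).
  change (rsum (fun n => npow n (- x)) (S N) + npow (S (S N)) (- x)
    <= 1 + (1 - npow (S (S N)) (1 - x)) / (x - 1)).
  assert (npow (S (S N)) (- x) <= (npow (S N) (1 - x) - npow (S (S N)) (1 - x)) / (x - 1)).
  { apply Rmult_le_reg_r with (x - 1); [lra|]. unfold Rdiv.
    rewrite Rmult_assoc, Rinv_l, Rmult_1_r by lra. exact H. }
  unfold Rdiv in *. lra.
Qed.

Lemma zeta_partial_tail_le (x : R) (N : nat) : 1 < x ->
  rsum (fun n => npow (S n) (- x)) N <= / (x - 1).
Proof.
intros Hx.
assert (E : forall N, rsum (fun n => npow n (- x)) (S N) = 1 + rsum (fun n => npow (S n) (- x)) N).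
{ clear N. induction N as [|N IH]; [simpl; rewrite npow_1; ring|].
  change (rsum (fun n => npow n (- x)) (S N) + npow (S (S N)) (- x)
    = 1 + (rsum (fun n => npow (S n) (- x)) N + npow (S (S N)) (- x))).
  rewrite IH. ring. }
assert (H := zeta_partial_le x N Hx). rewrite E in H.
assert (Hp := npow_pos (S N) (1 - x)).
assert (0 < / (x - 1)) by (apply Rinv_0_lt_compat; lra).
unfold Rdiv in H. nra.
Qed.

Definition coprime_upto (P n : nat) : Prop :=
  forall p, is_prime p -> (p <= P)%nat -> (n mod p)%nat <> 0%nat.

(** The same sieve applied to zeta, with constant coefficients 1 and one local parameter 1: it
    leaves the indicator of the integers free of primes up to [P]. What matters later is that these
    coefficients are nonnegative and that the first is 1. *)
Lemma sieve_upto_one (P n : nat) : (1 <= n)%nat ->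
  (coprime_upto P n /\ sieve_upto (fun _ _ => RtoC 1) 1 P (fun _ => RtoC 1) n = RtoC 1) \/
  (~ coprime_upto P n /\ sieve_upto (fun _ _ => RtoC 1) 1 P (fun _ => RtoC 1) n = RtoC 0).
Proof.
revert n. induction P as [|P IH]; intros n Hn.
- left. split; [|reflexivity]. intros p Hp Hle. apply is_prime_ge2 in Hp. lia.
- simpl. destruct (is_prime_dec (S P)) as [Hp|Hp].
  + set (c := sieve_upto (fun _ _ => RtoC 1) 1 P (fun _ => RtoC 1)) in *.
    assert (Hmono : forall k, coprime_upto (S P) k -> coprime_upto P k)
      by (intros k Hk p Hpp Hle; apply Hk; [assumption|lia]).
    unfold sieve_factor, sieve.
    destruct (Nat.eqb_spec (n mod S P) 0) as [E|E].
    * right. split; [intros H; now apply (H (S P) Hp (le_n _))|].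
      assert (Hd : n = (S P * (n / S P))%nat).
      { assert (H := Nat.div_mod_eq n (S P)). lia. }
      assert (Hq : (1 <= n / S P)%nat) by (destruct (n / S P)%nat; lia).
      assert (Hiff : coprime_upto P n <-> coprime_upto P (n / S P)).
      { split; intros H p Hpp Hle Hmod.
        - apply (H p Hpp Hle). apply Nat.Lcm0.mod_divide in Hmod. apply Nat.Lcm0.mod_divide.
          rewrite Hd. now apply Nat.divide_mul_r.
        - apply (H p Hpp Hle). apply Nat.Lcm0.mod_divide in Hmod. apply Nat.Lcm0.mod_divide.
          rewrite Hd in Hmod.
          destruct Hmod as [z Hz].
          assert (HZ : (Z.of_nat p | Z.of_nat (S P) * Z.of_nat (n / S P))%Z).
          { exists (Z.of_nat z). rewrite <- Nat2Z.inj_mul, Hz. apply Nat2Z.inj_mul. }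
          apply prime_mult in HZ; [|assumption]. destruct HZ as [HZ|[y Hy]].
          + apply prime_div_prime in HZ; try assumption. lia.
          + exists (Z.to_nat y). apply Nat2Z.inj. rewrite Hy, Nat2Z.inj_mul.
            assert (0 < Z.of_nat p)%Z by (apply is_prime_ge2 in Hpp; lia).
            rewrite Z2Nat.id; [reflexivity|]. nia. }
      destruct (IH n Hn) as [[H1 H2]|[H1 H2]]; destruct (IH _ Hq) as [[H3 H4]|[H3 H4]];
        try tauto; rewrite H2, H4; ring.
    * destruct (IH n Hn) as [[H1 H2]|[H1 H2]]; [left|right]; (split; [|assumption]).
      -- intros p Hpp Hle. destruct (Nat.eq_dec p (S P)) as [->|Hne]; [assumption|].
         apply H1; [assumption|lia].
      -- auto.
  + destruct (IH n Hn) as [[H1 H2]|[H1 H2]]; [left|right]; (split; [|assumption]).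
    * intros p Hpp Hle. destruct (Nat.eq_dec p (S P)) as [->|Hne]; [tauto|].
      apply H1; [assumption|lia].
    * intros H. apply H1. intros p Hpp Hle. apply H; [assumption|lia].
Qed.

Lemma dpart_real (a : nat -> R) (x : R) (N : nat) :
  dpart (fun n => RtoC (a n)) x N = RtoC (rsum (fun n => a n * npow n (- x)) N).
Proof.
unfold dpart. induction N as [|N IH]; simpl; [reflexivity|].
rewrite IH, RtoC_plus, RtoC_mult. reflexivity.
Qed.

Lemma clim_real (u : nat -> R) (l : R) :
  is_lim_seq u l -> clim (fun n => RtoC (u n)) (RtoC l).
Proof.
intros H eps He. apply is_lim_seq_spec in H.
destruct (H (mkposreal eps He)) as [N HN]. exists N. intros n Hn.
rewrite <- RtoC_minus, Cmod_R. now apply HN.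
Qed.

Lemma npow_gt_1 (p : nat) (x : R) : (2 <= p)%nat -> 0 < x -> 1 < npow p x.
Proof.
intros Hp Hx. unfold npow. rewrite <- (Rpower_O (INR p)) by (apply lt_0_INR; lia).
apply Rpower_lt; [|lra]. change 1 with (INR 1). apply lt_INR. lia.
Qed.

(** The partial product times the sieved sum [w] is the value of zeta at [x], which is at most
    [x / (x - 1)]; and [|w| >= 1], because [w] is a sum of nonnegative terms beginning with 1. *)
Lemma euler_one_partial_le (x : R) (P : nat) : 1 < x ->
  Cmod (euler_partial 1 (fun _ _ => RtoC 1) (RtoC x) P) <= x / (x - 1).
Proof.
intros Hx.
assert (Hz : exists z : R, is_lim_seq (rsum (fun n => 1 * npow n (- x))) z /\ Rabs z <= x / (x - 1)).
{ assert (Hi : forall N, rsum (fun n => 1 * npow n (- x)) N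
      <= rsum (fun n => 1 * npow n (- x)) (S N)).
  { intros N. simpl. assert (H := npow_pos (S N) (- x)). lra. }
  assert (Hb : forall N, rsum (fun n => 1 * npow n (- x)) N <= x / (x - 1)).
  { intros [|N].
    - simpl. apply Rdiv_le_0_compat; lra.
    - rewrite rsum_scal, Rmult_1_l. apply Rle_trans with (1 := zeta_partial_le x N Hx).
      assert (Hp := npow_pos (S N) (1 - x)).
      assert (Hi' : 0 < / (x - 1)) by (apply Rinv_0_lt_compat; lra).
      replace (x / (x - 1)) with (1 + 1 / (x - 1)) by (field; lra).
      unfold Rdiv. nra. }
  destruct (ex_finite_lim_seq_incr _ (x / (x - 1)) Hi Hb) as [z Hz].
  exists z. split; [assumption|].
  assert (H1 : z <= x / (x - 1)).
  { apply (is_lim_seq_le _ _ (Finite z) (Finite (x / (x - 1))) Hb Hz).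
    apply is_lim_seq_const. }
  assert (H2 : 0 <= z).
  { apply (is_lim_seq_le (fun _ => 0) _ (Finite 0) (Finite z)) with (3 := Hz).
    - intros n. apply Rle_trans with (rsum (fun _ => 0) n); [rewrite rsum_const; lra|].
      apply rsum_le. intros k _. assert (H := npow_pos k (- x)). lra.
    - apply is_lim_seq_const. }
  rewrite Rabs_pos_eq; lra. }
destruct Hz as [z [Hz1 Hz2]].
assert (Hc : clim (dpart (fun _ => RtoC 1) x) (RtoC z)).
{ apply clim_ext with (2 := clim_real _ _ Hz1). intros n.
  symmetry. apply (dpart_real (fun _ => 1)). }
destruct (clim_sieve_upto (fun _ _ => RtoC 1) 1 P (fun _ => RtoC 1) x (RtoC z)) with (2 := Hc)
  as [w [Hw1 Hw2]].
{ intros p j Hp _ E. apply is_prime_ge2 in Hp.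
  assert (Hpn := npow_gt_1 p x ltac:(lia) ltac:(lra)).
  assert (Hne : RtoC (npow p x) <> 0%C) by (intros HE; apply RtoC_inj in HE; lra).
  rewrite RCpow_npow in E.
  assert (E2 : RtoC (npow p x) = RtoC 1).
  { transitivity (RtoC (npow p x) - RtoC (npow p x) * (1 - 1 / RtoC (npow p x)))%C.
    - rewrite E. ring.
    - field. assumption. }
  apply RtoC_inj in E2. lra. }
assert (Hw : 1 <= Cmod w).
{ assert (HRe : forall N, 1 <= Re (dpart (sieve_upto (fun _ _ => RtoC 1) 1 P (fun _ => RtoC 1)) x (S N))).
  { induction N as [|N IH]; unfold dpart in *.
    - cbn [csum]. destruct (sieve_upto_one P 1 (le_n _)) as [[_ ->]|[H _]].
      + rewrite npow_1. unfold Re; simpl. lra.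
      + exfalso. apply H. intros p Hp _. apply is_prime_ge2 in Hp.
        rewrite Nat.mod_1_l; lia.
    - set (N' := S N) in *. cbn [csum]. rewrite re_plus, re_scal_r.
      assert (Hp := npow_pos (S N') (- x)).
      destruct (sieve_upto_one P (S N') ltac:(lia)) as [[_ ->]|[_ ->]]; rewrite re_RtoC; lra. }
  apply Rnot_lt_le. intros Hlt.
  destruct (Hw1 (1 - Cmod w) ltac:(lra)) as [N HN]. specialize (HN (S N) ltac:(lia)).
  specialize (HRe N).
  set (D := dpart (sieve_upto (fun _ _ => RtoC 1) 1 P (fun _ => RtoC 1)) x (S N)) in *.
  assert (H1 := re_le_Cmod D). assert (H2 := Cmod_triangle_rev D w).
  assert (H3 := Rle_abs (Re D)). lra. }
apply Rle_trans with (2 := Hz2). rewrite <- Cmod_R, <- Hw2, Cmod_mult.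
assert (H := Cmod_ge_0 (euler_partial 1 (fun _ _ => RtoC 1) (RtoC x) P)). nra.
Qed.

(** Factor by factor: [|1 - alpha_j(p) p^-s| >= 1 - p^-sigma] once [|alpha_j(p)| <= 1], so each of
    the [m] factors is dominated by that of zeta. *)
Lemma euler_partial_le (L : selbergSP) (s : C) (P : nat) : 1 < Re s ->
  Cmod (euler_partial (order L) (alpha L) s P)
  <= Cmod (euler_partial 1 (fun _ _ => RtoC 1) (RtoC (Re s)) P) ^ order L.
Proof.
intros Hs. unfold euler_partial. induction P as [|P IH]; simpl.
- rewrite Cmod_1, pow1. lra.
- rewrite !Cmod_mult, Rpow_mult_distr.
  apply Rmult_le_compat; try apply Cmod_ge_0; [assumption|].
  destruct (is_prime_dec (S P)) as [Hp|Hp]; [|rewrite Cmod_1, pow1; lra].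
  assert (Hp2 := is_prime_ge2 _ Hp).
  set (p := S P) in *. set (x := Re s) in *.
  assert (Hpn := npow_gt_1 p x ltac:(lia) ltac:(lra)).
  assert (Hy : 0 < / npow p x < 1).
  { split; [apply Rinv_0_lt_compat; lra|]. rewrite <- Rinv_1. apply Rinv_lt_contravar; lra. }
  assert (Hone : euler_factor 1 (fun _ _ => RtoC 1) (RtoC x) p = RtoC (/ (1 - / npow p x))).
  { unfold euler_factor; cbn [Cprod]. rewrite RCpow_npow.
    rewrite RtoC_inv by lra. rewrite RtoC_minus, RtoC_inv by lra.
    rewrite Cmult_1_l. f_equal. f_equal. f_equal. unfold Cdiv. apply Cmult_1_l. }
  rewrite Hone, Cmod_R, Rabs_pos_eq by (left; apply Rinv_0_lt_compat; lra).
  unfold euler_factor.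
  assert (Hj : forall k, (k <= order L)%nat ->
    Cmod (Cprod (fun j => / (1 - alpha L j p / RCpow (INR p) s))%C k) <= (/ (1 - / npow p x)) ^ k).
  { induction k as [|k IHk]; intros Hk; cbn [Cprod pow].
    - rewrite Cmod_1. lra.
    - rewrite Cmod_mult, Rmult_comm.
      apply Rmult_le_compat; try apply Cmod_ge_0; [|apply IHk; lia].
      assert (Ha : Cmod (alpha L (S k) p / RCpow (INR p) s) <= / npow p x).
      { rewrite Cmod_div by apply RCpow_neq0. rewrite Cmod_RCpow.
        assert (Ha := alpha_le_1 L p (S k) Hp ltac:(lia)). fold x.
        unfold Rdiv. nra. }
      assert (T := Cmod_triangle_rev 1 (alpha L (S k) p / RCpow (INR p) s)).
      rewrite Cmod_1 in T.
      rewrite Cmod_inv by (apply Cmod_gt_0; lra).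
      apply Rinv_le_contravar; lra. }
  now apply Hj.
Qed.

Lemma lfun_right_bound (L : selbergSP) (s : C) : 1 < Re s ->
  Cmod (L s) <= (Re s / (Re s - 1)) ^ order L.
Proof.
intros Hs. destruct (lfun_euler L s Hs) as [_ Hlim]. apply filterlim_clim in Hlim.
replace (L s) with (L s - 0)%C by ring.
apply (clim_Cmod_le (euler_partial (order L) (alpha L) s)); [exact Hlim|]. exists O. intros n _.
replace (euler_partial (order L) (alpha L) s n - 0)%C
  with (euler_partial (order L) (alpha L) s n) by ring.
eapply Rle_trans; [apply (euler_partial_le L s n Hs)|].
apply pow_incr. split; [apply Cmod_ge_0|]. now apply euler_one_partial_le.
Qed.

(** * The logarithm to the right of 1 *)

Lemma RCpow_mult_INR (p k : nat) (s : C) :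
  RCpow (INR p) (RtoC (INR k) * s) = (RCpow (INR p) s ^ k)%C.
Proof.
unfold RCpow. induction k as [|k IH].
- simpl INR. simpl Cpow. replace (RtoC 0 * s * RtoC (ln (INR p)))%C with (RtoC 0) by ring.
  apply Cexp_0.
- rewrite S_INR, RtoC_plus. cbn [Cpow]. rewrite <- IH, <- Cexp_plus. f_equal. ring.
Qed.

(* The derivative of [(1 - w) * Cexp (w + ... + w^n / n)] is [- w^n * Cexp (...)], which tends to 0. *)
Definition log_partial (n : nat) (w : C) : C :=
  csum (fun i => w ^ S i / RtoC (INR (S i)))%C n.

Lemma cderiv_pow_S (w : C) (n : nat) :
  cderiv (fun w => w ^ S n)%C w (RtoC (INR (S n)) * w ^ n)%C.
Proof.
induction n as [|n IH].
- apply cderiv_local with (f := fun w => w) (delta := 1); [lra|intros; simpl; ring|].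
  eapply cderiv_eq; [apply cderiv_id|]. simpl. ring.
- eapply cderiv_eq; [apply (cderiv_mult (fun w => w) (fun w => w ^ S n)%C); [apply cderiv_id|exact IH]|].
  rewrite (S_INR (S n)), RtoC_plus. simpl Cpow. ring.
Qed.

Lemma cderiv_log_partial (n : nat) (w : C) :
  cderiv (log_partial n) w (csum (fun i => w ^ i)%C n).
Proof.
unfold log_partial. induction n as [|n IH]; simpl csum; [apply cderiv_const|].
apply cderiv_plus; [exact IH|].
eapply cderiv_eq.
- apply (cderiv_mult (fun w => w ^ S n)%C (fun _ => / RtoC (INR (S n)))%C);
    [apply cderiv_pow_S|apply cderiv_const].
- field. intros E. apply RtoC_inj in E. rewrite S_INR in E. assert (H := pos_INR n). lra.
Qed.

Lemma csum_geometric (w : C) (n : nat) : ((1 - w) * csum (fun i => w ^ i) n = 1 - w ^ n)%C.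
Proof.
induction n as [|n IH]; simpl; [ring|]. rewrite Cmult_plus_distr_l, IH. ring.
Qed.

Lemma real_derivative_on_ray (F : C -> C) (z l : C) (x : R) :
  cderiv F (RtoC x * z) l ->
  derivable_pt_lim (fun x => Re (F (RtoC x * z)%C)) x (Re (l * z)) /\
  derivable_pt_lim (fun x => Im (F (RtoC x * z)%C)) x (Im (l * z)).
Proof.
intros HF.
assert (HG : cderiv (fun w => F (w * z)%C) (RtoC x) (l * z)%C).
{ eapply cderiv_eq; [apply (cderiv_comp F (fun w => w * z)%C); [|exact HF]|].
  - apply (cderiv_mult (fun w => w) (fun _ => z)); [apply cderiv_id|apply cderiv_const].
  - ring. }
destruct HG as (phi & H1 & H2 & H3).
assert (Key : forall eps, 0 < eps -> exists delta : posreal, forall h, h <> 0 -> Rabs h < delta ->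
  Cmod ((F (RtoC (x + h) * z)%C - F (RtoC x * z)%C) * RtoC (/ h) - l * z) < eps).
{ intros eps He. destruct (H1 eps He) as [d [Hd Hdel]]. exists (mkposreal d Hd).
  intros h Hh Hhd. specialize (Hdel (RtoC (x + h))).
  replace (RtoC (x + h) - RtoC x)%C with (RtoC h) in Hdel by (rewrite RtoC_plus; ring).
  rewrite Cmod_R in Hdel. specialize (Hdel Hhd). rewrite H2 in Hdel.
  rewrite (H3 (RtoC (x + h))).
  replace (RtoC (x + h) - RtoC x)%C with (RtoC h) by (rewrite RtoC_plus; ring).
  replace ((F (RtoC x * z) + phi (RtoC (x + h)) * RtoC h - F (RtoC x * z)) * RtoC (/ h) - l * z)%C
    with (phi (RtoC (x + h)) - l * z)%C; [assumption|].
  rewrite RtoC_inv by assumption. field. intros E. apply RtoC_inj in E. tauto. }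
split; intros eps He; destruct (Key eps He) as [d Hd]; exists d; intros h Hh Hhd;
  specialize (Hd h Hh Hhd).
- eapply Rle_lt_trans; [|exact Hd]. eapply Rle_trans; [right|apply re_le_Cmod].
  f_equal. unfold Cminus at 1. rewrite re_plus, re_opp, re_scal_r.
  unfold Cminus. rewrite re_plus, re_opp. unfold Rdiv, Rminus. ring.
- eapply Rle_lt_trans; [|exact Hd]. eapply Rle_trans; [right|apply im_le_Cmod].
  f_equal. unfold Cminus at 1. rewrite im_plus, im_opp, im_scal_r.
  unfold Cminus. rewrite im_plus, im_opp. unfold Rdiv, Rminus. ring.
Qed.

(** The real mean value theorem is applied to the real and imaginary parts along the segment from 0
    to [z] separately, which costs the factor 2. *)
Lemma mean_value_inequality (F F' : C -> C) (z : C) (B : R) :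
  (forall x, 0 <= x <= 1 -> cderiv F (RtoC x * z) (F' (RtoC x * z)%C) /\
     Cmod (F' (RtoC x * z)%C) <= B) ->
  Cmod (F z - F 0) <= 2 * B * Cmod z.
Proof.
intros H.
assert (Hb : forall x, 0 <= x <= 1 -> Cmod (F' (RtoC x * z)%C * z) <= B * Cmod z).
{ intros x Hx. rewrite Cmod_mult. apply Rmult_le_compat_r; [apply Cmod_ge_0|now apply H]. }
assert (E1 : F z = F (RtoC 1 * z)%C) by (f_equal; ring).
assert (E0 : F 0 = F (RtoC 0 * z)%C) by (f_equal; ring).
assert (HRe : Rabs (Re (F z) - Re (F 0)) <= B * Cmod z).
{ rewrite E1, E0.
  destruct (MVT_cor2 (fun x => Re (F (RtoC x * z)%C)) (fun x => Re (F' (RtoC x * z)%C * z)) 0 1)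
    as [x [Hx1 Hx2]]; [lra| |].
  - intros x Hx. apply (real_derivative_on_ray F z _ x). now apply H.
  - rewrite Hx1, Rminus_0_r, Rmult_1_r.
    eapply Rle_trans; [apply re_le_Cmod|]. apply Hb. lra. }
assert (HIm : Rabs (Im (F z) - Im (F 0)) <= B * Cmod z).
{ rewrite E1, E0.
  destruct (MVT_cor2 (fun x => Im (F (RtoC x * z)%C)) (fun x => Im (F' (RtoC x * z)%C * z)) 0 1)
    as [x [Hx1 Hx2]]; [lra| |].
  - intros x Hx. apply (real_derivative_on_ray F z _ x). now apply H.
  - rewrite Hx1, Rminus_0_r, Rmult_1_r.
    eapply Rle_trans; [apply im_le_Cmod|]. apply Hb. lra. }
eapply Rle_trans; [apply Cmod_le_re_im|].
unfold Cminus. rewrite re_plus, re_opp, im_plus, im_opp. unfold Rminus in *. lra.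
Qed.

Lemma geometric_rsum_le (q : R) (n : nat) : 0 <= q < 1 -> rsum (fun k => q ^ k) n <= q / (1 - q).
Proof.
intros Hq.
assert (E : rsum (fun k => q ^ k) n = (q - q ^ S n) / (1 - q)).
{ induction n as [|n IH]; simpl; [field; lra|]. simpl in IH. rewrite IH. field. lra. }
rewrite E. unfold Rdiv. apply Rmult_le_compat_r; [left; apply Rinv_0_lt_compat; lra|].
assert (0 <= q ^ S n) by (apply pow_le; lra). lra.
Qed.

Lemma Cmod_csum_le (u : nat -> C) (b : nat -> R) (n : nat) :
  (forall i, (i < n)%nat -> Cmod (u i) <= b (S i)) -> Cmod (csum u n) <= rsum b n.
Proof.
induction n as [|n IH]; intros H; simpl; [rewrite Cmod_0; lra|].
eapply Rle_trans; [apply Cmod_triangle|].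
apply Rplus_le_compat; [apply IH; intros; apply H; lia|apply H; lia].
Qed.

Lemma Cmod_log_partial_le (n : nat) (w : C) (q : R) : Cmod w <= q -> q < 1 ->
  Cmod (log_partial n w) <= q / (1 - q).
Proof.
intros Hw Hq. assert (H0 := Cmod_ge_0 w).
apply Rle_trans with (rsum (fun k => q ^ k) n); [|apply geometric_rsum_le; lra].
apply Cmod_csum_le. intros i _.
assert (H1 : 1 <= INR (S i)) by (apply one_le_INR; lia).
rewrite Cmod_div by (intros E; apply RtoC_inj in E; lra).
rewrite Cmod_pow, Cmod_R, Rabs_pos_eq by lra.
apply Rle_trans with (Cmod w ^ S i); [|apply pow_incr; lra].
assert (H2 : 0 <= Cmod w ^ S i) by (apply pow_le; lra).
apply Rmult_le_reg_r with (INR (S i)); [lra|].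
unfold Rdiv. rewrite Rmult_assoc, Rinv_l, Rmult_1_r by lra. nra.
Qed.

Lemma log_series (z : C) : Cmod z < 1 ->
  exists l, clim (fun n => log_partial n z) l /\ Cexp l = (/ (1 - z))%C.
Proof.
intros Hz. assert (H0 := Cmod_ge_0 z). set (q := Cmod z) in *.
destruct (ex_series_le (K := C_AbsRing) (V := C_CompleteNormedModule)
    (fun i => z ^ S i / RtoC (INR (S i)))%C (fun k => q ^ k)) as [l Hl].
{ intros i. change (Cmod (z ^ S i / RtoC (INR (S i))) <= q ^ i).
  assert (H1 : 1 <= INR (S i)) by (apply one_le_INR; lia).
  rewrite Cmod_div by (intros E; apply RtoC_inj in E; lra).
  rewrite Cmod_pow, Cmod_R, Rabs_pos_eq by lra. fold q. simpl pow.
  assert (H2 : 0 <= q ^ i) by (apply pow_le; lra).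
  apply Rmult_le_reg_r with (INR (S i)); [lra|].
  unfold Rdiv. rewrite Rmult_assoc, Rinv_l, Rmult_1_r by lra. nra. }
{ apply ex_series_geom. rewrite Rabs_pos_eq; lra. }
apply is_series_clim in Hl. exists l. split; [exact Hl|].
assert (H1z : (1 - z)%C <> 0%C).
{ apply Cmod_gt_0. assert (T := Cmod_triangle_rev 1 z). rewrite Cmod_1 in T. fold q in T. lra. }
assert (Hlim : clim (fun n => (1 - z) * Cexp (log_partial n z))%C ((1 - z) * Cexp l)%C).
{ apply clim_scal. apply (clim_ccont Cexp); [exact Hl|]. eapply cderiv_ccont, cderiv_Cexp. }
assert (Hone : clim (fun n => (1 - z) * Cexp (log_partial n z))%C 1%C).
{ set (B := exp (q / (1 - q))).
  assert (HB : 0 < B) by apply exp_pos.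
  assert (Hn : forall n, Cmod ((1 - z) * Cexp (log_partial n z) - 1) <= 2 * B * q ^ n).
  { intros n. set (F := fun w => ((1 - w) * Cexp (log_partial n w))%C).
    assert (HF0 : F 0%C = 1%C).
    { unfold F, log_partial. replace (csum (fun i => 0 ^ S i / RtoC (INR (S i)))%C n) with (RtoC 0).
      - rewrite Cexp_0. ring.
      - induction n as [|n IH]; cbn [csum]; [reflexivity|]. rewrite <- IH. simpl Cpow. unfold Cdiv. ring. }
    change ((1 - z) * Cexp (log_partial n z))%C with (F z). rewrite <- HF0.
    apply Rle_trans with (2 * (B * q ^ n) * Cmod z).
    - apply (mean_value_inequality F (fun w => - (w ^ n * Cexp (log_partial n w)))%C).
      intros x Hx. set (w := (RtoC x * z)%C).
      assert (Hw : Cmod w <= q).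
      { unfold w. rewrite Cmod_mult, Cmod_R, Rabs_pos_eq by lra. fold q. nra. }
      split.
      + eapply cderiv_eq.
        * apply cderiv_mult; [apply cderiv_minus; [apply cderiv_const|apply cderiv_id]|].
          apply (cderiv_comp Cexp); [apply cderiv_log_partial|apply cderiv_Cexp].
        * cbv beta.
          transitivity (- Cexp (log_partial n w)
            + Cexp (log_partial n w) * ((1 - w) * csum (fun i => w ^ i) n))%C; [ring|].
          rewrite csum_geometric. ring.
      + rewrite Cmod_opp, Cmod_mult, Cmod_pow, Cmod_Cexp, Rmult_comm.
        apply Rmult_le_compat.
        * left; apply exp_pos.
        * apply pow_le, Cmod_ge_0.
        * unfold B. assert (H2 := Cmod_log_partial_le n w q Hw Hz).
          assert (H3 := re_le_Cmod (log_partial n w)). assert (H4 := Rle_abs (Re (log_partial n w))).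
          destruct (Rle_lt_or_eq_dec (Re (log_partial n w)) (q / (1 - q))) as [E|E]; [lra| |].
          -- left. now apply exp_increasing.
          -- right. now rewrite E.
        * apply pow_incr. split; [apply Cmod_ge_0|assumption].
    - fold q. assert (0 <= B * q ^ n) by (apply Rmult_le_pos; [lra|apply pow_le; lra]). nra. }
  intros eps He.
  destruct (pow_lt_1_zero q) with (y := eps / (2 * B)) as [N HN].
  - rewrite Rabs_pos_eq; lra.
  - apply Rdiv_lt_0_compat; lra.
  - exists N. intros n Hn'. eapply Rle_lt_trans; [apply Hn|].
    specialize (HN n Hn'). rewrite Rabs_pos_eq in HN by (apply pow_le; lra).
    apply Rmult_lt_compat_l with (r := 2 * B) in HN; [|lra].
    replace (2 * B * (eps / (2 * B))) with eps in HN by (field; lra). exact HN. }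
assert (E := clim_unique _ _ _ Hlim Hone).
transitivity (/ (1 - z) * ((1 - z) * Cexp l))%C; [field; assumption|]. rewrite E. ring.
Qed.

Lemma sum_n_m_csum (f : nat -> C) (m : nat) :
  sum_n_m (G := C_AbelianMonoid) f 1 m = csum (fun j => f (S j)) m.
Proof.
induction m as [|m IH].
- rewrite sum_n_m_zero by lia. reflexivity.
- rewrite sum_n_Sm by lia. rewrite IH. reflexivity.
Qed.

Lemma csum_plus (u v : nat -> C) (n : nat) :
  csum (fun i => u i + v i)%C n = (csum u n + csum v n)%C.
Proof. induction n as [|n IH]; simpl; [ring|]. rewrite IH. ring. Qed.

Lemma csum_exchange (a : nat -> nat -> C) (n m : nat) :
  csum (fun i => csum (fun j => a i j) m) n = csum (fun j => csum (fun i => a i j) n) m.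
Proof.
induction n as [|n IH]; simpl.
- induction m as [|m IHm]; simpl; [reflexivity|]. rewrite <- IHm. ring.
- now rewrite IH, csum_plus.
Qed.

Lemma csum_ext (u v : nat -> C) (n : nat) :
  (forall i, (i < n)%nat -> u i = v i) -> csum u n = csum v n.
Proof.
induction n as [|n IH]; intros H; simpl; [reflexivity|].
now rewrite IH, H by (intros; try apply H; lia).
Qed.

Lemma log_series_sum (z : nat -> C) (m : nat) :
  (forall j, (1 <= j <= m)%nat -> Cmod (z j) < 1) ->
  exists l, clim (fun n => csum (fun j => log_partial n (z (S j))) m) l /\
    Cexp l = Cprod (fun j => / (1 - z j))%C m.
Proof.
induction m as [|m IH]; intros H.
- exists 0%C. split; [exact (clim_const 0%C)|apply Cexp_0].
- destruct IH as [l [H1 H2]]; [intros; apply H; lia|].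
  destruct (log_series (z (S m))) as [l' [H3 H4]]; [apply H; lia|].
  exists (l + l')%C. split.
  + simpl. now apply clim_plus.
  + rewrite Cexp_plus, H2, H4. reflexivity.
Qed.

Lemma prime_npow_le_half (p : nat) (x : R) : is_prime p -> 1 < x -> 0 < npow p (- x) <= 1 / 2.
Proof.
intros Hp Hs. split; [apply npow_pos|]. assert (H := is_prime_ge2 p Hp).
rewrite npow_opp. replace (1 / 2) with (/ 2) by field. apply Rinv_le_contravar; [lra|].
assert (Hp2 : 2 <= INR p) by (change 2 with (INR 2); now apply le_INR).
apply Rle_trans with (1 := Hp2). unfold npow.
rewrite <- (Rpower_1 (INR p)) at 1 by lra. apply Rle_Rpower; lra.
Qed.

Lemma Cmod_local_parameter_le (L : selbergSP) (s : C) (p j : nat) :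
  is_prime p -> (1 <= j <= order L)%nat ->
  Cmod (alpha L j p / RCpow (INR p) s) <= npow p (- Re s).
Proof.
intros Hp Hj. rewrite Cmod_div, Cmod_RCpow, npow_opp by apply RCpow_neq0.
assert (Ha := alpha_le_1 L p j Hp Hj). assert (H := npow_pos p (Re s)).
assert (0 < / npow p (Re s)) by now apply Rinv_0_lt_compat.
unfold Rdiv. nra.
Qed.

Lemma local_log_partial (L : selbergSP) (s : C) (p n : nat) :
  csum (fun i => let k := S i in
    sum_n_m (G := C_AbelianMonoid)
      (fun j => alpha L j p ^ k / (INR k * RCpow (INR p) (INR k * s)))%C 1 (order L)) n
  = csum (fun j => log_partial n (alpha L (S j) p / RCpow (INR p) s)%C) (order L).
Proof.
unfold log_partial. rewrite <- (csum_exchange (fun i j => (alpha L (S j) p / RCpow (INR p) s) ^ S i / RtoC (INR (S i)))%C).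
apply csum_ext. intros i _. cbv zeta. rewrite sum_n_m_csum. apply csum_ext. intros j _.
rewrite RCpow_mult_INR. unfold Cdiv. rewrite Cpow_mult_l, Cpow_inv by apply RCpow_neq0.
field. split; [intros E; apply RtoC_inj in E; rewrite S_INR in E; assert (H := pos_INR i); lra|].
apply Cpow_nz, RCpow_neq0.
Qed.

Lemma local_log_spec (L : selbergSP) (s : C) (p : nat) (u : C) :
  1 < Re s -> is_prime p ->
  is_series (K := C_AbsRing) (V := C_NormedModule)
   (fun i => let k := S i in
      sum_n_m (G := C_AbelianMonoid)
        (fun j => alpha L j p ^ k / (INR k * RCpow (INR p) (INR k * s)))%C 1 (order L)) u ->
  Cexp u = euler_factor (order L) (alpha L) s p /\
  Cmod u <= 2 * INR (order L) * npow p (- Re s).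
Proof.
intros Hs Hp Hu. apply is_series_clim in Hu.
set (z := fun j => (alpha L j p / RCpow (INR p) s)%C).
assert (Hu' : clim (fun n => csum (fun j => log_partial n (z (S j))) (order L)) u).
{ apply clim_ext with (2 := Hu). apply local_log_partial. }
assert (Hy := prime_npow_le_half p (Re s) Hp Hs).
destruct (log_series_sum z (order L)) as [l [H1 H2]].
{ intros j Hj. unfold z. assert (H := Cmod_local_parameter_le L s p j Hp Hj). lra. }
rewrite (clim_unique _ _ _ Hu' H1). split; [exact H2|].
replace l with (l - 0)%C by ring.
apply (clim_Cmod_le (fun n => csum (fun j => log_partial n (z (S j))) (order L))); [exact H1|].
exists O. intros n _.
replace (csum (fun j => log_partial n (z (S j))) (order L) - 0)%C
  with (csum (fun j => log_partial n (z (S j))) (order L)) by ring.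
eapply Rle_trans.
- apply (Cmod_csum_le _ (fun _ => 2 * npow p (- Re s))). intros j Hj.
  eapply Rle_trans; [apply Cmod_log_partial_le with (q := npow p (- Re s))|].
  + apply Cmod_local_parameter_le; [assumption|lia].
  + lra.
  + apply Rmult_le_reg_r with (1 - npow p (- Re s)); [lra|].
    unfold Rdiv. rewrite Rmult_assoc, Rinv_l, Rmult_1_r by lra. nra.
- rewrite rsum_const. lra.
Qed.

Lemma log_euler_sum_spec (L : selbergSP) (s v : C) : 1 < Re s -> log_euler_sum L s v ->
  Cexp v = L s /\ Cmod v <= 2 * INR (order L) / (Re s - 1).
Proof.
intros Hs [u [Hu Hv]]. apply is_series_clim in Hv.
set (b := fun p => if is_prime_dec p then u p else RtoC 0).
change (clim (csum b) v) in Hv.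
split.
- destruct (lfun_euler L s Hs) as [_ Hlim]. apply filterlim_clim in Hlim.
  assert (H1 : clim (fun n => Cexp (csum b n)) (Cexp v)).
  { apply (clim_ccont Cexp); [assumption|]. eapply cderiv_ccont, cderiv_Cexp. }
  (* [csum] counts from 0 and [Cprod] from 1. The shift aligns them; the extra index 0 is not prime
     and contributes nothing. *)
  apply clim_shift in H1. refine (clim_unique _ _ _ _ Hlim).
  apply clim_ext with (2 := H1). intros n. induction n as [|n IH].
  + simpl. unfold b. destruct (is_prime_dec 0) as [H|H].
    * apply is_prime_ge2 in H. lia.
    * replace (0 + 0)%C with (RtoC 0) by ring. apply Cexp_0.
  + cbn [csum Cprod] in *. rewrite Cexp_plus, IH. f_equal. unfold b.
    destruct (is_prime_dec (S n)) as [H|H]; [|apply Cexp_0].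
    now apply (local_log_spec L s (S n) _ Hs H (Hu _ H)).
(* The indices 0 and 1 are dropped because they are not prime. Had the term [n = 1] been kept in the
   majorant, the bound would be a multiple of [sigma / (sigma - 1)] and not of [1 / (sigma - 1)]. *)
- replace v with (v - 0)%C by ring. apply (clim_Cmod_le _ _ _ _ Hv). exists 2%nat. intros n Hn.
  destruct n as [|[|n]]; [lia|lia|].
  replace (csum b (S (S n)) - 0)%C with (csum (fun i => b (S (S i))) n).
  + eapply Rle_trans.
    * apply (Cmod_csum_le _ (fun k => 2 * INR (order L) * npow (S k) (- Re s))). intros i _.
      unfold b. destruct (is_prime_dec (S (S i))) as [H|H].
      -- now apply (local_log_spec L s (S (S i)) _ Hs H (Hu _ H)).
      -- rewrite Cmod_0. apply Rmult_le_pos; [|left; apply npow_pos].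
         assert (Hi := pos_INR (order L)). lra.
    * rewrite rsum_scal. unfold Rdiv. apply Rmult_le_compat_l.
      -- assert (Hi := pos_INR (order L)). lra.
      -- now apply zeta_partial_tail_le.
  + assert (B : forall k, (k <= 1)%nat -> b k = RtoC 0).
    { intros k Hk. unfold b. destruct (is_prime_dec k) as [H|H]; [|reflexivity].
      apply is_prime_ge2 in H. lia. }
    clear Hn. induction n as [|n IH].
    * simpl. rewrite !B by lia. ring.
    * cbn [csum] in *. rewrite IH. ring.
Qed.

Lemma lfun_cderiv (L : selbergSP) (s : C) : s <> RtoC 1 -> exists l, cderiv L s l.
Proof.
intros Hs. destruct (lfun_continuation L) as (k & F & HF & _ & HFL).
destruct (proj1 (Cdifferentiable_cderiv F s) (HF s)) as [l Hl].
destruct (cderiv_pow (fun w => w - 1)%C s (1 - 0)%C k) as [m Hm].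
{ apply cderiv_minus; [apply cderiv_id|apply cderiv_const]. }
assert (Hs1 : (s - 1)%C <> 0%C) by now apply Cminus_eq_contra.
assert (Hp : 0 < Cmod (s - 1)) by now apply Cmod_gt_0.
eexists. apply (cderiv_local (fun w => F w * / (w - 1) ^ k)%C L s _ (Cmod (s - 1)) Hp).
- intros w Hw. assert (Hw1 : w <> RtoC 1) by (intros ->; rewrite Cmod_minus_sym in Hw; lra).
  rewrite HFL by now left. field. now apply Cpow_nz, Cminus_eq_contra.
- apply cderiv_mult; [exact Hl|]. apply cderiv_inv; [exact Hm|]. now apply Cpow_nz.
Qed.

Lemma degree_ge0 (L : selbergSP) : 0 <= degree L.
Proof.
unfold degree. apply Rmult_le_pos; [lra|].
assert (H := fe_lambda_pos L). revert H.
generalize (fe_size L) (fe_lambda L). intros f lambda H.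
induction f as [|f IH].
- rewrite sum_n_m_zero by lia. apply Rle_refl.
- rewrite sum_n_Sm by lia. apply Rplus_le_le_0_compat.
  + apply IH. intros; apply H; lia.
  + left. apply H. lia.
Qed.

(** * Ratios of Gamma values *)

Lemma CLim_seq_clim (u : nat -> C) (l : C) : clim u l -> CLim_seq u = l.
Proof.
intros H.
assert (HRe : is_lim_seq (fun n => Re (u n)) (Re l)).
{ apply is_lim_seq_spec. intros eps. destruct (H eps (cond_pos eps)) as [N HN].
  exists N. intros n Hn. eapply Rle_lt_trans; [|apply (HN n Hn)].
  eapply Rle_trans; [right|apply re_le_Cmod]. unfold Cminus. now rewrite re_plus, re_opp. }
assert (HIm : is_lim_seq (fun n => Im (u n)) (Im l)).
{ apply is_lim_seq_spec. intros eps. destruct (H eps (cond_pos eps)) as [N HN].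
  exists N. intros n Hn. eapply Rle_lt_trans; [|apply (HN n Hn)].
  eapply Rle_trans; [right|apply im_le_Cmod]. unfold Cminus. now rewrite im_plus, im_opp. }
unfold CLim_seq. rewrite (is_lim_seq_unique _ _ HRe), (is_lim_seq_unique _ _ HIm).
apply Ceq_ext; reflexivity.
Qed.

Lemma inv_S_telescope (n : nat) : (1 <= n)%nat ->
  / INR n ^ 2 <= 2 * (/ INR n - / INR (S n)).
Proof.
intros Hn. assert (H : 1 <= INR n) by now apply one_le_INR.
rewrite S_INR. set (x := INR n) in *.
assert (E : 2 * (/ x - / (x + 1)) - / x ^ 2 = (x - 1) * / (x ^ 2 * (x + 1))) by (field; lra).
assert (0 <= (x - 1) * / (x ^ 2 * (x + 1))).
{ apply Rmult_le_pos; [lra|]. left. apply Rinv_0_lt_compat, Rmult_lt_0_compat; [apply pow_lt|]; lra. }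
lra.
Qed.

Lemma exp_neg_le (x : R) : 0 <= x <= 1 / 2 -> exp (- (2 * x)) <= 1 - x.
Proof.
intros Hx. rewrite exp_Ropp. assert (H := exp_ineq1_le (2 * x)).
apply Rle_trans with (/ (1 + 2 * x)).
- apply Rinv_le_contravar; lra.
- apply Rmult_le_reg_r with (1 + 2 * x); [lra|]. rewrite Rinv_l by lra. nra.
Qed.

(* The potentials [|u n| exp (2A/n)] and [|u n| exp (-4A/n)] are monotone. *)
Lemma infinite_product_converges (u : nat -> C) (A : R) (N : nat) :
  (1 <= N)%nat -> 0 <= A -> A / INR N ^ 2 <= 1 / 2 ->
  (forall n, (N <= n)%nat -> Cmod (u (S n) - u n) <= Cmod (u n) * (A / INR n ^ 2)) ->
  u N <> 0%C ->
  exists l, clim u l /\ l <> 0%C.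
Proof.
intros HN HA HAN Hu HuN.
assert (Hi : forall n, (N <= n)%nat -> 1 <= INR n).
{ intros n Hn. change 1 with (INR 1). apply le_INR. lia. }
assert (Hsmall : forall n, (N <= n)%nat -> 0 <= A / INR n ^ 2 <= 1 / 2 /\
   A / INR n ^ 2 <= 2 * A / INR n - 2 * A / INR (S n)).
{ intros n Hn. specialize (Hi n Hn). assert (HiN : 1 <= INR N) by now apply one_le_INR.
  assert (Hp : 0 < / INR n ^ 2) by (apply Rinv_0_lt_compat, pow_lt; lra).
  split; [split|].
  - unfold Rdiv. apply Rmult_le_pos; lra.
  - apply Rle_trans with (2 := HAN). apply Rmult_le_compat_l; [assumption|].
    apply Rinv_le_contravar; [apply pow_lt; lra|]. apply pow_incr. split; [lra|]. now apply le_INR.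
  - assert (H := inv_S_telescope n ltac:(lia)). unfold Rdiv. nra. }
assert (Hup : forall k, Cmod (u (N + k)%nat) * exp (2 * A / INR (N + k)) <= Cmod (u N) * exp (2 * A / INR N)).
{ induction k as [|k IH]; [rewrite Nat.add_0_r; lra|]. rewrite Nat.add_succ_r.
  set (n := (N + k)%nat) in *. destruct (Hsmall n ltac:(unfold n; lia)) as [S1 S2].
  specialize (Hu n ltac:(unfold n; lia)).
  assert (T := Cmod_triangle (u (S n) - u n) (u n)).
  replace (u (S n) - u n + u n)%C with (u (S n)) in T by ring.
  apply Rle_trans with (2 := IH). set (x := A / INR n ^ 2) in *.
  assert (H1 : Cmod (u (S n)) <= Cmod (u n) * exp x).
  { assert (H := exp_ineq1_le x). assert (H0 := Cmod_ge_0 (u n)). nra. }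
  apply Rle_trans with (Cmod (u n) * exp x * exp (2 * A / INR (S n))).
  - apply Rmult_le_compat_r; [left; apply exp_pos|assumption].
  - rewrite Rmult_assoc, <- exp_plus. apply Rmult_le_compat_l; [apply Cmod_ge_0|].
    apply exp_le_compat. lra. }
assert (Hlow : forall k, Cmod (u N) * exp (- (4 * A / INR N)) <= Cmod (u (N + k)%nat) * exp (- (4 * A / INR (N + k)))).
{ induction k as [|k IH]; [rewrite Nat.add_0_r; lra|]. rewrite Nat.add_succ_r.
  set (n := (N + k)%nat) in *. destruct (Hsmall n ltac:(unfold n; lia)) as [S1 S2].
  specialize (Hu n ltac:(unfold n; lia)).
  assert (T := Cmod_triangle_rev (u n) (u n - u (S n))).
  replace (u n - (u n - u (S n)))%C with (u (S n)) in T by ring.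
  rewrite (Cmod_minus_sym (u n)) in T.
  apply Rle_trans with (1 := IH). set (x := A / INR n ^ 2) in *.
  assert (H1 : Cmod (u n) * exp (- (2 * x)) <= Cmod (u (S n))).
  { assert (H := exp_neg_le x S1). assert (H0 := Cmod_ge_0 (u n)). nra. }
  apply Rle_trans with (Cmod (u n) * exp (- (2 * x)) * exp (- (4 * A / INR (S n)))).
  - rewrite Rmult_assoc, <- exp_plus. apply Rmult_le_compat_l; [apply Cmod_ge_0|].
    apply exp_le_compat. lra.
  - apply Rmult_le_compat_r; [left; apply exp_pos|assumption]. }
assert (HuNp : 0 < Cmod (u N)) by now apply Cmod_gt_0.
set (B := Cmod (u N) * exp (2 * A / INR N)) in *.
assert (HB : forall k, Cmod (u (N + k)%nat) <= B).
{ intros k. apply Rle_trans with (2 := Hup k).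
  assert (H1 : 1 <= exp (2 * A / INR (N + k))).
  { rewrite <- exp_0. apply exp_le_compat. apply Rdiv_le_0_compat; [lra|].
    specialize (Hi (N + k)%nat ltac:(lia)). lra. }
  assert (H0 := Cmod_ge_0 (u (N + k)%nat)). nra. }
assert (Hlow' : forall k, Cmod (u N) * exp (- (4 * A / INR N)) <= Cmod (u (N + k)%nat)).
{ intros k. apply Rle_trans with (1 := Hlow k).
  assert (H1 : exp (- (4 * A / INR (N + k))) <= 1).
  { rewrite <- exp_0. apply exp_le_compat.
    assert (0 <= 4 * A / INR (N + k)); [|lra]. apply Rdiv_le_0_compat; [lra|].
    specialize (Hi (N + k)%nat ltac:(lia)). lra. }
  assert (H0 := Cmod_ge_0 (u (N + k)%nat)). nra. }
assert (HB0 : 0 <= B) by (specialize (HB O); assert (H := Cmod_ge_0 (u (N + 0)%nat)); lra).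
(* A telescoping majorant: [B A / n^2 <= w k - w (S k)] for [n = N + k], so the increments of [u]
   form an absolutely convergent series. The lower potential bounds [|u n|] away from 0, and hence
   the limit too. *)
set (w := fun k => B * (2 * A / INR (N + k))).
assert (Hser : ex_series (fun k => w k - w (S k))).
{ exists (w O). change (is_lim_seq (sum_n (fun k => w k - w (S k))) (w O)).
  apply (is_lim_seq_ext (fun n => w O - w (S n))).
  - intros n. induction n as [|n IH]; [now rewrite sum_O|]. rewrite sum_Sn, <- IH.
    unfold plus; simpl. ring.
  - replace (Finite (w O)) with (Finite (w O - 0)) by (f_equal; ring).
    apply is_lim_seq_minus'; [apply is_lim_seq_const|].
    unfold w. replace (Finite 0) with (Rbar_mult B (Finite 0)) by (simpl; f_equal; ring).
    apply is_lim_seq_scal_l.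
    apply is_lim_seq_ext with (fun n => 2 * A * / INR (n + S N)).
    + intros n. unfold Rdiv. do 3 f_equal. lia.
    + replace (Finite 0) with (Rbar_mult (2 * A) (Finite 0)) by (simpl; f_equal; ring).
      apply is_lim_seq_scal_l. apply (is_lim_seq_incr_n (fun n => / INR n)).
      replace (Finite 0) with (Rbar_inv p_infty) by reflexivity.
      apply is_lim_seq_inv; [apply is_lim_seq_INR|discriminate]. }
destruct (ex_series_le (K := C_AbsRing) (V := C_CompleteNormedModule)
    (fun k => u (S (N + k)) - u (N + k)%nat)%C (fun k => w k - w (S k))) as [v Hv].
{ intros k. change (Cmod (u (S (N + k)) - u (N + k)%nat) <= w k - w (S k)).
  destruct (Hsmall (N + k)%nat ltac:(lia)) as [S1 S2].
  apply Rle_trans with (1 := Hu (N + k)%nat ltac:(lia)).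
  unfold w. rewrite Nat.add_succ_r.
  apply Rle_trans with (B * (A / INR (N + k) ^ 2)).
  - apply Rmult_le_compat_r; [apply S1|apply HB].
  - rewrite <- Rmult_minus_distr_l. now apply Rmult_le_compat_l. }
{ exact Hser. }
apply is_series_clim in Hv.
assert (Hlim : clim (fun k => u (N + k)%nat) (u N + v)%C).
{ apply clim_ext with (fun k => u N + csum (fun k => u (S (N + k)) - u (N + k)%nat) k)%C.
  - intros k. induction k as [|k IH]; cbn [csum]; [rewrite Nat.add_0_r; ring|].
    rewrite Nat.add_succ_r.
    replace (u (S (N + k))) with (u (N + k)%nat + (u (S (N + k)) - u (N + k)%nat))%C at 2 by ring.
    rewrite <- IH at 2. ring.
  - apply clim_plus; [apply clim_const|exact Hv]. }
exists (u N + v)%C. split.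
- intros eps He. destruct (Hlim eps He) as [M HM]. exists (N + M)%nat. intros n Hn.
  replace n with (N + (n - N))%nat by lia. apply HM. lia.
- set (m := Cmod (u N) * exp (- (4 * A / INR N))) in *.
  assert (Hm : 0 < m) by (apply Rmult_lt_0_compat; [assumption|apply exp_pos]).
  intros E. rewrite E in Hlim. destruct (Hlim m Hm) as [M HM].
  specialize (HM M (le_n M)). specialize (Hlow' M).
  replace (u (N + M)%nat - 0)%C with (u (N + M)%nat) in HM by ring. lra.
Qed.

(** * Convergence of Gauss's sequence *)

Definition gauss_seq (z : C) (n : nat) : C :=
  (RtoC (INR (fact n)) * RCpow (INR n) z / (z * Cprod (fun k => z + RtoC (INR k)) n))%C.

Lemma not_nonpositive_integer (z : C) (k : nat) : Im z <> 0 -> (z + RtoC (INR k))%C <> 0%C.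
Proof.
intros Hz E. apply Hz. apply (f_equal Im) in E. rewrite im_plus, !im_RtoC in E. lra.
Qed.

Lemma gauss_denominator_neq0 (z : C) (n : nat) : Im z <> 0 ->
  (z * Cprod (fun k => z + RtoC (INR k)) n)%C <> 0%C.
Proof.
intros Hz. apply Cmult_neq_0.
- intros ->. apply Hz. apply im_RtoC.
- apply Cprod_neq0. intros k _. now apply not_nonpositive_integer.
Qed.

Lemma gauss_seq_neq0 (z : C) (n : nat) : Im z <> 0 -> gauss_seq z n <> 0%C.
Proof.
intros Hz. unfold gauss_seq. apply Cmult_neq_0.
- apply Cmult_neq_0; [|apply RCpow_neq0]. intros E. apply RtoC_inj in E.
  now apply INR_fact_neq_0 in E.
- intros E. apply C1_nz.
  rewrite <- (Cinv_r _ (gauss_denominator_neq0 z n Hz)), E. ring.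
Qed.

Lemma gauss_seq_S (z : C) (n : nat) : (1 <= n)%nat -> Im z <> 0 ->
  gauss_seq z (S n) = (gauss_seq z n *
    (RtoC (INR (S n)) * Cexp (z * RtoC (ln (INR (S n)) - ln (INR n)))
     / (z + RtoC (INR (S n)))))%C.
Proof.
intros Hn Hz. unfold gauss_seq. rewrite fact_simpl, mult_INR, RtoC_mult. cbn [Cprod].
replace (RCpow (INR (S n)) z) with
  (RCpow (INR n) z * Cexp (z * RtoC (ln (INR (S n)) - ln (INR n))))%C.
2:{ unfold RCpow. rewrite <- Cexp_plus. f_equal. rewrite RtoC_minus. ring. }
assert (H1 := not_nonpositive_integer z (S n) Hz).
assert (H2 := gauss_denominator_neq0 z n Hz).
assert (H3 : z <> 0%C) by (intros E; apply H2; rewrite E; ring).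
assert (H4 : Cprod (fun k => z + RtoC (INR k))%C n <> 0%C) by (intros E; apply H2; rewrite E; ring).
set (D := Cprod (fun k => z + RtoC (INR k))%C n) in *.
set (e := Cexp (z * RtoC (ln (INR (S n)) - ln (INR n)))).
field. auto.
Qed.

(** With [d = log ((n + 1) / n)] and [w = z d], the ratio of consecutive terms minus 1 is [((n +
    1)(exp w - 1 - w) + z ((n + 1) d - 1)) / (z + n + 1)]. Both terms of the numerator are [O(1/n)]
    and the denominator is at least [(n + 1) / 2], which gives the summable rate [1/n^2]. *)
Lemma gauss_seq_step (z : C) (n : nat) : (1 <= n)%nat -> 2 * Cmod z <= INR n -> Im z <> 0 ->
  Cmod (gauss_seq z (S n) - gauss_seq z n)
    <= Cmod (gauss_seq z n) * ((16 * Cmod z ^ 2 + 2 * Cmod z) / INR n ^ 2).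
Proof.
intros Hn Hzn Hz. rewrite gauss_seq_S by assumption.
assert (H1 : 1 <= INR n) by now apply one_le_INR.
assert (H0 := Cmod_ge_0 z).
set (N1 := INR (S n)). assert (EN : N1 = INR n + 1) by apply S_INR.
set (x := INR n) in *.
set (d := ln N1 - ln x).
assert (Hd : / N1 <= d <= / x).
{ assert (Ed : d = ln (N1 / x)) by (unfold d; rewrite ln_div; lra).
  rewrite Ed. split.
  - assert (H := ln_ratio_ge N1 ltac:(lra)). replace (N1 - 1) with x in H by lra. exact H.
  - assert (H := ln_le_self (N1 / x) ltac:(apply Rdiv_lt_0_compat; lra)).
    replace (N1 / x - 1) with (/ x) in H by (rewrite EN; field; lra). exact H. }
assert (Hxi : 0 < / x) by (apply Rinv_0_lt_compat; lra).
assert (Hni : 0 < / N1) by (apply Rinv_0_lt_compat; lra).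
assert (Hw := not_nonpositive_integer z (S n) Hz). fold N1 in Hw.
set (G := gauss_seq z n). set (w := (z * RtoC d)%C).
assert (Hwm : Cmod w <= Cmod z * / x).
{ unfold w. rewrite Cmod_mult, Cmod_R, Rabs_pos_eq by lra. apply Rmult_le_compat_l; lra. }
assert (Hwh : Cmod z * / x <= 1 / 2).
{ apply Rmult_le_reg_r with x; [lra|]. rewrite Rmult_assoc, Rinv_l; lra. }
assert (HE := Cexp_minus_linear w ltac:(lra)).
replace (G * (RtoC N1 * Cexp w / (z + RtoC N1)) - G)%C with
  (G * ((RtoC N1 * (Cexp w - 1 - w) + z * (RtoC (N1 * d - 1))) / (z + RtoC N1)))%C.
2:{ rewrite RtoC_minus, RtoC_mult. unfold w. field. assumption. }
rewrite Cmod_mult. apply Rmult_le_compat_l; [apply Cmod_ge_0|].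
rewrite Cmod_div by assumption.
assert (Hden : N1 / 2 <= Cmod (z + RtoC N1)).
{ assert (T := Cmod_triangle_rev (RtoC N1) (- z)). rewrite Cmod_opp, Cmod_R, Rabs_pos_eq in T by lra.
  replace (RtoC N1 - - z)%C with (z + RtoC N1)%C in T by ring. lra. }
assert (Hnum : Cmod (RtoC N1 * (Cexp w - 1 - w) + z * RtoC (N1 * d - 1))
   <= N1 * (8 * (Cmod z * / x) ^ 2) + Cmod z * / x).
{ eapply Rle_trans; [apply Cmod_triangle|]. rewrite !Cmod_mult, !Cmod_R.
  rewrite (Rabs_pos_eq N1) by lra.
  assert (Hnd : 0 <= N1 * d - 1 <= / x).
  { split.
    - assert (H : N1 * / N1 <= N1 * d) by (apply Rmult_le_compat_l; lra).
      rewrite Rinv_r in H by lra. lra.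
    - assert (H : N1 * d <= N1 * / x) by (apply Rmult_le_compat_l; lra).
      replace (N1 * / x) with (1 + / x) in H by (rewrite EN; field; lra). lra. }
  rewrite (Rabs_pos_eq (N1 * d - 1)) by lra.
  apply Rplus_le_compat; apply Rmult_le_compat_l; try lra.
  apply Rle_trans with (1 := HE). apply Rmult_le_compat_l; [lra|].
  apply pow_incr. split; [apply Cmod_ge_0|assumption]. }
apply Rmult_le_reg_r with (Cmod (z + RtoC N1)); [lra|].
unfold Rdiv at 1. rewrite Rmult_assoc, Rinv_l, Rmult_1_r by lra.
apply Rle_trans with (1 := Hnum).
apply Rle_trans with ((16 * Cmod z ^ 2 + 2 * Cmod z) / x ^ 2 * (N1 / 2)).
- assert (Ez : (16 * Cmod z ^ 2 + 2 * Cmod z) / x ^ 2 * (N1 / 2)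
    = N1 * (8 * (Cmod z * / x) ^ 2) + Cmod z * / x * (N1 * / x)) by (field; lra).
  rewrite Ez. apply Rplus_le_compat_l.
  assert (0 <= Cmod z * / x) by (apply Rmult_le_pos; lra).
  assert (1 <= N1 * / x) by (apply Rmult_le_reg_r with x; [lra|]; rewrite Rmult_assoc, Rinv_l; lra).
  nra.
- apply Rmult_le_compat_l; [|assumption]. apply Rdiv_le_0_compat; [|apply pow_lt; lra].
  assert (0 <= Cmod z ^ 2) by (apply pow_le; lra). lra.
Qed.

Lemma gauss_seq_converges (z : C) : Im z <> 0 ->
  clim (gauss_seq z) (CGamma z) /\ CGamma z <> 0%C.
Proof.
intros Hz. set (A := 16 * Cmod z ^ 2 + 2 * Cmod z).
assert (H0 := Cmod_ge_0 z). assert (H2 : 0 <= Cmod z ^ 2) by (apply pow_le; lra).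
assert (HA : 0 <= A) by (unfold A; lra).
destruct (nfloor_ex (2 * Cmod z + 2 * A + 1) ltac:(lra)) as [N0 HN0].
set (N := S N0).
assert (HN : 2 * Cmod z + 2 * A + 1 < INR N) by (unfold N; rewrite S_INR; lra).
destruct (infinite_product_converges (gauss_seq z) A N) as [l [Hl1 Hl2]].
- unfold N; lia.
- assumption.
- apply Rmult_le_reg_r with (INR N ^ 2); [apply pow_lt; lra|].
  unfold Rdiv at 1. rewrite Rmult_assoc, Rinv_l, Rmult_1_r by (apply pow_nonzero; lra).
  assert (HNN : INR N * 1 <= INR N * INR N) by (apply Rmult_le_compat_l; lra).
  replace (INR N ^ 2) with (INR N * INR N) by ring. lra.
- intros n Hn. apply gauss_seq_step; [unfold N in Hn; lia| |assumption].
  apply le_INR in Hn. lra.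
- now apply gauss_seq_neq0.
- assert (E : CGamma z = l) by (apply CLim_seq_clim; exact Hl1).
  rewrite E. auto.
Qed.

(* [a (ln |w+1| - ln |w|)] and [ln |w+a| - ln |w|] agree up to [O(1/|w|^2)]. *)
Lemma Cmod_shift_le (w : C) (a : R) :
  0 <= a -> 1 <= Cmod w -> 2 * (2 * a + a ^ 2) <= Cmod w -> (w + 1)%C <> 0%C -> (w + RtoC a)%C <> 0%C ->
  Cmod w <= Cmod (w + RtoC a) * Rpower (Cmod w / Cmod (w + 1)) a
              * exp (((2 * a + a ^ 2) ^ 2 + a) / Cmod w ^ 2).
Proof.
intros Ha Hw1 Hwa Hn1 Hna.
set (r := Cmod w) in *. set (u := Re w). set (k := 2 * a + a ^ 2) in *.
assert (Hr2 : r ^ 2 = u ^ 2 + Im w ^ 2) by apply Cmod2_alt.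
assert (Hur : - r <= u <= r) by (apply Rabs_le_between; apply re_le_Cmod).
assert (Hsq : forall b, Cmod (w + RtoC b) ^ 2 = r ^ 2 * (1 + (2 * b * u + b ^ 2) / r ^ 2)).
{ intros b. rewrite Cmod2_alt, re_plus, im_plus, re_RtoC, im_RtoC. fold u.
  replace (r ^ 2 * (1 + (2 * b * u + b ^ 2) / r ^ 2)) with (r ^ 2 + 2 * b * u + b ^ 2) by (field; lra).
  rewrite Hr2. ring. }
assert (Hp1 : 0 < Cmod (w + 1)) by now apply Cmod_gt_0.
assert (Hpa : 0 < Cmod (w + RtoC a)) by now apply Cmod_gt_0.
assert (Hr2p : 1 <= r ^ 2) by (simpl; nra).
assert (Hlog : forall b, 0 < Cmod (w + RtoC b) ->
   2 * (ln (Cmod (w + RtoC b)) - ln r) = ln (1 + (2 * b * u + b ^ 2) / r ^ 2) /\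
   0 < 1 + (2 * b * u + b ^ 2) / r ^ 2).
{ intros b Hb. assert (Hb2 : 0 < Cmod (w + RtoC b) ^ 2) by now apply pow_lt.
  assert (Hpos : 0 < 1 + (2 * b * u + b ^ 2) / r ^ 2).
  { rewrite Hsq in Hb2. apply Rmult_lt_reg_l with (r ^ 2); lra. }
  split; [|assumption].
  assert (E : ln (Cmod (w + RtoC b) ^ 2) = ln (r ^ 2 * (1 + (2 * b * u + b ^ 2) / r ^ 2))) by now rewrite Hsq.
  rewrite ln_mult, !ln_pow in E by lra. simpl INR in E. lra. }
destruct (Hlog a Hpa) as [La _]. destruct (Hlog 1 Hp1) as [L1 L1p].
set (X := (2 * a * u + a ^ 2) / r ^ 2) in *. set (X1 := (2 * 1 * u + 1 ^ 2) / r ^ 2) in *.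
assert (Hi2 : 0 < / r ^ 2) by (apply Rinv_0_lt_compat; lra).
assert (Hk : 0 <= k) by (unfold k; nra).
assert (HX : Rabs X <= k / r).
{ unfold X, Rdiv. rewrite Rabs_mult, (Rabs_pos_eq (/ r ^ 2)) by lra.
  replace (k * / r) with ((k * r) * / r ^ 2) by (field; lra).
  apply Rmult_le_compat_r; [lra|]. apply Rabs_le. unfold k. simpl. nra. }
assert (Hkr : k / r <= 1 / 2).
{ apply Rmult_le_reg_r with r; [lra|]. unfold Rdiv at 1. rewrite Rmult_assoc, Rinv_l by lra. lra. }
assert (HX2 : X ^ 2 <= k ^ 2 / r ^ 2).
{ replace (k ^ 2 / r ^ 2) with ((k / r) ^ 2) by (field; lra). now apply pow_maj_Rabs. }
assert (HXb := HX). apply Rabs_le_between in HXb.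
assert (Hlow : X - 2 * X ^ 2 <= ln (1 + X)).
{ assert (H := ln_le_self (/ (1 + X)) ltac:(apply Rinv_0_lt_compat; lra)).
  rewrite ln_Rinv in H by lra.
  assert (E : 1 - / (1 + X) - (X - 2 * X ^ 2) = X ^ 2 * (1 + 2 * X) * / (1 + X)) by (field; lra).
  assert (0 <= X ^ 2 * (1 + 2 * X) * / (1 + X)).
  { apply Rmult_le_pos; [|left; apply Rinv_0_lt_compat; lra].
    apply Rmult_le_pos; [apply pow2_ge_0|lra]. }
  lra. }
assert (Hup : ln (1 + X1) <= X1) by (assert (H := ln_le_self (1 + X1) L1p); lra).
assert (Hmain : ln r <= ln (Cmod (w + RtoC a)) + a * (ln r - ln (Cmod (w + 1))) + (k ^ 2 + a) / r ^ 2).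
{ change (Cmod (w + 1)) with (Cmod (w + RtoC 1)).
  (* The contributions linear in [u], which are only [O(1/r)] and would not be summable, cancel
     here. *)
  assert (EX : X - a * X1 = (a ^ 2 - a) / r ^ 2) by (unfold X, X1; field; lra).
  assert (HaX : a * ln (1 + X1) <= a * X1) by (apply Rmult_le_compat_l; lra).
  assert (Ha2 : 0 <= a ^ 2 / r ^ 2) by (apply Rdiv_le_0_compat; [apply pow2_ge_0|lra]).
  assert (Ha1 : 0 <= a / r ^ 2) by (apply Rdiv_le_0_compat; lra).
  unfold Rdiv in *. rewrite Rmult_plus_distr_r. rewrite Rmult_minus_distr_r in EX.
  set (l1 := ln (Cmod (w + RtoC 1))) in *. set (la := ln (Cmod (w + RtoC a))) in *.
  assert (E1 : 2 * (a * (l1 - ln r)) <= a * X1) by (rewrite <- L1 in HaX; lra).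
  lra. }
rewrite <- (exp_ln r) at 1 by lra. rewrite <- (exp_ln (Cmod (w + RtoC a))) at 1 by assumption.
unfold Rpower. rewrite ln_div by lra. rewrite <- !exp_plus. now apply exp_le_compat.
Qed.

(** [Cmod_shift_le] is multiplied over [w = z + k], for [k = 0, ..., n]. The powers of
    [|z + k| / |z + k + 1|] telescope, and the errors [exp (4D / (k + 1)^2)] multiply to a bounded
    factor; [2 - / INR (S n)] is the usual telescoping bound for the sum of [1 / (k + 1)^2]. *)
Lemma gauss_denominator_ratio (z : C) (a : R) (n : nat) :
  0 <= a -> Im z <> 0 -> 2 * (2 * a + a ^ 2) <= Rabs (Im z) ->
  (forall k : nat, ((INR k + 1) / 2) ^ 2 <= Cmod (z + RtoC (INR k)) ^ 2) -> 1 <= Rabs (Im z) ->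
  Cmod (z * Cprod (fun k => z + RtoC (INR k))%C n) <=
    Cmod ((z + RtoC a) * Cprod (fun k => z + RtoC a + RtoC (INR k))%C n)
    * Rpower (Cmod z / Cmod (z + RtoC (INR (S n)))) a
    * exp (4 * ((2 * a + a ^ 2) ^ 2 + a) * (2 - / INR (S n))).
Proof.
intros Ha Hz Hza Hk Hz1. set (D := (2 * a + a ^ 2) ^ 2 + a).
assert (HD : 0 <= D) by (unfold D; assert (H := pow2_ge_0 (2 * a + a ^ 2)); lra).
assert (Hstep : forall k : nat, Cmod (z + RtoC (INR k)) <=
  Cmod (z + RtoC a + RtoC (INR k))
  * Rpower (Cmod (z + RtoC (INR k)) / Cmod (z + RtoC (INR (S k)))) a
  * exp (4 * D / (INR k + 1) ^ 2)).
{ intros k. set (w := (z + RtoC (INR k))%C).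
  assert (HIw : Im w = Im z) by (unfold w; rewrite im_plus, im_RtoC; ring).
  assert (HwI : Rabs (Im z) <= Cmod w) by (rewrite <- HIw; apply im_le_Cmod).
  replace (z + RtoC a + RtoC (INR k))%C with (w + RtoC a)%C by (unfold w; ring).
  replace (z + RtoC (INR (S k)))%C with (w + 1)%C by (unfold w; rewrite S_INR, RtoC_plus; ring).
  assert (Hne : forall b, (w + RtoC b)%C <> 0%C).
  { intros b E. apply (f_equal Im) in E. rewrite im_plus, !im_RtoC in E. lra. }
  assert (Hik := pos_INR k).
  eapply Rle_trans; [apply (Cmod_shift_le w a); [assumption|lra|lra|apply Hne|apply Hne]|].
  apply Rmult_le_compat_l; [apply Rmult_le_pos; [apply Cmod_ge_0|left; apply exp_pos]|].
  apply exp_le_compat. fold D. specialize (Hk k). fold w in Hk.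
  replace (4 * D / (INR k + 1) ^ 2) with (D * / ((INR k + 1) / 2) ^ 2) by (field; lra).
  apply Rmult_le_compat_l; [assumption|].
  apply Rinv_le_contravar; [apply pow_lt; lra|exact Hk]. }
assert (Hmod : forall k : nat, 0 < Cmod (z + RtoC (INR k))).
{ intros k. apply Cmod_gt_0. now apply not_nonpositive_integer. }
assert (Hz0 : (z + RtoC (INR 0))%C = z) by (simpl; ring).
induction n as [|n IH].
- cbn [Cprod]. specialize (Hstep O). rewrite Hz0 in Hstep.
  replace (z + RtoC a + RtoC (INR 0))%C with (z + RtoC a)%C in Hstep by (simpl; ring).
  rewrite !Cmult_1_r. apply Rle_trans with (1 := Hstep).
  apply Rmult_le_compat_l; [apply Rmult_le_pos; [apply Cmod_ge_0|left; apply exp_pos]|].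
  apply exp_le_compat. right. simpl. field.
- cbn [Cprod]. rewrite !Cmult_assoc, !(Cmod_mult (_ * _)%C).
  specialize (Hstep (S n)). set (n1 := S n) in *.
  set (P := Cmod (z * Cprod (fun k => z + RtoC (INR k))%C n)) in *.
  set (Q := Cmod ((z + RtoC a) * Cprod (fun k => z + RtoC a + RtoC (INR k))%C n)) in *.
  assert (Hi : 1 <= INR n1) by (change 1 with (INR 1); apply le_INR; unfold n1; lia).
  assert (E : Rpower (Cmod z / Cmod (z + RtoC (INR (S n1)))) a
    = Rpower (Cmod z / Cmod (z + RtoC (INR n1))) a
      * Rpower (Cmod (z + RtoC (INR n1)) / Cmod (z + RtoC (INR (S n1)))) a).
  { assert (M0 := Hmod O). rewrite Hz0 in M0. assert (M1 := Hmod n1). assert (M2 := Hmod (S n1)).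
    rewrite Rpower_mult_distr; [f_equal; field; lra| |]; apply Rdiv_lt_0_compat; assumption. }
  rewrite E.
  set (R1 := Rpower (Cmod z / Cmod (z + RtoC (INR n1))) a) in *.
  set (R2 := Rpower (Cmod (z + RtoC (INR n1)) / Cmod (z + RtoC (INR (S n1)))) a) in *.
  assert (HR1 : 0 < R1) by apply exp_pos. assert (HR2 : 0 < R2) by apply exp_pos.
  assert (HQ : 0 <= Q) by apply Cmod_ge_0. assert (HP : 0 <= P) by apply Cmod_ge_0.
  set (V := Cmod (z + RtoC (INR n1))) in *. set (W := Cmod (z + RtoC a + RtoC (INR n1))) in *.
  assert (HV : 0 <= V) by apply Cmod_ge_0. assert (HW : 0 <= W) by apply Cmod_ge_0.
  apply Rle_trans with ((Q * R1 * exp (4 * D * (2 - / INR n1)))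
    * (W * R2 * exp (4 * D / (INR n1 + 1) ^ 2))).
  + apply Rmult_le_compat; assumption.
  + replace (Q * R1 * exp (4 * D * (2 - / INR n1)) * (W * R2 * exp (4 * D / (INR n1 + 1) ^ 2)))
      with (Q * W * (R1 * R2) * (exp (4 * D * (2 - / INR n1)) * exp (4 * D / (INR n1 + 1) ^ 2))) by ring.
    rewrite <- exp_plus. apply Rmult_le_compat_l.
    * repeat apply Rmult_le_pos; lra.
    * apply exp_le_compat. rewrite (S_INR n1). set (x := INR n1) in *.
      assert (Ei : / x - / (x + 1) - / (x + 1) ^ 2 = / (x * (x + 1) ^ 2)) by (field; lra).
      assert (0 < / (x * (x + 1) ^ 2)).
      { apply Rinv_0_lt_compat. apply Rmult_lt_0_compat; [lra|apply pow_lt; lra]. }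
      unfold Rdiv. rewrite <- Rmult_plus_distr_l. apply Rmult_le_compat_l; lra.
Qed.

Lemma Cmod_gauss_seq (z : C) (n : nat) : Im z <> 0 ->
  Cmod (gauss_seq z n) =
    INR (fact n) * npow n (Re z) / Cmod (z * Cprod (fun k => z + RtoC (INR k))%C n).
Proof.
intros Hz. unfold gauss_seq. rewrite Cmod_div by now apply gauss_denominator_neq0.
rewrite Cmod_mult, Cmod_R, Cmod_RCpow, Rabs_pos_eq by apply pos_INR. reflexivity.
Qed.

Lemma clim_Cmod_compare (u v : nat -> C) (l m : C) (B : R) : 0 <= B ->
  clim u l -> clim v m -> (exists N, forall n, (N <= n)%nat -> Cmod (u n) <= B * Cmod (v n)) ->
  Cmod l <= B * Cmod m.
Proof.
intros HB Hu Hv [N HN]. apply le_epsilon. intros eps He.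
destruct (Hu (eps / 2) ltac:(lra)) as [N1 H1].
destruct (Hv (eps / (2 * (B + 1))) ltac:(apply Rdiv_lt_0_compat; lra)) as [N2 H2].
set (n := (N + N1 + N2)%nat).
specialize (HN n ltac:(unfold n; lia)). specialize (H1 n ltac:(unfold n; lia)).
specialize (H2 n ltac:(unfold n; lia)).
assert (T1 := Cmod_triangle_rev l (u n)). rewrite (Cmod_minus_sym l) in T1.
assert (T2 := Cmod_triangle_rev (v n) m).
assert (T3 : B * Cmod (v n) <= B * (Cmod m + eps / (2 * (B + 1)))) by (apply Rmult_le_compat_l; lra).
assert (T4 : B * (eps / (2 * (B + 1))) <= eps / 2).
{ apply Rmult_le_reg_r with (2 * (B + 1)); [lra|].
  replace (B * (eps / (2 * (B + 1))) * (2 * (B + 1))) with (B * eps) by (field; lra).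
  replace (eps / 2 * (2 * (B + 1))) with (B * eps + eps) by field. lra. }
lra.
Qed.

(** The ratio of the Gauss sequences at [z + a] and [z] is bounded uniformly in [n], because [n^a]
    cancels against the [|z + n + 1|^-a] left by telescoping. The constants are uniform in [a],
    since the shift used later depends on [delta] and thus on [t]. *)
Lemma gamma_ratio (X amax : R) : 0 <= X -> 0 <= amax ->
  exists K Y, 0 < K /\ 1 <= Y /\ forall (z : C) (a : R),
    Rabs (Re z) <= X -> Y <= Rabs (Im z) -> 0 <= a <= amax ->
    CGamma z <> 0%C /\
    Cmod (CGamma (z + RtoC a)) <= K * Rpower (Cmod z) a * Cmod (CGamma z).
Proof.
intros HX Hmax.
set (D := fun a => (2 * a + a ^ 2) ^ 2 + a).
exists (Rpower 2 amax * exp (8 * D amax)), (X + 1 + 2 * (2 * amax + amax ^ 2)).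
split; [apply Rmult_lt_0_compat; apply exp_pos|].
assert (Hm2 : 0 <= amax ^ 2) by apply pow2_ge_0. split; [lra|].
intros z a Hz1 Hz2 Ha.
assert (Ha2 : 0 <= a ^ 2 <= amax ^ 2) by (split; [apply pow2_ge_0|apply pow_incr; lra]).
assert (Hz : Im z <> 0) by (intros E; rewrite E, Rabs_R0 in Hz2; lra).
assert (Hza : Im (z + RtoC a) <> 0) by (rewrite im_plus, im_RtoC, Rplus_0_r; assumption).
destruct (gauss_seq_converges z Hz) as [L1 N1]. destruct (gauss_seq_converges _ Hza) as [L2 _].
split; [assumption|].
(* A negative real part could make [|z + k|] small for some [k]; [|Im z| >= X + 1] compensates for
   this. *)
assert (Hk : forall k : nat, ((INR k + 1) / 2) ^ 2 <= Cmod (z + RtoC (INR k)) ^ 2).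
{ intros k. rewrite Cmod2_alt, re_plus, im_plus, re_RtoC, im_RtoC, Rplus_0_r.
  assert (H1 : (X + 1) ^ 2 <= Im z ^ 2).
  { rewrite <- (Rabs_pos_eq (X + 1)) by lra. rewrite <- !Rsqr_pow2, Rsqr_abs, (Rsqr_abs (Im z)), Rabs_Rabsolu.
    apply Rsqr_incr_1; [|apply Rabs_pos|apply Rabs_pos]. rewrite (Rabs_pos_eq (X + 1)); lra. }
  assert (H2 : Re z ^ 2 <= X ^ 2) by (apply pow_maj_Rabs; assumption).
  assert (Hi := pos_INR k). simpl in *.
  assert (H3 := pow2_ge_0 (INR k + 2 * Re z)). assert (H4 := pow2_ge_0 (INR k - 1)).
  simpl in *. nra. }
assert (Hbase : forall n, (1 <= n)%nat ->
  Cmod (gauss_seq (z + RtoC a) n) <=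
    Rpower 2 amax * exp (8 * D amax) * Rpower (Cmod z) a * Cmod (gauss_seq z n)).
{ intros n Hn.
  assert (Hi : 1 <= INR n) by now apply one_le_INR.
  assert (H := gauss_denominator_ratio z a n ltac:(lra) Hz ltac:(lra) Hk ltac:(lra)).
  rewrite !Cmod_gauss_seq by assumption.
  set (P := Cmod (z * Cprod (fun k => z + RtoC (INR k))%C n)) in *.
  set (Q := Cmod ((z + RtoC a) * Cprod (fun k => z + RtoC a + RtoC (INR k))%C n)) in *.
  assert (HP : 0 < P) by (apply Cmod_gt_0; now apply gauss_denominator_neq0).
  assert (HQ : 0 < Q) by (apply Cmod_gt_0; now apply gauss_denominator_neq0).
  rewrite re_plus, re_RtoC, npow_plus.
  set (fn := INR (fact n) * npow n (Re z)).
  assert (Hfn : 0 < fn) by (apply Rmult_lt_0_compat; [apply INR_fact_lt_0|apply npow_pos]).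
  assert (Hz0 : 0 < Cmod z) by (apply Cmod_gt_0; intros E; apply Hz; rewrite E; apply im_RtoC).
  set (V := Cmod (z + RtoC (INR (S n)))) in *.
  assert (HV : INR n / 2 <= V).
  { specialize (Hk (S n)). fold V in Hk. rewrite S_INR in Hk.
    assert (HV0 : 0 <= V) by apply Cmod_ge_0.
    apply Rnot_lt_le. intros Hlt. simpl in Hk. nra. }
  assert (HVp : 0 < V) by lra.
  assert (Hkey : npow n a * P <= Rpower 2 amax * exp (8 * D amax) * Rpower (Cmod z) a * Q).
  { apply Rle_trans with (npow n a * (Q * Rpower (Cmod z / V) a
       * exp (4 * ((2 * a + a ^ 2) ^ 2 + a) * (2 - / INR (S n))))).
    - apply Rmult_le_compat_l; [left; apply npow_pos|exact H].
    - assert (E1 : npow n a * Rpower (Cmod z / V) a = Rpower (INR n / V) a * Rpower (Cmod z) a).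
      { unfold npow. rewrite !Rpower_mult_distr; try lra; [f_equal; field; lra| |];
          apply Rdiv_lt_0_compat; lra. }
      assert (E2 : Rpower (INR n / V) a <= Rpower 2 amax).
      { apply Rle_trans with (Rpower 2 a).
        - apply Rle_Rpower_l; [lra|]. split; [apply Rdiv_lt_0_compat; lra|].
          apply Rmult_le_reg_r with V; [lra|]. unfold Rdiv. rewrite Rmult_assoc, Rinv_l by lra. lra.
        - apply Rle_Rpower; lra. }
      assert (E3 : exp (4 * ((2 * a + a ^ 2) ^ 2 + a) * (2 - / INR (S n))) <= exp (8 * D amax)).
      { apply exp_le_compat. unfold D.
        assert (Hs : 0 < / INR (S n)) by (apply Rinv_0_lt_compat, lt_0_INR; lia).
        assert (Hd : (2 * a + a ^ 2) ^ 2 <= (2 * amax + amax ^ 2) ^ 2) by (apply pow_incr; lra).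
        assert (Hd0 := pow2_ge_0 (2 * a + a ^ 2)).
        nra. }
      set (E := exp (4 * ((2 * a + a ^ 2) ^ 2 + a) * (2 - / INR (S n)))) in *.
      replace (npow n a * (Q * Rpower (Cmod z / V) a * E))
        with ((npow n a * Rpower (Cmod z / V) a) * Q * E) by ring.
      rewrite E1.
      replace (Rpower (INR n / V) a * Rpower (Cmod z) a * Q * E)
        with ((Rpower (INR n / V) a * E) * (Rpower (Cmod z) a * Q)) by ring.
      rewrite (Rmult_assoc (Rpower 2 amax * exp (8 * D amax))).
      apply Rmult_le_compat_r; [apply Rmult_le_pos; [left; apply exp_pos|lra]|].
      apply Rmult_le_compat; try assumption; left; apply exp_pos. }
  replace (INR (fact n) * (npow n (Re z) * npow n a) / Q) with (fn * / (P * Q) * (npow n a * P))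
    by (unfold fn; field; lra).
  replace (Rpower 2 amax * exp (8 * D amax) * Rpower (Cmod z) a * (fn / P))
    with (fn * / (P * Q) * (Rpower 2 amax * exp (8 * D amax) * Rpower (Cmod z) a * Q))
    by (field; lra).
  apply Rmult_le_compat_l; [|exact Hkey].
  apply Rmult_le_pos; [lra|]. left. apply Rinv_0_lt_compat. nra. }
apply (clim_Cmod_compare (gauss_seq (z + RtoC a)) (gauss_seq z)); try assumption.
- repeat apply Rmult_le_pos; left; apply exp_pos.
- exists 1%nat. exact Hbase.
Qed.

(** * The convexity bound *)

Lemma Rpower_le_exp_half (rho c B eps : R) : 0 < rho -> 0 < c -> 0 < eps ->
  exists N0, forall N, 0 <= N -> N0 <= N -> Rpower (N + c) rho + B <= eps * exp (N / 2).
Proof.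
intros Hr Hc He.
set (eta := / (8 * rho)).
assert (Heta : 0 < eta) by (apply Rinv_0_lt_compat; lra).
set (y0 := (1 + Rabs B) / eps + 1).
assert (HB := Rabs_pos B).
assert (Hy0 : 1 <= y0).
{ unfold y0. assert (0 <= (1 + Rabs B) / eps) by (apply Rdiv_le_0_compat; lra). lra. }
exists (Rmax (4 * y0) (8 * (c / 8 + rho * (- ln eta)))).
intros N HN0 HN.
assert (H1 := Rle_trans _ _ _ (Rmax_l _ _) HN). assert (H2 := Rle_trans _ _ _ (Rmax_r _ _) HN).
assert (Hl : rho * ln (N + c) <= N / 4).
{ assert (H := ln_le_self (eta * (N + c)) ltac:(apply Rmult_lt_0_compat; lra)).
  rewrite ln_mult in H by lra.
  apply Rmult_le_compat_l with (r := rho) in H; [|lra].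
  replace (rho * (eta * (N + c) - 1)) with ((N + c) / 8 - rho) in H by (unfold eta; field; lra).
  lra. }
assert (Hp : Rpower (N + c) rho <= exp (N / 4)) by (apply exp_le_compat; exact Hl).
assert (Hy : y0 <= exp (N / 4)) by (assert (H := exp_ineq1_le (N / 4)); lra).
replace (exp (N / 2)) with (exp (N / 4) * exp (N / 4)) by (rewrite <- exp_plus; f_equal; field).
set (y := exp (N / 4)) in *.
assert (Hey : 1 + Rabs B <= eps * y).
{ apply Rle_trans with (eps * y0).
  - unfold y0. rewrite Rmult_plus_distr_l.
    replace (eps * ((1 + Rabs B) / eps)) with (1 + Rabs B) by (field; lra). lra.
  - apply Rmult_le_compat_l; lra. }
assert (HB' := Rle_abs B). nra.
Qed.

(** This is [2 cos ((z - m) / 2)]. On a strip of width at most 3 centred at [m] its real part grows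
    like [exp (|Im z| / 2)], so [exp (- eps * damping)] decays doubly exponentially and beats
    [exp (|z|^rho)] for every [rho]. *)
Definition damping (m : R) (z : C) : C :=
  (Cexp (Ci / 2 * (z - m)) + Cexp (- Ci / 2 * (z - m)))%C.

Lemma re_damping (m : R) (z : C) :
  Re (damping m z) = cos ((Re z - m) / 2) * (exp (Im z / 2) + exp (- (Im z / 2))).
Proof.
unfold damping. rewrite re_plus.
assert (E1 : (Ci / 2 * (z - m))%C = (- (Im z / 2), (Re z - m) / 2)).
{ apply Ceq_ext; unfold Re, Im, Ci; simpl; field. }
assert (E2 : (- Ci / 2 * (z - m))%C = (Im z / 2, - ((Re z - m) / 2))).
{ apply Ceq_ext; unfold Re, Im, Ci; simpl; field. }
rewrite E1, E2. unfold Cexp, Re at 1 3, Im at 1 3; simpl.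
rewrite cos_neg. unfold Re, Im; simpl. ring.
Qed.

Lemma re_damping_ge (m : R) (z : C) : Rabs (Re z - m) <= 3 / 2 ->
  exp (Rabs (Im z) / 2) / 2 <= Re (damping m z).
Proof.
intros Hz. rewrite re_damping.
assert (Hc : 1 / 2 <= cos ((Re z - m) / 2)).
{ assert (H := one_minus_cos_le ((Re z - m) / 2)).
  assert (Hsq : (Re z - m) ^ 2 <= (3 / 2) ^ 2) by (apply pow_maj_Rabs; assumption).
  simpl in *. nra. }
assert (H1 := exp_pos (Im z / 2)). assert (H2 := exp_pos (- (Im z / 2))).
assert (He : exp (Rabs (Im z) / 2) <= exp (Im z / 2) + exp (- (Im z / 2))).
{ unfold Rabs. destruct (Rcase_abs (Im z)).
  - replace (- Im z / 2) with (- (Im z / 2)) by field. lra.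
  - lra. }
nra.
Qed.

Lemma cderiv_damping (m eps : R) (z : C) :
  exists l, cderiv (fun z => Cexp (- RtoC eps * damping m z)) z l.
Proof.
destruct (cderiv_Cexp_affine (Ci / 2) m z) as [l1 H1].
destruct (cderiv_Cexp_affine (- Ci / 2) m z) as [l2 H2].
eexists. apply (cderiv_comp Cexp); [|apply cderiv_Cexp].
apply cderiv_mult; [apply cderiv_const|]. unfold damping. apply cderiv_plus; eassumption.
Qed.

(** After multiplication by [exp (- eps * damping)], of modulus at most 1 on the strip, the bound
    [W] holds on all sides of a sufficiently tall rectangle. The maximum principle gives it at [z0],
    and [eps] is then made small. *)
Lemma phragmen_lindelof (f : C -> C) (a b r0 rho B W : R) :
  a <= b <= a + 3 -> 0 < rho -> 0 < W ->
  (forall z, a <= Re z <= b -> exists l, cderiv f z l) ->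
  (forall z, a <= Re z <= b -> r0 <= Cmod z -> Cmod (f z) <= exp (Rpower (Cmod z) rho + B)) ->
  (forall z, Re z = a \/ Re z = b -> Cmod (f z) <= W) ->
  forall z, a <= Re z <= b -> Cmod (f z) <= W.
Proof.
intros Hab Hr HW Hf Hgrow Hb z0 Hz0.
set (m := (a + b) / 2).
assert (Hm : forall z, a <= Re z <= b -> Rabs (Re z - m) <= 3 / 2).
{ intros z Hz. apply Rabs_le. unfold m. lra. }
assert (HR0 : 0 < Re (damping m z0)).
{ assert (H := re_damping_ge m z0 (Hm z0 Hz0)). assert (H' := exp_pos (Rabs (Im z0) / 2)). lra. }
assert (Hdamp : forall eps, 0 < eps -> Cmod (f z0) * exp (- eps * Re (damping m z0)) <= W).
{ intros eps He.
  pose (g := fun z => (f z * Cexp (- RtoC eps * damping m z))%C).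
  assert (Hg : forall z, Cmod (g z) = Cmod (f z) * exp (- eps * Re (damping m z))).
  { intros z. unfold g. rewrite Cmod_mult, Cmod_Cexp. do 2 f_equal.
    rewrite <- RtoC_opp. apply re_scal_l. }
  rewrite <- Hg.
  set (c := Rabs a + Rabs b + 1).
  assert (Hc : 1 <= c) by (unfold c; assert (H := Rabs_pos a); assert (H' := Rabs_pos b); lra).
  destruct (Rpower_le_exp_half rho c (B - ln W) (eps / 2) Hr ltac:(lra) ltac:(lra)) as [N0 HN0].
  set (N := Rmax (Rmax N0 r0) (Rabs (Im z0)) + 1).
  assert (HN1 : N0 <= N) by (unfold N; assert (H := Rmax_l (Rmax N0 r0) (Rabs (Im z0)));
    assert (H' := Rmax_l N0 r0); lra).
  assert (HN2 : r0 <= N) by (unfold N; assert (H := Rmax_l (Rmax N0 r0) (Rabs (Im z0)));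
    assert (H' := Rmax_r N0 r0); lra).
  assert (HN3 : Rabs (Im z0) <= N) by (unfold N; assert (H := Rmax_r (Rmax N0 r0) (Rabs (Im z0))); lra).
  assert (HN4 : 0 < N).
  { unfold N; assert (H := Rmax_r (Rmax N0 r0) (Rabs (Im z0))); assert (H' := Rabs_pos (Im z0)); lra. }
  assert (HN3' := HN3). apply Rabs_le_between in HN3'.
  apply (maximum_modulus_rectangle g a b (- N) N); try lra.
  - intros z Hz _. destruct (Hf z Hz) as [l Hl]. destruct (cderiv_damping m eps z) as [l' Hl'].
    eexists. apply cderiv_mult; eassumption.
  - intros z Hz1 Hz2 Hedge. rewrite Hg.
    assert (Hd := re_damping_ge m z (Hm z Hz1)).
    assert (He0 := exp_pos (Rabs (Im z) / 2)).
    assert (Hside : Re z = a \/ Re z = b -> Cmod (f z) * exp (- eps * Re (damping m z)) <= W).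
    { intros Hs. apply Rle_trans with (2 := Hb z Hs).
      assert (exp (- eps * Re (damping m z)) <= 1).
      { rewrite <- exp_0. apply exp_le_compat. nra. }
      assert (H0 := Cmod_ge_0 (f z)). nra. }
    destruct (classic (Re z = a \/ Re z = b)) as [Hs|Hs]; [now apply Hside|].
    assert (HI : Rabs (Im z) = N).
    { destruct Hedge as [E|[E|[E|E]]]; [tauto|tauto| |]; rewrite E.
      - rewrite Rabs_Ropp. apply Rabs_pos_eq; lra.
      - apply Rabs_pos_eq; lra. }
    assert (Hzr : r0 <= Cmod z) by (assert (H := im_le_Cmod z); lra).
    assert (Hzp : 0 < Cmod z) by (assert (H := im_le_Cmod z); lra).
    assert (Hzc : Cmod z <= N + c).
    { eapply Rle_trans; [apply Cmod_le_re_im|]. rewrite HI.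
      assert (Rabs (Re z) <= c); [|lra]. unfold c. apply Rabs_le.
      assert (H1 := Rle_abs b). assert (H2 := Rle_abs (- a)). rewrite Rabs_Ropp in H2.
      assert (H3 := Rabs_pos a). assert (H4 := Rabs_pos b). lra. }
    assert (Hrp : Rpower (Cmod z) rho <= Rpower (N + c) rho) by (apply Rle_Rpower_l; lra).
    specialize (HN0 N ltac:(lra) HN1). rewrite HI in Hd.
    apply Rle_trans with (exp (Rpower (Cmod z) rho + B) * exp (- eps * Re (damping m z))).
    + apply Rmult_le_compat_r; [left; apply exp_pos|now apply Hgrow].
    + rewrite <- exp_plus. apply Rle_trans with (exp (ln W)); [|right; now apply exp_ln].
      apply exp_le_compat.
      assert (eps * (exp (N / 2) / 2) <= eps * Re (damping m z)) by (apply Rmult_le_compat_l; lra).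
      lra. }
apply Rnot_lt_le. intros Hlt.
set (R0 := Re (damping m z0)) in *.
assert (Hq : 1 < Cmod (f z0) / W).
{ apply Rmult_lt_reg_r with W; [assumption|]. unfold Rdiv. rewrite Rmult_assoc, Rinv_l by lra. lra. }
assert (Hlq : 0 < ln (Cmod (f z0) / W)) by (rewrite <- ln_1; apply ln_increasing; lra).
(* With this [eps] the damping at [z0] costs exactly the square root of [|f z0| / W], which leaves a
   factor still greater than 1. *)
specialize (Hdamp (ln (Cmod (f z0) / W) / (2 * R0)) ltac:(apply Rdiv_lt_0_compat; lra)).
replace (- (ln (Cmod (f z0) / W) / (2 * R0)) * R0) with (- (ln (Cmod (f z0) / W) / 2)) in Hdamp
  by (field; lra).
set (q := ln (Cmod (f z0) / W)) in *.
assert (E : Cmod (f z0) = W * exp q) by (unfold q; rewrite exp_ln by lra; field; lra).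
rewrite E, Rmult_assoc, <- exp_plus in Hdamp.
assert (Hgt : 1 < exp (q + - (q / 2))) by (rewrite <- exp_0; apply exp_increasing; lra).
nra.
Qed.

(** * Transfer through the functional equation *)

Lemma Rpower_pos (x y : R) : 0 < Rpower x y.
Proof. apply exp_pos. Qed.

Lemma Rpower_ge_1 (x y : R) : 1 <= x -> 0 <= y -> 1 <= Rpower x y.
Proof.
intros Hx Hy. unfold Rpower. rewrite <- exp_0. apply exp_le_compat.
apply Rmult_le_pos; [assumption|]. rewrite <- ln_1. apply ln_mono; lra.
Qed.

(* [1 + delta + it] is [1 - conj s] for [s = - delta + it]. *)
Lemma gamma_factor_ratio (lambda : R) (mu : C) : 0 < lambda ->
  exists K T, 0 < K /\ 1 <= T /\ forall delta t, 0 < delta <= 1 -> T <= Rabs t ->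
    Im (RtoC lambda * ((- delta)%R, t) + mu)%C <> 0 /\
    CGamma (RtoC lambda * ((- delta)%R, t) + mu) <> 0%C /\
    Cmod (CGamma (RtoC lambda * ((1 + delta)%R, t) + mu)) <=
      K * Rpower (1 + Rabs t) (lambda * (1 + 2 * delta)) * Cmod (CGamma (RtoC lambda * ((- delta)%R, t) + mu)).
Proof.
intros Hl.
assert (HRm := Rabs_pos (Re mu)). assert (HIm := Rabs_pos (Im mu)). assert (Hmu := Cmod_ge_0 mu).
destruct (gamma_ratio (lambda + Rabs (Re mu)) (3 * lambda) ltac:(lra) ltac:(lra)) as (K & Y & HK & HY & H).
set (B := lambda + Cmod mu + 1).
exists (K * Rpower B (3 * lambda)), (1 + (Y + Rabs (Im mu)) / lambda).
assert (Hq : 0 <= (Y + Rabs (Im mu)) / lambda) by (apply Rdiv_le_0_compat; lra).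
split; [apply Rmult_lt_0_compat; [assumption|apply Rpower_pos]|]. split; [lra|].
intros delta t Hd Ht.
set (z := (RtoC lambda * ((- delta)%R, t) + mu)%C).
assert (HRz : Re z = - (lambda * delta) + Re mu).
{ unfold z. rewrite re_plus, re_scal_l. unfold Re at 1; simpl. ring. }
assert (HIz : Im z = lambda * t + Im mu).
{ unfold z. rewrite im_plus, im_scal_l. unfold Im at 1; simpl. ring. }
assert (Hlt : Y + Rabs (Im mu) <= lambda * Rabs t).
{ replace (Y + Rabs (Im mu)) with (lambda * ((Y + Rabs (Im mu)) / lambda)) by (field; lra).
  apply Rmult_le_compat_l; lra. }
assert (HIz2 : Y <= Rabs (Im z)).
{ rewrite HIz. assert (T1 := Rabs_triang_inv (lambda * t) (- Im mu)).
  rewrite Rabs_Ropp, Rabs_mult, (Rabs_pos_eq lambda) in T1 by lra.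
  replace (lambda * t - - Im mu) with (lambda * t + Im mu) in T1 by ring. lra. }
assert (HRz2 : Rabs (Re z) <= lambda + Rabs (Re mu)).
{ rewrite HRz. eapply Rle_trans; [apply Rabs_triang|].
  rewrite Rabs_Ropp, Rabs_pos_eq by nra. nra. }
destruct (H z (lambda * (1 + 2 * delta)) HRz2 HIz2) as [H1 H2]; [nra|].
split; [intros E; rewrite E, Rabs_R0 in HIz2; lra|]. split; [exact H1|].
replace (RtoC lambda * ((1 + delta)%R, t) + mu)%C with (z + RtoC (lambda * (1 + 2 * delta)))%C.
2:{ unfold z. apply Ceq_ext; unfold Re, Im; simpl; ring. }
apply Rle_trans with (1 := H2). apply Rmult_le_compat_r; [apply Cmod_ge_0|].
rewrite Rmult_assoc. apply Rmult_le_compat_l; [lra|].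
assert (Hz1 : 1 <= Cmod z) by (assert (T1 := im_le_Cmod z); lra).
assert (Htp := Rabs_pos t).
assert (HzB : Cmod z <= B * (1 + Rabs t)).
{ unfold z. eapply Rle_trans; [apply Cmod_triangle|].
  rewrite Cmod_mult, Cmod_R, Rabs_pos_eq by lra.
  assert (Hs : Cmod ((- delta)%R, t) <= 1 + Rabs t).
  { eapply Rle_trans; [apply Cmod_le_re_im|]. unfold Re, Im; simpl.
    rewrite Rabs_Ropp, Rabs_pos_eq by lra. lra. }
  unfold B. assert (H0 := Cmod_ge_0 ((- delta)%R, t)). nra. }
apply Rle_trans with (Rpower (B * (1 + Rabs t)) (lambda * (1 + 2 * delta))).
- apply Rle_Rpower_l; [nra|lra].
- rewrite <- Rpower_mult_distr by (unfold B; lra).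
  apply Rmult_le_compat_r; [left; apply Rpower_pos|]. apply Rle_Rpower; [unfold B; lra|nra].
Qed.

(** The conclusion on imaginary parts keeps all arguments off the poles of Gamma, which the
    functional equation demands at both points; the non-vanishing allows division by the Gamma
    factors on the left line. *)
Lemma gamma_product_ratio (f : nat) (lambda : nat -> R) (mu : nat -> C) :
  (forall j, (1 <= j <= f)%nat -> 0 < lambda j) ->
  exists K T, 0 < K /\ 1 <= T /\ forall delta t, 0 < delta <= 1 -> T <= Rabs t ->
    (forall j, (1 <= j <= f)%nat -> Im (RtoC (lambda j) * ((- delta)%R, t) + mu j)%C <> 0) /\
    Cprod (fun j => CGamma (RtoC (lambda j) * ((- delta)%R, t) + mu j)) f <> 0%C /\
    Cmod (Cprod (fun j => CGamma (RtoC (lambda j) * ((1 + delta)%R, t) + mu j)) f) <=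
      K * Rpower (1 + Rabs t) (sum_n_m lambda 1 f * (1 + 2 * delta))
        * Cmod (Cprod (fun j => CGamma (RtoC (lambda j) * ((- delta)%R, t) + mu j)) f).
Proof.
induction f as [|f IH]; intros Hl.
- exists 1, 1. split; [lra|]. split; [lra|]. intros delta t Hd Ht.
  split; [intros; lia|]. split; [apply C1_nz|].
  rewrite sum_n_m_zero by lia. simpl. rewrite Rmult_0_l. unfold Rpower. rewrite Rmult_0_l, exp_0. lra.
- destruct IH as (K1 & T1 & HK1 & HT1 & H1); [intros; apply Hl; lia|].
  destruct (gamma_factor_ratio (lambda (S f)) (mu (S f))) as (K2 & T2 & HK2 & HT2 & H2); [apply Hl; lia|].
  exists (K1 * K2), (Rmax T1 T2).
  split; [now apply Rmult_lt_0_compat|]. split; [apply Rle_trans with (1 := HT1), Rmax_l|].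
  intros delta t Hd Ht.
  destruct (H1 delta t Hd (Rle_trans _ _ _ (Rmax_l _ _) Ht)) as (A1 & A2 & A3).
  destruct (H2 delta t Hd (Rle_trans _ _ _ (Rmax_r _ _) Ht)) as (B1 & B2 & B3).
  split; [|split].
  + intros j Hj. destruct (Nat.eq_dec j (S f)) as [->|E]; [assumption|]. apply A1. lia.
  + cbn [Cprod]. now apply Cmult_neq_0.
  + cbn [Cprod]. rewrite !Cmod_mult, sum_n_Sm by lia.
    change (plus (sum_n_m lambda 1 f) (lambda (S f))) with (sum_n_m lambda 1 f + lambda (S f)).
    rewrite Rmult_plus_distr_r, Rpower_plus.
    eapply Rle_trans; [apply Rmult_le_compat; [apply Cmod_ge_0|apply Cmod_ge_0|exact A3|exact B3]|].
    right. ring.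
Qed.

Lemma lfun_right_bound_delta (L : selbergSP) (s : C) (delta : R) : 0 < delta <= 1 ->
  1 + delta <= Re s -> Cmod (L s) <= (2 / delta) ^ order L.
Proof.
intros Hd Hs. apply Rle_trans with (1 := lfun_right_bound L s ltac:(lra)).
apply pow_incr. split; [apply Rdiv_le_0_compat; lra|].
replace (Re s / (Re s - 1)) with (1 + / (Re s - 1)) by (field; lra).
apply Rle_trans with (1 + / delta).
- apply Rplus_le_compat_l. apply Rinv_le_contravar; lra.
- assert (1 <= / delta) by (rewrite <- Rinv_1; apply Rinv_le_contravar; lra).
  unfold Rdiv. lra.
Qed.

Lemma lfun_left_line_bound (L : selbergSP) :
  exists K T, 0 < K /\ 1 <= T /\ forall delta t, 0 < delta <= 1 -> T <= Rabs t ->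
    Cmod (L (- delta, t)) <=
      K * (2 / delta) ^ order L * Rpower (1 + Rabs t) (degree L / 2 * (1 + 2 * delta)).
Proof.
destruct (gamma_product_ratio (fe_size L) (fe_lambda L) (fe_mu L) (fe_lambda_pos L))
  as (K & T & HK & HT & H).
(* The powers of [Q] on the two sides leave [Q^(1 + 2 delta)], and [1 + 2 delta <= 3]. *)
exists (K * exp (3 * Rabs (ln (fe_Q L)))), T.
split; [apply Rmult_lt_0_compat; [assumption|apply exp_pos]|]. split; [assumption|].
intros delta t Hd Ht. destruct (H delta t Hd Ht) as (H1 & H2 & H3).
set (s := ((- delta)%R, t) : C) in *. set (s' := ((1 + delta)%R, t) : C) in *.
assert (Hs' : (1 - Cconj s)%C = s') by (apply Ceq_ext; unfold s, s', Cconj, Re, Im; simpl; ring).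
assert (Hreg : completed_regular (fe_size L) (fe_lambda L) (fe_mu L) s).
{ split.
  - intros E. apply (f_equal Re) in E. rewrite re_RtoC in E. unfold s, Re in E; simpl in E. lra.
  - intros j Hj [n En]. apply (H1 j Hj). rewrite En. apply im_RtoC. }
assert (Hreg' : completed_regular (fe_size L) (fe_lambda L) (fe_mu L) (1 - Cconj s)).
{ rewrite Hs'. split.
  - intros E. apply (f_equal Re) in E. rewrite re_RtoC in E. unfold s', Re in E; simpl in E. lra.
  - intros j Hj [n En]. apply (H1 j Hj). apply (f_equal Im) in En.
    rewrite im_RtoC, im_plus, im_scal_l in En. rewrite im_plus, im_scal_l. exact En. }
assert (HFE := lfun_equation L s Hreg Hreg').
apply (f_equal Cmod) in HFE. rewrite Hs' in HFE. unfold completed in HFE.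
rewrite (Cmod_mult (fe_omega L)), Cmod_conj, (fe_omega_unit L), Rmult_1_l in HFE.
rewrite !Cmod_mult in HFE.
set (G := Cmod (Cprod (fun j => CGamma (RtoC (fe_lambda L j) * s + fe_mu L j)) (fe_size L))) in *.
set (G' := Cmod (Cprod (fun j => CGamma (RtoC (fe_lambda L j) * s' + fe_mu L j)) (fe_size L))) in *.
assert (HG : 0 < G) by now apply Cmod_gt_0.
assert (HQ : forall z, Cmod (RCpow (fe_Q L) z) = exp (Re z * ln (fe_Q L))).
{ intros z. unfold RCpow. rewrite Cmod_Cexp. f_equal. apply re_scal_r. }
rewrite !HQ in HFE. change (Re s) with (- delta) in HFE. change (Re s') with (1 + delta) in HFE.
set (q := ln (fe_Q L)) in *.
assert (HL' := lfun_right_bound_delta L s' delta Hd ltac:(unfold s', Re; simpl; lra)).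
assert (HEq : Cmod (L s) * G = Cmod (L s') * exp ((1 + 2 * delta) * q) * G').
{ replace ((1 + 2 * delta) * q) with ((1 + delta) * q + - (- delta * q)) by ring.
  rewrite exp_plus, exp_Ropp. assert (Hp := exp_pos (- delta * q)).
  transitivity (Cmod (L s) * exp (- delta * q) * G * / exp (- delta * q)); [field; lra|].
  rewrite HFE. field. lra. }
replace (degree L / 2 * (1 + 2 * delta)) with (sum_n_m (fe_lambda L) 1 (fe_size L) * (1 + 2 * delta))
  by (unfold degree; field).
set (P := Rpower (1 + Rabs t) (sum_n_m (fe_lambda L) 1 (fe_size L) * (1 + 2 * delta))) in *.
assert (HP : 0 < P) by apply Rpower_pos.
assert (Hqe : exp ((1 + 2 * delta) * q) <= exp (3 * Rabs q)).
{ apply exp_le_compat. assert (Hq := Rle_abs q). assert (Hq0 := Rabs_pos q). nra. }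
assert (Hpd : 0 <= (2 / delta) ^ order L) by (apply pow_le, Rdiv_le_0_compat; lra).
apply Rmult_le_reg_r with G; [assumption|]. rewrite HEq.
apply Rle_trans with ((2 / delta) ^ order L * exp (3 * Rabs q) * (K * P * G)).
- apply Rmult_le_compat; [|apply Cmod_ge_0| |exact H3].
  + apply Rmult_le_pos; [apply Cmod_ge_0|left; apply exp_pos].
  + apply Rmult_le_compat; [apply Cmod_ge_0|left; apply exp_pos|assumption|assumption].
- right. ring.
Qed.

(** * Interpolation between the two vertical lines *)

Lemma continuous_bounded_rectangle (f : C -> C) (a b c d : R) : a <= b -> c <= d ->
  (forall z, a <= Re z <= b -> c <= Im z <= d -> ccont f z) ->
  exists M, 0 <= M /\ forall z, a <= Re z <= b -> c <= Im z <= d -> Cmod (f z) <= M.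
Proof.
intros Hab Hcd Hf.
destruct (usc_attains_max (fun z => a <= Re z <= b /\ c <= Im z <= d) (fun z => Cmod (f z)) a b c d)
  as [u [_ Hu]]; try assumption.
- exists (a, c). unfold Re, Im; simpl. lra.
- intros z Hz. exact Hz.
- intros w Hw.
  destruct (rectangle_complement_open a b c d w Hw) as [e [He HE]]. exists e. split; [assumption|].
  intros v H1 H2 Hin. apply Rabs_def2 in H1. apply Rabs_def2 in H2. unfold Re, Im in *. lra.
- intros z [Hz1 Hz2] eps He. destruct (Hf z Hz1 Hz2 eps He) as [e [He' H]].
  exists (e / 2). split; [lra|]. intros w _ H1 H2.
  specialize (H w ltac:(assert (H' := Cmod_lt_box _ _ _ H1 H2); lra)).
  assert (H' := Cmod_triangle_rev (f w) (f z)). lra.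
- exists (Cmod (f u)). split; [apply Cmod_ge_0|]. intros z Hz1 Hz2. now apply Hu.
Qed.

Lemma Cmod_minus1_le_plus3 (s : C) : - 1 <= Re s -> Cmod (s - 1) <= Cmod (s + 3).
Proof.
intros Hs. unfold Cmod. apply sqrt_le_1_alt. unfold Re in Hs. simpl. nra.
Qed.

Lemma plus3_neq0 (s : C) : - 1 <= Re s -> 1 <= Cmod (s + 3) /\ (s + 3)%C <> 0%C.
Proof.
intros Hs. assert (H : 1 <= Cmod (s + 3)).
{ assert (T := re_le_Cmod (s + 3)). rewrite re_plus, re_RtoC in T.
  assert (T' := Rle_abs (Re s + 3)). lra. }
split; [assumption|]. apply Cmod_gt_0. lra.
Qed.

Lemma gaussian_polynomial_bound (beta v : R) : 0 <= v -> 0 <= beta ->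
  Rpower (2 + v) beta * exp (- v ^ 2) <= exp (beta + beta ^ 2 / 4).
Proof.
intros Hv Hb. unfold Rpower. rewrite <- exp_plus. apply exp_le_compat.
assert (H := ln_le_self (2 + v) ltac:(lra)).
assert (H1 : beta * ln (2 + v) <= beta * (1 + v)) by (apply Rmult_le_compat_l; lra).
assert (H2 := pow2_ge_0 (beta / 2 - v)). simpl in *. lra.
Qed.

Lemma convexity_bound (L : selbergSP) :
  exists K, 1 <= K /\ forall s, 4 <= Rabs (Im s) -> 1 / 2 <= Re s ->
    Cmod (L s) <= K * ln (Rabs (Im s)) ^ order L * Rpower (Rabs (Im s)) (degree L / 4).
Proof.
destruct (lfun_left_line_bound L) as (K1 & T1 & HK1 & HT1 & Hleft).
destruct (lfun_continuation L) as (k & F & HF & (rho0 & r0 & Hr0 & Hord) & HFL).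
assert (HFd : forall z, exists l, cderiv F z l) by (intros z; apply Cdifferentiable_cderiv, HF).
(* [G] is [((s - 1) / (s + 3))^k L(s)]: the possible pole at 1 is gone, no pole is created in
   [Re s >= - 1], and [|G| <= |L|] there because 1 is nearer than -3. Multiplying by [(s - 1)^k]
   alone would have cost a power of [t]. *)
pose (G := fun s => (F s * / (s + 3) ^ k)%C).
assert (HGd : forall z, - 1 <= Re z -> exists l, cderiv G z l).
{ intros z Hz. destruct (HFd z) as [l Hl].
  destruct (cderiv_pow (fun s => s + 3)%C z (1 + 0)%C k) as [l' Hl'].
  { apply cderiv_plus; [apply cderiv_id|apply cderiv_const]. }
  eexists. apply cderiv_mult; [exact Hl|]. apply cderiv_inv; [exact Hl'|].
  apply Cpow_nz. now apply plus3_neq0. }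
destruct (continuous_bounded_rectangle G (- 1) 0 (- T1) T1) as [M [HM HGM]]; [lra|lra| |].
{ intros z Hz _. destruct (HGd z ltac:(lra)) as [l Hl]. eapply cderiv_ccont, Hl. }
assert (HGL : forall s, - 1 <= Re s -> s <> RtoC 1 -> Cmod (G s) <= Cmod (L s)).
{ intros s Hs Hs1. unfold G. destruct (plus3_neq0 s Hs) as [P1 P2].
  rewrite HFL by now left.
  rewrite !Cmod_mult, Cmod_inv, !Cmod_pow by now apply Cpow_nz.
  assert (Hle : Cmod (s - 1) ^ k <= Cmod (s + 3) ^ k).
  { apply pow_incr. split; [apply Cmod_ge_0|now apply Cmod_minus1_le_plus3]. }
  assert (Hp : 0 < Cmod (s + 3) ^ k) by (apply pow_lt; lra).
  apply Rmult_le_reg_r with (Cmod (s + 3) ^ k); [assumption|].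
  rewrite Rmult_assoc, Rinv_l, Rmult_1_r by lra. rewrite Rmult_comm.
  apply Rmult_le_compat_l; [apply Cmod_ge_0|assumption]. }
set (d := degree L) in *. assert (Hd : 0 <= d) by apply degree_ge0.
set (m := order L) in *.
set (beta := 3 * d / 2).
assert (Hbeta : 0 <= beta) by (unfold beta; lra).
set (K2 := K1 + M + 1).
(* [d / 2] is the price of the margin [delta], as [t0^(delta d / 2) = exp (d / 2)]; 9 bounds the
   squared horizontal distance in the Gaussian; the rest bounds [(2 + v)^beta exp (- v^2)]. In [K2],
   [K1] serves high up on the left line, [M] near the real axis, and 1 the right line. *)
set (W0 := K2 * exp (d / 2 + 9 + (beta + beta ^ 2 / 4))).
assert (Hbb : 0 <= beta + beta ^ 2 / 4) by (assert (H := pow2_ge_0 beta); lra).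
assert (HW0 : K2 <= W0).
{ unfold W0. assert (H := exp_ineq1_le (d / 2 + 9 + (beta + beta ^ 2 / 4))). unfold K2 in *. nra. }
exists (2 ^ k * W0 * 2 ^ m).
assert (H2k : 1 <= 2 ^ k) by (apply pow_R1_Rle; lra).
assert (H2m : 1 <= 2 ^ m) by (apply pow_R1_Rle; lra).
assert (HW1 : 1 <= W0) by (unfold K2 in *; lra).
assert (H2kW : 1 <= 2 ^ k * W0) by nra.
split; [nra|].
intros s0 Ht0 Hs0. set (t0 := Rabs (Im s0)) in *.
assert (Hln : 1 <= ln t0).
{ rewrite <- (ln_exp 1). apply ln_mono; [apply exp_pos|]. assert (H := exp_le_3). lra. }
set (delta := / ln t0).
assert (Hdelta : 0 < delta <= 1).
{ unfold delta. split; [apply Rinv_0_lt_compat; lra|]. rewrite <- Rinv_1. apply Rinv_le_contravar; lra. }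
assert (Hdl : delta * ln t0 = 1) by (unfold delta; field; lra).
assert (H2d : (2 / delta) ^ m = 2 ^ m * ln t0 ^ m).
{ rewrite <- Rpow_mult_distr. f_equal. unfold delta. field. lra. }
assert (Hlnm : 1 <= ln t0 ^ m) by (apply pow_R1_Rle; lra).
assert (Ht04 : 1 <= Rpower t0 (d / 4)).
{ apply Rpower_ge_1; lra. }
destruct (Rle_dec (1 + delta) (Re s0)) as [Hright|Hright].
{ apply Rle_trans with (1 := lfun_right_bound_delta L s0 delta Hdelta Hright). fold m. rewrite H2d.
  replace (2 ^ k * W0 * 2 ^ m * ln t0 ^ m * Rpower t0 (d / 4))
    with ((2 ^ m * ln t0 ^ m) * (2 ^ k * W0 * Rpower t0 (d / 4))) by ring.
  rewrite <- (Rmult_1_r (2 ^ m * ln t0 ^ m)) at 1. apply Rmult_le_compat_l; [nra|].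
  assert (1 <= 2 ^ k * W0) by nra. nra. }
(* The slope that equalizes the two lines: [exp (xi (Re s - 1/2))] turns [t0^(d (1 + 2 delta) / 2)]
   on the left and 1 on the right into the same [t0^(d (1/2 + delta) / 2)]. *)
set (xi := d / 2 * ln t0).
assert (Hxi : 0 <= xi) by (unfold xi; nra).
set (W := W0 * (2 / delta) ^ m * Rpower t0 (d / 4)).
assert (Hdm : 1 <= (2 / delta) ^ m) by (rewrite H2d; nra).
assert (HW : 0 < W).
{ unfold W. apply Rmult_lt_0_compat; [nra|lra]. }
(* The Gaussian localizes the estimate at height [t0]: at vertical distance [v] the left line costs
   only an extra [(2 + v)^beta], absorbed by [exp (- v^2)]. The bound thus depends on [t0] and not
   on the height of the boundary point. *)
pose (Phi := fun s => (G s * Cexp (RtoC xi * (s - RtoC (1 / 2))) * Cexp ((s - s0) * (s - s0)))%C).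
assert (HPhi : forall s, Cmod (Phi s) =
  Cmod (G s) * exp (xi * (Re s - 1 / 2) + ((Re s - Re s0) ^ 2 - (Im s - Im s0) ^ 2))).
{ intros s. unfold Phi. rewrite !Cmod_mult, Cmod_gaussian, Cmod_Cexp, Rmult_assoc, <- exp_plus.
  do 3 f_equal. rewrite re_scal_l. unfold Cminus. rewrite re_plus, re_opp, re_RtoC. ring. }
assert (Ht0ln : exp (ln t0) = t0) by (apply exp_ln; lra).
assert (Hmid : exp (xi * (1 / 2 + delta)) = Rpower t0 (d / 4) * exp (d / 2)).
{ unfold Rpower. rewrite <- exp_plus. f_equal. unfold xi.
  replace (d / 2 * ln t0 * (1 / 2 + delta)) with (d / 4 * ln t0 + d / 2 * (delta * ln t0)) by field.
  rewrite Hdl. ring. }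
assert (Hbound : forall s, - delta <= Re s <= 1 + delta -> Cmod (Phi s) <= W).
{ apply (phragmen_lindelof Phi (- delta) (1 + delta) (Rmax r0 1) (Rmax rho0 1) (xi * (3 / 2) + 9) W).
  - lra.
  - assert (H := Rmax_r rho0 1). lra.
  - assumption.
  - intros z Hz. destruct (HGd z ltac:(lra)) as [l Hl].
    destruct (cderiv_Cexp_affine (RtoC xi) (RtoC (1 / 2)) z) as [l1 Hl1].
    destruct (cderiv_gaussian s0 z) as [l2 Hl2].
    eexists. unfold Phi. apply cderiv_mult; [apply cderiv_mult|]; eassumption.
  - intros z Hz Hzr. rewrite HPhi.
    assert (Hz1 := Rle_trans _ _ _ (Rmax_l r0 1) Hzr). assert (Hz2 := Rle_trans _ _ _ (Rmax_r r0 1) Hzr).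
    assert (HGz : Cmod (G z) <= exp (Rpower (Cmod z) (Rmax rho0 1))).
    { unfold G. destruct (plus3_neq0 z ltac:(lra)) as [P1 P2].
      rewrite Cmod_mult, Cmod_inv, Cmod_pow by now apply Cpow_nz.
      assert (Hp : 1 <= Cmod (z + 3) ^ k) by now apply pow_R1_Rle.
      assert (Hip : / Cmod (z + 3) ^ k <= 1) by (rewrite <- Rinv_1; apply Rinv_le_contravar; lra).
      apply Rle_trans with (Cmod (F z)).
      - assert (H0 := Cmod_ge_0 (F z)). nra.
      - apply Rle_trans with (1 := Hord z Hz1). apply exp_le_compat.
        apply Rle_Rpower; [lra|apply Rmax_l]. }
    rewrite (exp_plus (Rpower _ _)). apply Rmult_le_compat; [apply Cmod_ge_0|left; apply exp_pos|assumption|].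
    apply exp_le_compat. assert (H0 := pow2_ge_0 (Im z - Im s0)).
    assert (Hre : (Re z - Re s0) ^ 2 <= 3 ^ 2) by (apply pow_maj_Rabs, Rabs_le; lra).
    nra.
  - intros z Hz. rewrite HPhi. unfold W.
    assert (Hq0 := pow2_ge_0 (Im z - Im s0)).
    assert (Hre : (Re z - Re s0) ^ 2 <= 3 ^ 2) by (apply pow_maj_Rabs, Rabs_le; lra).
    assert (Hpm : 0 < (2 / delta) ^ m) by lra.
    destruct Hz as [Hz|Hz].
    + set (v := Rabs (Im z - Im s0)).
      assert (Hv : 0 <= v) by apply Rabs_pos.
      assert (Hv2 : (Im z - Im s0) ^ 2 = v ^ 2) by (unfold v; now rewrite pow2_abs).
      assert (HGz : Cmod (G z) <=
        K2 * (2 / delta) ^ m * Rpower (1 + Rabs (Im z)) (d / 2 * (1 + 2 * delta))).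
      { assert (Hzp := Rabs_pos (Im z)).
        assert (Hrp : 1 <= Rpower (1 + Rabs (Im z)) (d / 2 * (1 + 2 * delta))).
        { apply Rpower_ge_1; [lra|]. nra. }
        set (R1 := Rpower (1 + Rabs (Im z)) (d / 2 * (1 + 2 * delta))) in *.
        assert (HPR : 1 <= (2 / delta) ^ m * R1) by nra.
        rewrite Rmult_assoc.
        destruct (Rle_dec T1 (Rabs (Im z))) as [Hb|Hb].
        - assert (Hzz : z = ((- delta)%R, Im z)) by (apply Ceq_ext; [exact Hz|reflexivity]).
          assert (H := Hleft delta (Im z) Hdelta Hb). rewrite <- Hzz in H. fold R1 in H.
          apply Rle_trans with (Cmod (L z)).
          + apply HGL; [lra|]. intros E. apply (f_equal Re) in E. rewrite re_RtoC in E. lra.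
          + apply Rle_trans with (1 := H). rewrite Rmult_assoc.
            apply Rmult_le_compat_r; [lra|unfold K2; lra].
        - assert (Hzi : - T1 <= Im z <= T1) by (apply Rabs_le_between; lra).
          assert (H := HGM z ltac:(lra) Hzi).
          apply Rle_trans with (1 := H). unfold K2. nra. }
      assert (Hgrow : Rpower (1 + Rabs (Im z)) (d / 2 * (1 + 2 * delta)) <=
        exp (xi * (1 + 2 * delta)) * Rpower (2 + v) beta).
      { assert (Hzt : Rabs (Im z) <= t0 + v).
        { unfold t0, v. replace (Im z) with (Im s0 + (Im z - Im s0)) at 1 by ring. apply Rabs_triang. }
        assert (Hzp := Rabs_pos (Im z)).
        apply Rle_trans with (Rpower (t0 * (2 + v)) (d / 2 * (1 + 2 * delta))).
        - apply Rle_Rpower_l; [nra|]. split; [lra|nra].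
        - rewrite <- Rpower_mult_distr by lra.
          apply Rmult_le_compat; [left; apply Rpower_pos|left; apply Rpower_pos| |].
          + right. unfold Rpower, xi. f_equal. ring.
          + apply Rle_Rpower; [lra|]. unfold beta. nra. }
      rewrite Hz, Hv2.
      apply Rle_trans with (K2 * (2 / delta) ^ m * (exp (xi * (1 + 2 * delta)) * Rpower (2 + v) beta)
        * exp (xi * (- delta - 1 / 2) + ((- delta - Re s0) ^ 2 - v ^ 2))).
      * apply Rmult_le_compat_r; [left; apply exp_pos|]. apply Rle_trans with (1 := HGz).
        apply Rmult_le_compat_l; [|assumption]. unfold K2. nra.
      * replace (exp (xi * (- delta - 1 / 2) + ((- delta - Re s0) ^ 2 - v ^ 2)))
          with (exp (xi * (- delta - 1 / 2)) * exp ((- delta - Re s0) ^ 2) * exp (- v ^ 2))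
          by (rewrite <- !exp_plus; f_equal; ring).
        assert (E1 : exp (xi * (1 + 2 * delta)) * exp (xi * (- delta - 1 / 2))
          = Rpower t0 (d / 4) * exp (d / 2)).
        { rewrite <- exp_plus, <- Hmid. f_equal. field. }
        assert (E2 := gaussian_polynomial_bound beta v Hv Hbeta).
        assert (E3 : exp ((- delta - Re s0) ^ 2) <= exp 9).
        { apply exp_le_compat. rewrite <- Hz. lra. }
        unfold W0. rewrite !exp_plus.
        replace (K2 * (2 / delta) ^ m * (exp (xi * (1 + 2 * delta)) * Rpower (2 + v) beta)
          * (exp (xi * (- delta - 1 / 2)) * exp ((- delta - Re s0) ^ 2) * exp (- v ^ 2)))
          with (K2 * (2 / delta) ^ m * (exp (xi * (1 + 2 * delta)) * exp (xi * (- delta - 1 / 2)))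
            * (exp ((- delta - Re s0) ^ 2) * (Rpower (2 + v) beta * exp (- v ^ 2)))) by ring.
        rewrite E1, <- !exp_plus.
        replace (K2 * exp (d / 2 + 9 + (beta + beta ^ 2 / 4)) * (2 / delta) ^ m * Rpower t0 (d / 4))
          with (K2 * (2 / delta) ^ m * (Rpower t0 (d / 4) * exp (d / 2))
            * (exp 9 * exp (beta + beta ^ 2 / 4))) by (rewrite !exp_plus; ring).
        apply Rmult_le_compat_l.
        -- apply Rmult_le_pos; [unfold K2; nra|].
           apply Rmult_le_pos; left; [apply Rpower_pos|apply exp_pos].
        -- apply Rmult_le_compat; try assumption; [left; apply exp_pos|].
           left. apply Rmult_lt_0_compat; [apply Rpower_pos|apply exp_pos].
    + assert (HGz : Cmod (G z) <= (2 / delta) ^ m).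
      { apply Rle_trans with (Cmod (L z)).
        - apply HGL; [lra|]. intros E. apply (f_equal Re) in E. rewrite re_RtoC in E. lra.
        - apply lfun_right_bound_delta; lra. }
      apply Rle_trans with ((2 / delta) ^ m * (exp (xi * (1 / 2 + delta)) * exp 9)).
      * apply Rmult_le_compat; [apply Cmod_ge_0|left; apply exp_pos|assumption|].
        rewrite <- exp_plus. apply exp_le_compat. rewrite Hz. rewrite <- Hz at 2.
        replace (1 + delta - 1 / 2) with (1 / 2 + delta) by field. lra.
      * rewrite Hmid.
        assert (E : exp (d / 2) * exp 9 <= W0).
        { unfold W0. rewrite <- exp_plus.
          apply Rle_trans with (1 * exp (d / 2 + 9 + (beta + beta ^ 2 / 4))).
          - rewrite Rmult_1_l. apply exp_le_compat. lra.
          - apply Rmult_le_compat_r; [left; apply exp_pos|unfold K2; lra]. }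
        replace ((2 / delta) ^ m * (Rpower t0 (d / 4) * exp (d / 2) * exp 9))
          with ((exp (d / 2) * exp 9) * ((2 / delta) ^ m * Rpower t0 (d / 4))) by ring.
        rewrite (Rmult_assoc W0). apply Rmult_le_compat_r; [nra|assumption]. }
assert (HG0 : Cmod (G s0) <= W).
{ assert (H := Hbound s0 ltac:(lra)). rewrite HPhi in H.
  (* At [s0] the auxiliary factors do not decrease [|G|], precisely because [Re s0 >= 1/2]. *)
  assert (H1 : 1 <= exp (xi * (Re s0 - 1 / 2) + ((Re s0 - Re s0) ^ 2 - (Im s0 - Im s0) ^ 2))).
  { apply Rle_trans with (exp 0); [rewrite exp_0; lra|]. apply exp_le_compat. rewrite !Rminus_diag.
    assert (Hpos : 0 <= xi * (Re s0 - 1 / 2)) by (apply Rmult_le_pos; lra). lra. }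
  assert (H0 := Cmod_ge_0 (G s0)). apply Rle_trans with (2 := H).
  rewrite <- (Rmult_1_r (Cmod (G s0))) at 1. apply Rmult_le_compat_l; assumption. }
assert (Him : t0 <= Cmod (s0 - 1)).
{ assert (T := im_le_Cmod (s0 - 1)). unfold Cminus in T. rewrite im_plus, im_opp, im_RtoC in T.
  replace (Im s0 + - 0) with (Im s0) in T by ring. exact T. }
assert (Hs01 : (s0 - 1)%C <> 0%C) by (apply Cmod_gt_0; lra).
assert (Hs1 : s0 <> RtoC 1) by (intros E; apply Hs01; rewrite E; ring).
(* The two points 1 and -3 are 4 apart and [|s0 - 1| >= |Im s0| >= 4]; returning from [G] to [L]
   therefore costs [2^k]. *)
assert (H3 : Cmod (s0 + 3) <= 2 * Cmod (s0 - 1)).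
{ assert (T := Cmod_triangle (s0 - 1) 4). rewrite Cmod_R, Rabs_pos_eq in T by lra.
  replace (s0 - 1 + 4)%C with (s0 + 3)%C in T by (apply Ceq_ext; unfold Re, Im; simpl; ring).
  lra. }
destruct (plus3_neq0 s0 ltac:(lra)) as [P1 P2].
assert (HLG : Cmod (L s0) <= 2 ^ k * Cmod (G s0)).
{ unfold G. rewrite HFL by now left.
  rewrite !Cmod_mult, Cmod_inv, !Cmod_pow by now apply Cpow_nz.
  assert (Hle : Cmod (s0 + 3) ^ k <= 2 ^ k * Cmod (s0 - 1) ^ k).
  { rewrite <- Rpow_mult_distr. apply pow_incr. split; [apply Cmod_ge_0|assumption]. }
  assert (Hp : 0 < Cmod (s0 + 3) ^ k) by (apply pow_lt; lra).
  apply Rmult_le_reg_r with (Cmod (s0 + 3) ^ k); [assumption|].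
  replace (2 ^ k * (Cmod (s0 - 1) ^ k * Cmod (L s0) * / Cmod (s0 + 3) ^ k) * Cmod (s0 + 3) ^ k)
    with (Cmod (L s0) * (2 ^ k * Cmod (s0 - 1) ^ k)) by (field; lra).
  apply Rmult_le_compat_l; [apply Cmod_ge_0|assumption]. }
apply Rle_trans with (1 := HLG).
replace (2 ^ k * W0 * 2 ^ m * ln t0 ^ m * Rpower t0 (d / 4)) with (2 ^ k * W)
  by (unfold W; rewrite H2d; ring).
apply Rmult_le_compat_l; lra.
Qed.

Theorem growth_bound_exists (L : selbergSP) :
  exists C0 l c T, 0 < C0 /\ 0 < l /\ 1 <= c /\ exp 1 <= T /\ growth_bound L C0 l c T.
Proof.
destruct (convexity_bound L) as [K [HK H]].
(* The exponent [l = m] of the iterated logarithm comes from [(2 / delta)^m] with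
   [delta = 1 / log |t|]. *)
exists K, (INR (order L)), 1, 4.
assert (Hm : 0 < INR (order L)) by (apply lt_0_INR, (order_pos L)).
assert (He := exp_le_3).
repeat split; try lra.
intros s Ht Hs Hne. specialize (H s Ht Hs). rewrite Rmult_1_l.
assert (Hl : 1 <= ln (Rabs (Im s))).
{ rewrite <- (ln_exp 1). apply ln_mono; [apply exp_pos|lra]. }
assert (Hp : 0 < Cmod (L s)) by now apply Cmod_gt_0.
apply ln_mono in H; [|assumption].
assert (H1 : 0 < ln (Rabs (Im s)) ^ order L) by (apply pow_lt; lra).
assert (H2 := Rpower_pos (Rabs (Im s)) (degree L / 4)).
rewrite ln_mult in H; [|nra|assumption]. rewrite ln_mult in H by lra.
rewrite ln_pow in H by lra. unfold Rpower in H. rewrite ln_exp in H.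
unfold logp. assert (HKl : ln K <= Rmax 0 (ln K)) by apply Rmax_r.
lra.
Qed.

(** * The logarithm in a zero-free region *)

Lemma inverse_height (h : R) : 10 <= h ->
  0 < 1 / h <= 1 / 10 /\ 4 / h = 4 * (1 / h) /\ 2 / h = 2 * (1 / h) /\ h * (1 / h) = 1.
Proof.
intros Hh. repeat split; try (field; lra); [apply Rdiv_lt_0_compat; lra|].
unfold Rdiv. rewrite !Rmult_1_l. apply Rinv_le_contravar; lra.
Qed.

(* Three-lines argument on a rectangle of height comparable to [h]: the factor [exp (2h(s-1))]
   balances the two vertical sides, and the Gaussian beats the growth [exp h] on the others. *)
Lemma three_lines_interpolation (g : C -> C) (t h H M : R) :
  10 <= h <= H -> 0 <= M ->
  (forall z, 1 / 2 + 1 / h <= Re z <= 1 + 4 / h -> Rabs (Im z - t) <= H ->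
     (exists l, cderiv g z l) /\ Cmod (g z) <= M * h * exp h) ->
  (forall z, Re z = 1 + 4 / h -> Rabs (Im z - t) <= H -> Cmod (g z) <= M * h) ->
  forall s, 1 / 2 + 1 / h <= Re s <= 1 + 4 / h -> Rabs (Im s - t) <= 1 ->
    Cmod (g s) <= M * h * exp 11 * exp (2 * h * (1 - Re s)).
Proof.
intros Hh HM Hg Hr s Hs1 Hs2.
destruct (inverse_height h ltac:(lra)) as (Hinv & Hinv4 & Hinv2 & Hhi).
set (e := 1 / h) in *. rewrite Hinv4 in *.
assert (HMh : 0 <= M * h) by (apply Rmult_le_pos; lra).
pose (F := fun z => (g z * Cexp (RtoC (2 * h) * (z - 1)) * Cexp ((z - s) * (z - s)))%C).
assert (HFm : forall z, Cmod (F z) =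
  Cmod (g z) * exp (2 * h * (Re z - 1) + ((Re z - Re s) ^ 2 - (Im z - Im s) ^ 2))).
{ intros z. unfold F. rewrite !Cmod_mult, Cmod_gaussian, Cmod_Cexp, Rmult_assoc, <- exp_plus.
  f_equal. f_equal. f_equal. rewrite re_scal_l. unfold Cminus. rewrite re_plus, re_opp, re_RtoC. ring. }
apply Rabs_le_between in Hs2.
assert (HFs : Cmod (F s) <= M * h * exp 11).
{ apply (maximum_modulus_rectangle F (1 / 2 + e) (1 + 4 * e) (t - H) (t + H)); try lra.
  - apply Rmult_le_pos; [assumption|left; apply exp_pos].
  - intros z Hz1 Hz2. destruct (Hg z Hz1) as [[l Hl] _]; [apply Rabs_le; lra|].
    destruct (cderiv_gaussian s z) as [l1 Hl1].
    destruct (cderiv_Cexp_affine (RtoC (2 * h)) 1 z) as [l2 Hl2].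
    eexists. unfold F. apply cderiv_mult; [apply cderiv_mult|]; eassumption.
  - intros z Hz1 Hz2 Hb. rewrite HFm.
    assert (Hz3 : Rabs (Im z - t) <= H) by (apply Rabs_le; lra).
    destruct (Hg z Hz1 Hz3) as [_ HgM].
    assert (Hd : (Re z - Re s) ^ 2 <= 1) by (simpl; nra).
    assert (Hd' : 0 <= (Im z - Im s) ^ 2) by apply pow2_ge_0.
    destruct (Req_dec (Re z) (1 + 4 * e)) as [E|E].
    + specialize (Hr z E Hz3).
      apply Rmult_le_compat; [apply Cmod_ge_0|left; apply exp_pos|assumption|].
      apply exp_le_compat. rewrite E. nra.
    (* On the left side [2h (Re z - 1) = 2 - h] cancels the growth and leaves at most 3. On the
       horizontal sides [2h (Re z - 1) <= 8], and [- (h - 1)^2] outweighs [h + 9] since [h >= 10].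
       On the right side, treated above, the exponent is at most 9. *)
    + assert (Hexp : h + (2 * h * (Re z - 1) + ((Re z - Re s) ^ 2 - (Im z - Im s) ^ 2)) <= 11).
      { destruct (Req_dec (Re z) (1 / 2 + e)) as [E'|E'].
        - rewrite E' in *. nra.
        - assert (HI : (h - 1) ^ 2 <= (Im z - Im s) ^ 2).
          { destruct Hb as [Hb|[Hb|[Hb|Hb]]]; [tauto|tauto| |]; rewrite Hb; simpl; nra. }
          simpl in *. nra. }
      apply Rle_trans with (M * h * exp h
        * exp (2 * h * (Re z - 1) + ((Re z - Re s) ^ 2 - (Im z - Im s) ^ 2))).
      * apply Rmult_le_compat_r; [left; apply exp_pos|assumption].
      * rewrite Rmult_assoc, <- exp_plus. apply Rmult_le_compat_l; [assumption|].
        now apply exp_le_compat. }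
rewrite HFm in HFs.
replace (2 * h * (Re s - 1) + ((Re s - Re s) ^ 2 - (Im s - Im s) ^ 2))
  with (- (2 * h * (1 - Re s))) in HFs by ring.
rewrite exp_Ropp in HFs. assert (Hp := exp_pos (2 * h * (1 - Re s))).
apply Rmult_le_compat_r with (r := exp (2 * h * (1 - Re s))) in HFs; [|lra].
rewrite Rmult_assoc, Rinv_l, Rmult_1_r in HFs by lra. exact HFs.
Qed.

Lemma log_branch_cderiv (L : selbergSP) (C3 c t : R) (g : C -> C) (z : C) :
  log_branch L (regionR C3 c t) g ->
  1 / 2 < Re z -> Rabs (Im z - t) < C3 * ln (ln (c * (Rabs t + 1))) + 3 -> Im z <> 0 ->
  exists l, cderiv g z l.
Proof.
intros [_ Hg] Hz1 Hz2 Hz3. apply Cdifferentiable_cderiv. apply Hg; [|tauto].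
set (B := C3 * ln (ln (c * (Rabs t + 1))) + 3) in *.
assert (He : 0 < Rmin (Re z - 1 / 2) (B - Rabs (Im z - t))) by (apply Rmin_glb_lt; lra).
exists (mkposreal _ He). intros w [Hw1 Hw2].
assert (Hw1' : Rabs (Re w - Re z) < Rmin (Re z - 1 / 2) (B - Rabs (Im z - t))) by exact Hw1.
assert (Hw2' : Rabs (Im w - Im z) < Rmin (Re z - 1 / 2) (B - Rabs (Im z - t))) by exact Hw2.
assert (H1 := Rmin_l (Re z - 1 / 2) (B - Rabs (Im z - t))).
assert (H2 := Rmin_r (Re z - 1 / 2) (B - Rabs (Im z - t))).
apply Rabs_def2 in Hw1'. split; [lra|].
replace (Im w - t) with ((Im w - Im z) + (Im z - t)) by ring.
eapply Rle_trans; [apply Rabs_triang|]. fold B. lra.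
Qed.

(* On a disc centred at [2 + iy] the identity [Cexp g = L] spreads from the half-plane of absolute
   convergence. *)
Lemma Cexp_log_branch (L : selbergSP) (C3 c t y : R) (g : C -> C) :
  log_branch L (regionR C3 c t) g ->
  Rabs (y - t) + 3 / 2 <= C3 * ln (ln (c * (Rabs t + 1))) + 3 -> 3 / 2 <= Rabs y ->
  forall z, Cmod (z - (2, y)) < 3 / 2 ->
    (exists l, cderiv g z l) /\ z <> RtoC 1 /\ Cexp (g z) = L z.
Proof.
intros Hlog Hy Hy0.
assert (Hdisc : forall z, Cmod (z - (2, y)) < 3 / 2 ->
  1 / 2 < Re z /\ Rabs (Im z - t) < C3 * ln (ln (c * (Rabs t + 1))) + 3 /\ Im z <> 0).
{ intros z Hz. apply Cmod_dist_bounds in Hz. change (Re (2, y)) with 2 in Hz. change (Im (2, y)) with y in Hz.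
  destruct Hz as [H1 H2]. apply Rabs_def2 in H1. split; [lra|]. split.
  - replace (Im z - t) with ((Im z - y) + (y - t)) by ring.
    eapply Rle_lt_trans; [apply Rabs_triang|]. lra.
  - intros E. rewrite E in H2. rewrite Rminus_0_l, Rabs_Ropp in H2. lra. }
assert (Hne1 : forall z, Cmod (z - (2, y)) < 3 / 2 -> z <> RtoC 1).
{ intros z Hz ->. destruct (Hdisc _ Hz) as (_ & _ & H). apply H. apply im_RtoC. }
assert (Hder : forall z, Cmod (z - (2, y)) < 3 / 2 -> exists l, cderiv g z l).
{ intros z Hz. destruct (Hdisc z Hz) as (H1 & H2 & H3).
  now apply (log_branch_cderiv L C3 c t). }
assert (Hid : forall z, Cmod (z - (2, y)) < 3 / 2 -> (L z * Cexp (- g z) - 1)%C = 0%C).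
{ apply (identity_theorem_disc (fun z => L z * Cexp (- g z) - 1)%C (2, y) (3 / 2) 1); [lra| |].
  - intros z Hz. destruct (Hder z Hz) as [l Hl].
    destruct (lfun_cderiv L z (Hne1 z Hz)) as [l' Hl'].
    eexists. apply cderiv_minus; [|apply cderiv_const].
    apply cderiv_mult; [exact Hl'|].
    apply (cderiv_comp Cexp); [apply cderiv_opp, Hl|apply cderiv_Cexp].
  - intros z Hz. destruct (Hdisc z ltac:(lra)) as (H1 & H2 & H3).
    apply Cmod_dist_bounds in Hz. change (Re (2, y)) with 2 in Hz.
    destruct Hz as [Hz _]. apply Rabs_def2 in Hz.
    assert (HRe : 1 < Re z) by lra.
    destruct Hlog as [Hsum _].
    destruct (log_euler_sum_spec L z (g z) HRe) as [E _].
    { apply Hsum; [|assumption]. split; [assumption|]. lra. }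
    rewrite <- E, <- Cexp_plus. replace (g z + - g z)%C with (RtoC 0) by ring.
    rewrite Cexp_0. ring. }
intros z Hz. split; [now apply Hder|]. split; [now apply Hne1|].
specialize (Hid z Hz). rewrite Cexp_opp in Hid.
assert (Hn := Cexp_neq0 (g z)).
transitivity (Cexp (g z) * (1 + (L z * / Cexp (g z) - 1)))%C.
- rewrite Hid. ring.
- field. assumption.
Qed.

(** Replacing [log+ C0] by [C0] keeps the final constant linear in the parameters, so that its
    computability needs no logarithm. *)
Lemma logp_le (u : R) : 0 < u -> logp u <= u.
Proof.
intros Hu. apply Rmax_lub; [lra|]. assert (H := exp_ineq1_le (ln u)).
rewrite exp_ln in H by assumption. lra.
Qed.

Lemma exp_1_ge_2 : 2 <= exp 1.
Proof. assert (H := exp_ineq1_le 1). lra. Qed.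

(** The first term makes [h = log log (c|t|)] at least 10. The second places the whole window of
    half-height [H + 3] around [t] above height [T], where the growth bound holds: [H] is at most
    about [|t| / 2 + c]. *)
Definition height_threshold (c T : R) : R := exp (exp 10) + 2 * (T + c + 4).

Lemma height_threshold_spec (c T t : R) : 1 <= c -> exp 1 <= T -> height_threshold c T <= Rabs t ->
  let h := ln (ln (c * Rabs t)) in
  let H := ln (ln (c * (Rabs t + 1))) in
  10 <= h <= H /\ exp h = ln (c * Rabs t) /\ T + H + 3 <= Rabs t.
Proof.
intros Hc HT Ht h H. unfold height_threshold in Ht.
assert (He := exp_1_ge_2). set (tau := Rabs t) in *.
assert (Hee : 0 < exp (exp 10)) by apply exp_pos.
assert (H10 : exp 10 <= ln (c * tau)).
{ rewrite <- (ln_exp (exp 10)). apply ln_mono; [assumption|nra]. }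
assert (H10p : 0 < exp 10) by apply exp_pos.
assert (Hmono : ln (c * tau) <= ln (c * (tau + 1))) by (apply ln_mono; nra).
split; [|split].
- split.
  + unfold h. rewrite <- (ln_exp 10). now apply ln_mono.
  + apply ln_mono; lra.
- unfold h. apply exp_ln. lra.
- assert (E : ln (c * (tau + 1)) = ln c + ln (tau + 1)) by (apply ln_mult; lra).
  assert (E1 := ln_le_self c ltac:(lra)). assert (E2 := ln_le_half (tau + 1) ltac:(lra)).
  assert (E3 := ln_le_self (ln (c * (tau + 1))) ltac:(lra)). unfold H. lra.
Qed.

(** In the window [|Im z| <= 2 |t|], so that [log (c |Im z|)] and its logarithm are both at most
    twice [log (c|t|)]. The outcome is one multiple of [log (c|t|)] whose factor depends on the
    degree, [l] and [C0] only. *)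
Lemma growth_bound_near (L : selbergSP) (C0 l c T t : R) (z : C) :
  0 < C0 -> 0 < l -> 1 <= c -> exp 1 <= T -> growth_bound L C0 l c T ->
  height_threshold c T <= Rabs t ->
  1 / 2 <= Re z -> Rabs (Im z - t) <= ln (ln (c * (Rabs t + 1))) + 3 -> L z <> RtoC 0 ->
  ln (Cmod (L z)) <= (degree L + 2 * l + C0) * ln (c * Rabs t).
Proof.
intros HC0 Hl Hc HT Hgr Ht Hz1 Hz2 Hz3.
destruct (height_threshold_spec c T t Hc HT Ht) as ([H1 H2] & H3 & H4).
cbv zeta in *. set (h := ln (ln (c * Rabs t))) in *. set (H := ln (ln (c * (Rabs t + 1)))) in *.
set (Lam := ln (c * Rabs t)) in *.
assert (He := exp_1_ge_2).
assert (HLam : 1 + h <= Lam) by (rewrite <- H3; apply exp_ineq1_le).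
assert (HI1 : T <= Rabs (Im z)).
{ assert (T1 := Rabs_triang_inv t (t - Im z)). replace (t - (t - Im z)) with (Im z) in T1 by ring.
  rewrite (Rabs_minus_sym t) in T1. lra. }
assert (HI2 : Rabs (Im z) <= 2 * Rabs t).
{ replace (Im z) with ((Im z - t) + t) by ring. eapply Rle_trans; [apply Rabs_triang|]. lra. }
specialize (Hgr z HI1 Hz1 Hz3).
assert (Hl1 : 1 <= ln (c * Rabs (Im z))).
{ rewrite <- (ln_exp 1). apply ln_mono; [apply exp_pos|]. nra. }
assert (Hl2 : ln (c * Rabs (Im z)) <= 2 * Lam).
{ apply Rle_trans with (ln (2 * (c * Rabs t))).
  - apply ln_mono; [apply Rmult_lt_0_compat; lra|nra].
  - rewrite ln_mult; [|lra|apply Rmult_lt_0_compat; lra]. fold Lam.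
    assert (E := ln_le_self 2 ltac:(lra)). lra. }
assert (Hll : ln (ln (c * Rabs (Im z))) <= 2 * Lam).
{ assert (E := ln_le_self (ln (c * Rabs (Im z))) ltac:(lra)). lra. }
assert (Hlp := logp_le C0 HC0).
assert (Hd := degree_ge0 L).
assert (P1 : 1 / 4 * degree L * ln (c * Rabs (Im z)) <= degree L * Lam) by nra.
assert (P2 : l * ln (ln (c * Rabs (Im z))) <= 2 * l * Lam) by nra.
assert (P3 : logp C0 <= C0 * Lam) by nra.
lra.
Qed.

(** The real part of [g] is [log |L|], which the growth bound controls from above; the Euler sum
    gives [|g| <= 2 m] at the centre [2 + iy]. The disc of radius [3/2] just touches [Re z = 1/2],
    and the additive 3 in the height of the region makes room for it around every [y] of the
    window. *)
Lemma log_branch_bound (L : selbergSP) (C0 l c T t C3 : R) (g : C -> C) :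
  0 < C0 -> 0 < l -> 1 <= c -> exp 1 <= T -> growth_bound L C0 l c T ->
  height_threshold c T <= Rabs t -> 1 <= C3 ->
  log_branch L (regionR C3 c t) g ->
  let h := ln (ln (c * Rabs t)) in
  forall z, 1 / 2 + 1 / h <= Re z <= 1 + 4 / h ->
    Rabs (Im z - t) <= ln (ln (c * (Rabs t + 1))) ->
    Cmod (g z) <= 8 * (degree L + 2 * l + C0 + 2 * INR (order L)) * h * exp h.
Proof.
intros HC0 Hl Hc HT Hgr Ht HC3 Hlog h z Hz1 Hz2.
destruct (height_threshold_spec c T t Hc HT Ht) as ([H1 H2] & H3 & H4).
fold h in H1, H2, H3. set (H := ln (ln (c * (Rabs t + 1)))) in *.
set (Lam := ln (c * Rabs t)) in *. rewrite H3.
assert (He := exp_1_ge_2).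
assert (HLam : 1 + h <= Lam) by (rewrite <- H3; apply exp_ineq1_le).
set (y := Im z) in *.
assert (Hy1 : Rabs (y - t) + 3 / 2 <= C3 * H + 3) by nra.
assert (Hy2 : 3 / 2 <= Rabs y).
{ assert (T1 := Rabs_triang_inv t (t - y)). replace (t - (t - y)) with y in T1 by ring.
  rewrite (Rabs_minus_sym t) in T1. lra. }
assert (Hspec := Cexp_log_branch L C3 c t y g Hlog Hy1 Hy2).
set (ctr := (2, y) : C) in *.
destruct (inverse_height h ltac:(lra)) as (Hinv & Hinv4 & Hinv2 & Hhi).
set (e := 1 / h) in *. rewrite Hinv4 in *.
set (m := INR (order L)) in *.
assert (Hm : 1 <= m) by apply one_le_INR, (order_pos L).
assert (Hd := degree_ge0 L).
assert (Hctr : Cmod (g ctr) <= 2 * m).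
{ destruct Hlog as [Hsum _]. destruct (log_euler_sum_spec L ctr (g ctr)) as [_ E].
  - unfold ctr, Re; simpl. lra.
  - apply Hsum; [|unfold ctr, Re; simpl; lra]. split; [unfold ctr, Re; simpl; lra|].
    fold H. unfold ctr, Im; simpl. lra.
  - fold m in E. change (Re ctr) with 2 in E.
    replace (2 * m / (2 - 1)) with (2 * m) in E by field. exact E. }
set (A := (degree L + 2 * l + C0 + 2 * m) * Lam).
assert (HA : 0 < A) by (unfold A; apply Rmult_lt_0_compat; lra).
(* As [z] is at distance at most [3/2 - e] from the centre, the radius [3/2 - e/2] leaves a gap of
   at least [e / 2 = 1 / (2h)]; dividing by this gap produces the factor [h]. *)
assert (HBC := borel_caratheodory (fun w => g w - g ctr)%C ctr (3 / 2 - e / 2) (3 / 2) A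
  ltac:(lra) HA).
assert (Hzc : Cmod (z - ctr) = 2 - Re z).
{ replace (z - ctr)%C with (RtoC (Re z - 2)).
  - rewrite Cmod_R, Rabs_left1; lra.
  - apply Ceq_ext; unfold ctr, y, Re, Im; simpl; ring. }
assert (Hfin : Cmod (g z - g ctr) * (3 / 2 - e / 2 - Cmod (z - ctr)) <= 2 * A * Cmod (z - ctr)).
{ apply HBC.
  - intros w Hw. destruct (Hspec w Hw) as [[l' Hl'] _]. eexists.
    apply cderiv_minus; [exact Hl'|apply cderiv_const].
  - ring.
  - intros w Hw. destruct (Hspec w Hw) as (_ & Hw1 & Hw2).
    assert (Hne : L w <> RtoC 0) by (rewrite <- Hw2; apply Cexp_neq0).
    assert (Hln : ln (Cmod (L w)) = Re (g w)) by (rewrite <- Hw2, Cmod_Cexp; apply ln_exp).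
    apply Cmod_dist_bounds in Hw. change (Re ctr) with 2 in Hw. change (Im ctr) with y in Hw.
    destruct Hw as [Hwr Hwi]. apply Rabs_def2 in Hwr.
    assert (Hb : ln (Cmod (L w)) <= (degree L + 2 * l + C0) * Lam).
    { apply (growth_bound_near L C0 l c T t); try assumption; [lra|].
      fold H. replace (Im w - t) with ((Im w - y) + (y - t)) by ring.
      eapply Rle_trans; [apply Rabs_triang|]. lra. }
    unfold Cminus. rewrite re_plus, re_opp.
    assert (Hc1 := re_le_Cmod (g ctr)). apply Rabs_le_between in Hc1.
    unfold A. nra.
  - rewrite Hzc. lra. }
rewrite Hzc in Hfin.
assert (Hge : e / 2 <= 3 / 2 - e / 2 - (2 - Re z)) by lra.
assert (H0 := Cmod_ge_0 (g z - g ctr)).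
assert (Hf1 : Cmod (g z - g ctr) * (e / 2) <= 3 * A).
{ apply Rle_trans with (Cmod (g z - g ctr) * (3 / 2 - e / 2 - (2 - Re z))).
  - apply Rmult_le_compat_l; lra.
  - apply Rle_trans with (1 := Hfin). nra. }
assert (Hf2 : Cmod (g z - g ctr) <= 6 * A * h).
{ apply Rmult_le_compat_r with (r := 2 * h) in Hf1; [|lra].
  replace (Cmod (g z - g ctr) * (e / 2) * (2 * h)) with (Cmod (g z - g ctr) * (h * e)) in Hf1 by field.
  rewrite Hhi in Hf1. lra. }
assert (T1 := Cmod_triangle_rev (g z) (g ctr)).
assert (HmA : 2 * m <= A) by (unfold A; nra).
replace (8 * (degree L + 2 * l + C0 + 2 * m) * h * Lam) with (8 * A * h) by (unfold A; ring).
nra.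
Qed.

Lemma log_branch_interpolated (L : selbergSP) (C0 l c T t C3 : R) (g : C -> C) :
  0 < C0 -> 0 < l -> 1 <= c -> exp 1 <= T -> growth_bound L C0 l c T ->
  height_threshold c T <= Rabs t -> 1 <= C3 ->
  log_branch L (regionR C3 c t) g ->
  let h := ln (ln (c * Rabs t)) in
  forall s, 1 / 2 + 1 / h <= Re s <= 1 + 4 / h -> Rabs (Im s - t) <= 1 ->
    (exists l, cderiv g s l) /\ L s = Cexp (g s) /\
    Cmod (g s) <= 8 * (degree L + 2 * l + C0 + 2 * INR (order L)) * h * exp 11
                    * exp (2 * h * (1 - Re s)).
Proof.
intros HC0 Hl Hc HT Hgr Ht HC3 Hlog h s Hs1 Hs2.
destruct (height_threshold_spec c T t Hc HT Ht) as ([H1 H2] & H3 & H4).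
fold h in H1, H2, H3. set (H := ln (ln (c * (Rabs t + 1)))) in *.
assert (He := exp_1_ge_2).
destruct (inverse_height h ltac:(lra)) as (Hinv & Hinv4 & Hinv2 & Hhi).
assert (Hd := degree_ge0 L).
assert (Hm : 1 <= INR (order L)) by apply one_le_INR, (order_pos L).
assert (Hpt : forall z, 1 / 2 + 1 / h <= Re z <= 1 + 4 / h -> Rabs (Im z - t) <= H ->
  (exists l, cderiv g z l) /\ L z = Cexp (g z)).
{ intros z Hz1 Hz2. destruct (Cexp_log_branch L C3 c t (Im z) g Hlog) with (z := z) as (P1 & P2 & P3).
  - fold H. nra.
  - assert (T1 := Rabs_triang_inv t (t - Im z)). replace (t - (t - Im z)) with (Im z) in T1 by ring.
    rewrite (Rabs_minus_sym t) in T1. lra.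
  - replace (z - (2, Im z))%C with (RtoC (Re z - 2)).
    + rewrite Cmod_R, Rabs_left1; lra.
    + apply Ceq_ext; unfold Re, Im; simpl; ring.
  - auto. }
destruct (Hpt s Hs1 ltac:(lra)) as [P1 P2]. split; [assumption|]. split; [assumption|].
apply (three_lines_interpolation g t h H); try assumption; [lra|lra| |].
- intros z Hz1 Hz2. split; [now apply Hpt|].
  now apply (log_branch_bound L C0 l c T t C3).
- intros z Hz1 Hz2. destruct Hlog as [Hsum _].
  assert (Hz3 : 1 < Re z) by lra.
  destruct (log_euler_sum_spec L z (g z) Hz3) as [_ E].
  { apply Hsum; [|assumption]. split; [lra|]. fold H. nra. }
  apply Rle_trans with (1 := E). rewrite Hz1.
  replace (2 * INR (order L) / (1 + 4 / h - 1)) with (INR (order L) * h / 2) by (field; lra).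
  apply Rle_trans with (8 * INR (order L) * h).
  + nra.
  + apply Rmult_le_compat_r; lra.
Qed.

(** Near [s] one has [L = exp g], so the logarithmic derivative is [g'], and Cauchy's estimate on a
    disc of radius [1 / (2h)] costs a factor [4h]. *)
Lemma log_derivative_interpolated (L : selbergSP) (C0 l c T t C3 : R) (g : C -> C) :
  0 < C0 -> 0 < l -> 1 <= c -> exp 1 <= T -> growth_bound L C0 l c T ->
  height_threshold c T <= Rabs t -> 1 <= C3 ->
  log_branch L (regionR C3 c t) g ->
  let h := ln (ln (c * Rabs t)) in
  forall sigma, 1 / 2 + 2 / h <= sigma <= 1 + 1 / h ->
    Cmod (C_derive L (sigma, t) / L (sigma, t))
      <= 32 * (degree L + 2 * l + C0 + 2 * INR (order L)) * h ^ 2 * exp 13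
          * exp (2 * h * (1 - sigma)).
Proof.
intros HC0 Hl Hc HT Hgr Ht HC3 Hlog h sigma Hsig.
destruct (height_threshold_spec c T t Hc HT Ht) as ([H1 H2] & H3 & H4).
assert (Hint := log_branch_interpolated L C0 l c T t C3 g HC0 Hl Hc HT Hgr Ht HC3 Hlog).
fold h in H1, H2, H3, Hint. cbv zeta in Hint.
destruct (inverse_height h ltac:(lra)) as (Hinv & Hinv4 & Hinv2 & Hhi).
assert (Hd := degree_ge0 L).
assert (Hm : 1 <= INR (order L)) by apply one_le_INR, (order_pos L).
set (e := 1 / h) in *. rewrite Hinv4, ?Hinv2 in *.
set (M := 8 * (degree L + 2 * l + C0 + 2 * INR (order L))) in *.
assert (HM : 0 <= M) by (unfold M; lra).
set (s := (sigma, t) : C).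
assert (Hdisc : forall z r, Cmod (z - s) < r -> r <= 1 ->
   sigma - r < Re z < sigma + r /\ Rabs (Im z - t) <= 1).
{ intros z r Hz Hr. apply Cmod_dist_bounds in Hz.
  change (Re s) with sigma in Hz. change (Im s) with t in Hz.
  destruct Hz as [Hz1 Hz2]. apply Rabs_def2 in Hz1. lra. }
assert (Hball : forall z, Cmod (z - s) < e ->
   1 / 2 + e <= Re z <= 1 + 4 * e /\ Rabs (Im z - t) <= 1).
{ intros z Hz. destruct (Hdisc z e Hz ltac:(lra)). split; lra. }
assert (Hss : Cmod (s - s) = 0) by (replace (s - s)%C with (RtoC 0) by ring; apply Cmod_0).
destruct (Hint s) as ([m Hgm] & HLs & _).
{ destruct (Hball s ltac:(lra)). lra. } { destruct (Hball s ltac:(lra)). lra. }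
assert (HLd : cderiv L s (Cexp (g s) * m)%C).
{ apply (cderiv_local (fun z => Cexp (g z)) L s _ e); [lra| |].
  - intros z Hz. symmetry. destruct (Hball z Hz). now apply Hint.
  - apply (cderiv_comp Cexp); [exact Hgm|apply cderiv_Cexp]. }
apply cderiv_is_derive, is_C_derive_unique in HLd. rewrite HLd, HLs.
replace (Cexp (g s) * m / Cexp (g s))%C with m by (field; apply Cexp_neq0).
(* On a disc of radius below [1/h] the real part drops by less than [1/h], which raises the exponent
   by at most 2; this is the passage from [exp 11] to [exp 13]. *)
set (B := M * h * exp 11 * exp (2 * h * (1 - sigma) + 2)).
assert (Hmb : Cmod m <= 2 * B / (e / 2)).
{ apply (cauchy_derivative_bound g s m (e / 2) e); [lra| | |assumption].
  - intros z Hz. destruct (Hball z Hz). now apply Hint.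
  - intros z Hz. destruct (Hball z ltac:(lra)) as [Hz1 Hz2].
    destruct (Hint z Hz1 Hz2) as (_ & _ & Hb). apply Rle_trans with (1 := Hb).
    unfold B. apply Rmult_le_compat_l.
    + apply Rmult_le_pos; [apply Rmult_le_pos; lra|left; apply exp_pos].
    + apply exp_le_compat. destruct (Hdisc z e ltac:(lra) ltac:(lra)). nra. }
apply Rle_trans with (1 := Hmb). right. unfold B, M.
replace (2 * h * (1 - sigma) + 2) with (2 + 2 * h * (1 - sigma)) by ring.
rewrite exp_plus. replace (exp 13) with (exp 11 * exp 2) by (rewrite <- exp_plus; f_equal; ring).
assert (He : e = / h) by (unfold e; field; lra). rewrite He. field. lra.
Qed.

(** A common constant for both estimates. The larger of the two is [32 exp 13 (d + 2l + C0 + 2m)],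
    where [exp 13 <= 4^13 = 2^26] and doubling evens out the coefficients: [5 + 26 + 1 = 32]. A
    power of two turns the evaluation into a shift of the binary approximations. *)
Definition leading_constant (d : R) (m : nat) (l C0 : R) : R := 2 ^ 32 * (1 + d + INR m + l + C0).

Lemma exp_13_le : exp 13 <= 2 ^ 26.
Proof.
replace 13 with (INR 13 * 1) by (simpl; ring).
assert (H := exp_le_3). assert (H0 := exp_pos 1).
replace (exp (INR 13 * 1)) with (exp 1 ^ 13).
- apply Rle_trans with (4 ^ 13); [apply pow_incr; lra|]. simpl. lra.
- rewrite <- Rpower_pow by assumption. unfold Rpower. now rewrite ln_exp.
Qed.

Theorem log_lfun_bounds (L : selbergSP) (C0 l c T t C3 : R) (g : C -> C) (sigma : R) :
  0 < C0 -> 0 < l -> 1 <= c -> exp 1 <= T -> growth_bound L C0 l c T ->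
  height_threshold c T <= Rabs t -> 1 <= C3 ->
  log_branch L (regionR C3 c t) g -> intervalS 2 1 c t sigma ->
  let a := leading_constant (degree L) (order L) l C0 in
  Cmod (g (sigma, t)) <=
    a * Rpower (1 * ln (c * Rabs t)) (2 * (1 - sigma)) * ln (ln (c * Rabs t)) /\
  Cmod (C_derive L (sigma, t) / L (sigma, t)) <=
    a * Rpower (1 * ln (c * Rabs t)) (2 * (1 - sigma)) * ln (ln (c * Rabs t)) ^ 2.
Proof.
intros HC0 Hl Hc HT Hgr Ht HC3 Hlog Hsig a.
destruct (height_threshold_spec c T t Hc HT Ht) as ([H1 H2] & H3 & H4).
assert (HD := log_derivative_interpolated L C0 l c T t C3 g HC0 Hl Hc HT Hgr Ht HC3 Hlog sigma Hsig).
assert (HI := log_branch_interpolated L C0 l c T t C3 g HC0 Hl Hc HT Hgr Ht HC3 Hlog (sigma, t)).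
cbv zeta in HD, HI. unfold intervalS in Hsig. unfold Rpower. rewrite Rmult_1_l.
set (h := ln (ln (c * Rabs t))) in *.
destruct (inverse_height h ltac:(lra)) as (Hinv & Hinv4 & Hinv2 & _).
destruct HI as (_ & _ & HI).
{ change (Re (sigma, t)) with sigma. lra. }
{ change (Im (sigma, t)) with t. rewrite Rminus_diag, Rabs_R0. lra. }
change (Re (sigma, t)) with sigma in HI.
assert (Hd := degree_ge0 L).
assert (Hm := pos_INR (order L)).
assert (He13 := exp_13_le).
assert (He11 : exp 11 <= exp 13) by (apply exp_le_compat; lra).
assert (H0 := exp_pos 11).
set (D := degree L + 2 * l + C0 + 2 * INR (order L)) in *.
assert (HD0 : 0 <= D) by (unfold D; lra).
assert (Ha : 32 * D * exp 13 <= a).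
{ unfold a, leading_constant. apply Rle_trans with (2 ^ 32 / 2 * D).
  - replace (2 ^ 32 / 2 * D) with (32 * D * 2 ^ 26) by (simpl; field).
    apply Rmult_le_compat_l; lra.
  - unfold D. simpl. lra. }
assert (Ha' : 8 * D * exp 11 <= a).
{ apply Rle_trans with (2 := Ha). nra. }
replace (2 * h * (1 - sigma)) with (2 * (1 - sigma) * h) in * by ring.
set (E := exp (2 * (1 - sigma) * h)) in *.
assert (HE : 0 < E) by apply exp_pos.
assert (HEh : 0 < E * h) by (apply Rmult_lt_0_compat; lra).
split.
- apply Rle_trans with (1 := HI).
  replace (8 * D * h * exp 11 * E) with (8 * D * exp 11 * (E * h)) by ring.
  rewrite (Rmult_assoc a). apply Rmult_le_compat_r; lra.
- apply Rle_trans with (1 := HD).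
  replace (32 * D * h ^ 2 * exp 13 * E) with (32 * D * exp 13 * (E * h ^ 2)) by ring.
  rewrite (Rmult_assoc a). apply Rmult_le_compat_r; [|lra].
  left. apply Rmult_lt_0_compat; [lra|apply pow_lt; lra].
Qed.

(** * Computability of the constants *)

Lemma recursive_ext (f g : list nat -> nat) : recursive f -> (forall v, f v = g v) -> recursive g.
Proof. intros H E. now replace g with f by (apply functional_extensionality, E). Qed.

Lemma recursive_comp1 (F : nat -> nat) (f : list nat -> nat) :
  recursive (fun v => F (nth 0 v 0%nat)) -> recursive f -> recursive (fun v => F (f v)).
Proof.
intros HF Hf. exact (rec_comp _ [f] HF (Forall_cons _ Hf (Forall_nil _))).
Qed.

Lemma recursive_comp2 (F : nat -> nat -> nat) (f g : list nat -> nat) :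
  recursive (fun v => F (nth 0 v 0%nat) (nth 1 v 0%nat)) -> recursive f -> recursive g ->
  recursive (fun v => F (f v) (g v)).
Proof.
intros HF Hf Hg.
exact (rec_comp _ [f; g] HF (Forall_cons _ Hf (Forall_cons _ Hg (Forall_nil _)))).
Qed.

Lemma recursive_S (f : list nat -> nat) : recursive f -> recursive (fun v => S (f v)).
Proof. apply (recursive_comp1 S), rec_succ. Qed.

Lemma recursive_const (c : nat) : recursive (fun _ => c).
Proof. induction c as [|c IH]; [apply rec_zero|now apply (recursive_S (fun _ => c))]. Qed.

Lemma recursive_add (f g : list nat -> nat) :
  recursive f -> recursive g -> recursive (fun v => f v + g v)%nat.
Proof.
apply (recursive_comp2 Nat.add).
apply (recursive_ext (fun v => nat_rect (fun _ => nat) (nth 0 (tl v) 0%nat)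
   (fun k r => S (nth 1 (k :: r :: tl v) 0%nat)) (nth 0 v 0%nat))).
- exact (rec_prim _ _ (rec_proj 0) (recursive_S _ (rec_proj 1))).
- intros [|x v]; simpl; [reflexivity|]. destruct v as [|y v]; simpl; induction x; simpl in *; lia.
Qed.

Lemma recursive_mul (f g : list nat -> nat) :
  recursive f -> recursive g -> recursive (fun v => f v * g v)%nat.
Proof.
apply (recursive_comp2 Nat.mul).
apply (recursive_ext (fun v => nat_rect (fun _ => nat) 0%nat
   (fun k r => nth 2 (k :: r :: tl v) 0 + nth 1 (k :: r :: tl v) 0)%nat (nth 0 v 0%nat))).
- exact (rec_prim _ _ rec_zero (recursive_add _ _ (rec_proj 2) (rec_proj 1))).
- intros [|x v]; simpl; [reflexivity|]. destruct v as [|y v]; simpl; induction x; simpl in *; lia.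
Qed.

Lemma recursive_pred (f : list nat -> nat) : recursive f -> recursive (fun v => pred (f v)).
Proof.
apply (recursive_comp1 pred).
apply (recursive_ext (fun v => nat_rect (fun _ => nat) 0%nat
   (fun k r => nth 0 (k :: r :: tl v) 0%nat) (nth 0 v 0%nat))).
- exact (rec_prim _ _ rec_zero (rec_proj 0)).
- intros v. destruct (nth 0 v 0%nat); reflexivity.
Qed.

(** Primitive recursion runs on the first argument, which has to be the subtrahend; hence the
    exchanged order in the composition. *)
Lemma recursive_sub (f g : list nat -> nat) :
  recursive f -> recursive g -> recursive (fun v => f v - g v)%nat.
Proof.
intros Hf Hg. apply (recursive_comp2 (fun y x => x - y)%nat g f); [|assumption|assumption].
apply (recursive_ext (fun v => nat_rect (fun _ => nat) (nth 0 (tl v) 0%nat)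
   (fun k r => pred (nth 1 (k :: r :: tl v) 0%nat)) (nth 0 v 0%nat))).
- exact (rec_prim _ _ (rec_proj 0) (recursive_pred _ (rec_proj 1))).
- intros [|x v]; simpl; [reflexivity|]. destruct v as [|y v]; simpl; induction x; simpl in *; lia.
Qed.

Lemma recursive_pow2 (f : list nat -> nat) : recursive f -> recursive (fun v => 2 ^ f v)%nat.
Proof.
apply (recursive_comp1 (Nat.pow 2)).
apply (recursive_ext (fun v => nat_rect (fun _ => nat) 1%nat
   (fun k r => nth 1 (k :: r :: tl v) 0 + nth 1 (k :: r :: tl v) 0)%nat (nth 0 v 0%nat))).
- exact (rec_prim _ _ (recursive_const 1) (recursive_add _ _ (rec_proj 1) (rec_proj 1))).
- intros v. induction (nth 0 v 0%nat) as [|x IH]; [reflexivity|]. simpl in *. lia.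
Qed.

(** The quotient is found by minimization: it is the least [q] with [a + 1 <= (b + 1)(q + 1)], that
    is, the first zero of a truncated difference. The successor in the divisor makes the search
    succeed for all arguments. *)
Lemma recursive_div_S (f g : list nat -> nat) :
  recursive f -> recursive g -> recursive (fun v => f v / S (g v))%nat.
Proof.
apply (recursive_comp2 (fun a b => a / S b)%nat).
apply (rec_min (fun w => S (nth 1 w 0) - S (nth 2 w 0) * S (nth 0 w 0))%nat).
- apply recursive_sub; [apply recursive_S, rec_proj|].
  apply recursive_mul; apply recursive_S, rec_proj.
- intros v. cbn [nth]. set (a := nth 0 v 0%nat). set (b := nth 1 v 0%nat).
  assert (H1 := Nat.div_mod_eq a (S b)). assert (H2 := Nat.mod_upper_bound a (S b) ltac:(lia)).
  split; [nia|]. intros k Hk. nia.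
Qed.

(* With inputs of precision 2^-k and [k >= n + 35], the sum of the numerators is divided by
   2^(k-n-32), rounding to the nearest integer. *)
Definition leading_constant_algorithm (v : list nat) : nat :=
  let n := nth 0 v 0%nat in let k := nth 1 v 0%nat in let m := nth 2 v 0%nat in
  let j := (k - (n + 35))%nat in
  ((1 - ((n + 35) - k)) *
   S ((nth 3 v 0 + nth 4 v 0 + nth 5 v 0 + (1 + m) * 2 ^ k + 2 ^ (j + 2))
      / S (pred (2 ^ (j + 3)))))%nat.

Lemma recursive_leading_constant_algorithm : recursive leading_constant_algorithm.
Proof.
unfold leading_constant_algorithm. cbv zeta.
repeat first [apply recursive_mul | apply recursive_S | apply recursive_div_S | apply recursive_add
  | apply recursive_sub | apply recursive_pred | apply recursive_pow2
  | apply rec_proj | apply recursive_const].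
Qed.

(** The factor [1 - (n + 35 - k)] in the algorithm is 0 exactly when [k < n + 35], which asks for
    more precision. The surplus 35 is 32 for the factor [2^32] and 3 more bits, so that the three
    input errors together stay below [3/8] of the tolerance while rounding takes [1/2]. *)
Lemma computable_leading_constant : computable_constant leading_constant.
Proof.
split.
{ intros d m l C0 (H1 & H2 & H3 & H4). unfold leading_constant.
  assert (H := pos_INR m). apply Rmult_lt_0_compat; [apply pow_lt; lra|lra]. }
exists leading_constant_algorithm. split; [apply recursive_leading_constant_algorithm|].
intros d m l C0 _ n. split.
- intros k p1 p2 p3 q H1 H2 H3 Hq. unfold leading_constant_algorithm in Hq. cbn [nth] in Hq.
  destruct (Nat.le_gt_cases (n + 35) k) as [Hk|Hk].
  2:{ replace (1 - (n + 35 - k))%nat with 0%nat in Hq by lia. discriminate. }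
  replace (n + 35 - k)%nat with 0%nat in Hq by lia.
  set (j := (k - (n + 35))%nat) in *.
  rewrite Nat.sub_0_r, Nat.mul_1_l in Hq. apply eq_add_S in Hq.
  assert (HD : S (pred (2 ^ (j + 3))) = (2 ^ (j + 3))%nat).
  { assert (H := Nat.pow_nonzero 2 (j + 3) ltac:(lia)). lia. }
  rewrite HD in Hq. clear HD.
  set (N := (p1 + p2 + p3 + (1 + m) * 2 ^ k + 2 ^ (j + 2))%nat) in *.
  assert (Q1 := Nat.div_mod_eq N (2 ^ (j + 3))).
  assert (Q2 := Nat.mod_upper_bound N (2 ^ (j + 3)) (Nat.pow_nonzero 2 (j + 3) ltac:(lia))).
  rewrite Hq in Q1.
  assert (L1 : (2 ^ (j + 3) * q <= N)%nat) by lia.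
  assert (L2 : (N <= 2 ^ (j + 3) * q + 2 ^ (j + 3))%nat) by lia.
  clear Q1 Q2 Hq.
  apply le_INR in L1. apply le_INR in L2. unfold N in L1, L2.
  repeat (rewrite plus_INR in L1 || rewrite mult_INR in L1 || rewrite pow_INR in L1).
  repeat (rewrite plus_INR in L2 || rewrite mult_INR in L2 || rewrite pow_INR in L2).
  change (INR 2) with 2 in *. change (INR 1) with 1 in *.
  unfold approximates, leading_constant in *.
  set (K := 2 ^ k) in *.
  assert (HJ : 0 < 2 ^ j) by (apply pow_lt; lra).
  assert (Hn : 0 < 2 ^ n) by (apply pow_lt; lra).
  assert (EK : K = 2 ^ j * 2 ^ n * 2 ^ 35).
  { unfold K. rewrite <- !pow_add. f_equal. unfold j. lia. }
  assert (HK : 0 < K) by (apply pow_lt; lra).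
  assert (B : forall p x, Rabs (x - INR p / K) <= / K -> INR p - 1 <= x * K <= INR p + 1).
  { intros p x Hx. apply Rabs_le_between in Hx.
    assert (E1 : / K * K = 1) by (field; lra).
    assert (E2 : INR p / K * K = INR p) by (field; lra).
    split; nra. }
  apply B in H1. apply B in H2. apply B in H3. clear B.
  rewrite !pow_add in L1. rewrite !pow_add in L2.
  set (J := 2 ^ j) in *. set (Nn := 2 ^ n) in *.
  assert (HX : (1 + d + INR m + l + C0) * K
     = d * K + l * K + C0 * K + (1 + INR m) * K) by ring.
  set (X := 1 + d + INR m + l + C0) in *.
  (* Each of the three numerators is off by at most 1 and rounding by at most half the divisor,
     [4 J]; in total [3 + 4 J <= 8 J], as [J >= 1]. *)
  assert (M1 : Rabs (X * K - INR q * (J * 8)) <= J * 8).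
  { assert (HJ1 : 1 <= J) by (unfold J; apply pow_R1_Rle; lra).
    replace (2 ^ 2) with 4 in * by ring. replace (2 ^ 3) with 8 in * by ring.
    clearbody J K X Nn. apply Rabs_le. lra. }
  replace (2 ^ 32 * X - INR q / Nn) with ((X * K - INR q * (J * 8)) / (J * 8 * Nn)).
  + unfold Rdiv. rewrite Rabs_mult, (Rabs_pos_eq (/ (J * 8 * Nn))).
    * apply Rle_trans with (J * 8 * / (J * 8 * Nn)).
      -- apply Rmult_le_compat_r; [left; apply Rinv_0_lt_compat; nra|exact M1].
      -- right. field. lra.
    * left. apply Rinv_0_lt_compat. nra.
  + rewrite EK. simpl. field. lra.
- exists (n + 35)%nat. intros k p1 p2 p3 Hk _ _ _. unfold leading_constant_algorithm. cbn [nth].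
  replace (n + 35 - k)%nat with 0%nat by lia. rewrite Nat.sub_0_r, Nat.mul_1_l. discriminate.
Qed.

Lemma computable_one : computable_constant (fun _ _ _ _ => 1).
Proof.
split; [intros; lra|].
exists (fun v => S (2 ^ nth 0 v 0)%nat). split; [apply recursive_S, recursive_pow2, rec_proj|].
intros d m l C0 _ n. split.
- intros k p1 p2 p3 q _ _ _ Hq. cbn [nth] in Hq. apply eq_add_S in Hq. subst q.
  unfold approximates. rewrite pow_INR. change (INR 2) with 2.
  assert (Hn : 0 < 2 ^ n) by (apply pow_lt; lra).
  replace (1 - 2 ^ n / 2 ^ n) with 0 by (field; lra).
  rewrite Rabs_R0. left. now apply Rinv_0_lt_compat.
- exists 0%nat. intros. discriminate.
Qed.

Theorem theorem1 :
  (forall L : selbergSP,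
     exists C0 l c T : R,
       0 < C0 /\ 0 < l /\ 1 <= c /\ exp 1 <= T /\ growth_bound L C0 l c T) /\
  (exists (a1 b1 a2 b2 : R -> nat -> R -> R -> R) (A B : R) (t0 : R -> R -> R),
     computable_constant a1 /\ computable_constant b1 /\
     computable_constant a2 /\ computable_constant b2 /\
     0 < A /\ 0 < B /\
     (forall c T : R, 1 <= c -> exp 1 <= T -> 0 < t0 c T) /\
     forall (L : selbergSP) (C0 l c T : R),
       0 < C0 -> 0 < l -> 1 <= c -> exp 1 <= T -> growth_bound L C0 l c T ->
       forall t : R, t0 c T <= Rabs t ->
       forall C3 : R, 1 <= C3 ->
         (forall z : C, regionR C3 c t z -> L z <> RtoC 0) ->
       forall logL : C -> C, log_branch L (regionR C3 c t) logL ->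
       forall sigma : R, intervalS A B c t sigma ->
         let d := degree L in
         let m := order L in
         let s : C := (sigma, t) in
         Cmod (logL s) <=
           a1 d m l C0 * Rpower (b1 d m l C0 * ln (c * Rabs t)) (2 * (1 - sigma))
             * ln (ln (c * Rabs t)) /\
         Cmod (C_derive L s / L s) <=
           a2 d m l C0 * Rpower (b2 d m l C0 * ln (c * Rabs t)) (2 * (1 - sigma))
             * ln (ln (c * Rabs t)) ^ 2).
Proof.
split; [apply growth_bound_exists|].
(* [A = 2] and [B = 1] leave room for a disc of radius [1/h] about [s] inside the strip from
   [1/2 + 1/h] to [1 + 4/h], on which the logarithm has been interpolated. *)
exists leading_constant, (fun _ _ _ _ => 1), leading_constant, (fun _ _ _ _ => 1), 2, 1,
  height_threshold.
split; [apply computable_leading_constant|]. split; [apply computable_one|].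
split; [apply computable_leading_constant|]. split; [apply computable_one|].
split; [lra|]. split; [lra|]. split.
- intros c T Hc HT. unfold height_threshold.
  assert (H := exp_pos (exp 10)). assert (H' := exp_pos 1). lra.
- intros L C0 l c T HC0 Hl Hc HT Hgr t Ht C3 HC3 _ logL Hlog sigma Hsig.
  now apply (log_lfun_bounds L C0 l c T t C3 logL sigma).
Qed.
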